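(* Let $k$ be an algebraically closed field of characteristic $2$ and let $G$ be a finite group of even order. Let $M$ be an indecomposable $kG$-module which has symmetric type and let $T$ be a symmetric vertex of $M$. Then $T$ contains a Green vertex $V$ of $M$ and $[T:V]\leq 2$. More precisely, exactly one of the following is true: (i) $M$ has a $G$-form which is non-degenerate on a direct summand of $\mathrm{Res}_V^G M$ that is a source of $M$. Then $T=V$ and $M$ is in the principal $2$-block of $G$. (ii) The sources of $M$ are self-dual, but each $G$-form on $M$ is degenerate on any direct summand of $\mathrm{Res}_V^G M$ that is a source of $M$. Then $[T:V]=2$. (iii) The sources of $M$ are not self-dual. Then $[T:V]=2$.
   Context: All modules are finite-dimensional left modules. A $G$-form on a $kG$-module $M$ is a non-degenerate $G$-invariant symmetric bilinear form $B:M\times M\to k$ (as $\mathrm{char}(k)=2$, this includes symplectic forms, i.e. those with $B(m,m)=0$ for all $m$); then $(M,B)$ is called a symmetric $kG$-module and $M$ is said to have symmetric type. A kG-isometry is a $kG$-homomorphism preserving the forms; $(L,B_L)$ is a component of $(M,B)$ if there is a $kG$-isometry $(L,B_L)\to(M,B)$ (its image is then an orthogonal direct summand). For $H\le G$ and a symmetric $kH$-module $(L,B_L)$, $\mathrm{Ind}_H^G(L,B_L)$ is $\mathrm{Ind}_H^G L$ with the induced $G$-form $B_L^G(g_1\otimes \ell_1,g_2\otimes \ell_2)=B_L(g_2^{-1}g_1\ell_1,\ell_2)$ if $g_1H=g_2H$ and $0$ otherwise. A $G$-form $B$ on $M$ is $H$-projective if $(M,B)$ is a component of $\mathrm{Ind}_H^G(L,B_L)$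 for some symmetric $kH$-module $(L,B_L)$. $M$ is symmetrically $H$-projective if it affords an $H$-projective $G$-form. If $M$ is indecomposable, a symmetric vertex of $M$ is a subgroup $T$ of $G$ that is minimal (under inclusion) subject to $M$ being symmetrically $T$-projective. A Green vertex $V$ of an indecomposable $kG$-module $M$ is a subgroup minimal subject to $M$ being isomorphic to a direct summand of $\mathrm{Ind}_V^G L$ for some $kV$-module $L$; a ($V$-)source of $M$ is an indecomposable $kV$-module $Z$ such that $M$ is isomorphic to a direct summand of $\mathrm{Ind}_V^G Z$. A module is self-dual if it is isomorphic to its dual. The principal $2$-block of $G$ is the block of $kG$ containing the trivial module. *)

(* Defs.v *)
From HB Require Import structures.
From mathcomp Require Import all_boot all_order all_algebra all_fingroup.
From mathcomp Require Import mxrepresentation character.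

Set Implicit Arguments.
Unset Strict Implicit.
Unset Printing Implicit Defensive.
Import GRing.Theory GroupScope.
Local Open Scope ring_scope.

(* A finite-dimensional left kG-module is M : representation k G acting on    *)
(* the column vectors 'cV_(rdegree M) by g v := M g *m v.  A linear map       *)
(* M -> N is a matrix with rdegree N rows and rdegree M columns, and a        *)
(* bilinear form on M is given by its Gram matrix.  Over columns, a witness   *)
(* of mx_rsim M N is a matrix of an isomorphism N -> M, so mx_rsim is         *)
(* isomorphism of left modules.                                               *)

Section Modules.

Variables (k : fieldType) (gT : finGroupType) (G : {group gT}).
Implicit Types M N L : representation k G.

Definition kG_hom M N (f : 'M[k]_(rdegree N, rdegree M)) : Prop :=
  forall g, g \in G -> f *m M g = N g *m f.

Definition indecomposable M : Prop :=
  (0 < rdegree M)%N /\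
  forall L1 L2, mx_rsim M (dadd_grepr L1 L2) ->
    rdegree L1 = 0%N \/ rdegree L2 = 0%N.

(* M is isomorphic to a direct summand of N. *)
Definition is_summand_of M N : Prop :=
  exists L, mx_rsim N (dadd_grepr M L).

(* i is injective and N is the direct sum of i(M) and of a submodule j(L). *)
Definition summand_embedding M N (i : 'M[k]_(rdegree N, rdegree M)) : Prop :=
  kG_hom i /\
  exists L (j : 'M[k]_(rdegree N, rdegree L)),
    [/\ kG_hom j, row_free (row_mx i j) & row_full (row_mx i j)].

(* Coordinates are taken in the dual basis: (g f)(v) = f (g^-1 v). *)
Lemma dual_mx_repr M : mx_repr G (fun g => (M g^-1%g)^T).
Proof.
split=> [|x y Gx Gy]; first by rewrite invg1 repr_mx1 trmx1.
by rewrite invMg repr_mxM ?groupV // trmx_mul.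
Qed.

Definition dual_repr M : representation k G :=
  Representation (MxRepresentation (dual_mx_repr M)).

Definition self_dual M : Prop := mx_rsim M (dual_repr M).

Lemma trivial_mx_repr : mx_repr G (fun _ : gT => 1%:M : 'M[k]_1).
Proof. by split=> // x y _ _; rewrite mulmx1. Qed.

Definition trivial_repr : representation k G :=
  Representation (MxRepresentation trivial_mx_repr).

Definition Res (H : {group gT}) (sHG : H \subset G) M : representation k H :=
  Representation (subg_repr M sHG).

End Modules.

Section Forms.

Variable k : fieldType.

Definition bform n (B : 'M[k]_n) (u v : 'cV[k]_n) : k := (u^T *m B *m v) 0 0.

Definition nondegenerate n (B : 'M[k]_n) : Prop :=
  forall u, (forall v, bform B u v = 0) -> u = 0.

(* For injective i : the restriction of B to the image of i is               *)
(* non-degenerate.                                                            *)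
Definition nondegenerate_on n m (B : 'M[k]_n) (i : 'M[k]_(n, m)) : Prop :=
  forall u, (forall v, bform B (i *m u) (i *m v) = 0) -> u = 0.

Variables (gT : finGroupType) (G : {group gT}).
Implicit Types M N : representation k G.

Definition G_form M (B : 'M[k]_(rdegree M)) : Prop :=
  [/\ nondegenerate B,
      forall u v, bform B u v = bform B v u
    & forall g u v, g \in G -> bform B (M g *m u) (M g *m v) = bform B u v].

Definition symmetric_type M : Prop := exists B, G_form (M := M) B.

Definition kG_isometry M (B : 'M[k]_(rdegree M)) N (C : 'M[k]_(rdegree N))
    (f : 'M[k]_(rdegree N, rdegree M)) : Prop :=
  kG_hom f /\ forall u v, bform C (f *m u) (f *m v) = bform B u v.

Definition component M (B : 'M[k]_(rdegree M)) N (C : 'M[k]_(rdegree N)) : Prop :=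
  exists f, kG_isometry B C f.

End Forms.

(* Ind_H^G L = kG (x)_(kH) L has the basis t_i (x) e_a, where t_i runs over   *)
(* representatives of the left cosets of H in G and e_a over the standard     *)
(* basis of L; coordinates are grouped in blocks indexed by i.                *)
Section Induction.

Variables (k : fieldType) (gT : finGroupType) (G H : {group gT}).
Hypothesis sHG : H \subset G.
Variable L : representation k H.

Local Notation ncos := #|lcosets H G|.
Local Notation ind_deg := (\sum_(i < ncos) rdegree L)%N.

Definition coset_repr (i : 'I_ncos) : gT := repr (enum_val i).
Local Notation t := coset_repr.

Definition ind_block (x : gT) : 'M[k]_(rdegree L) :=
  if x \in H then L x else 0.

(* The linear map L -> Ind_H^G L, v |-> g (x) v. *)
Definition ind_tensor (g : gT) : 'M[k]_(ind_deg, rdegree L) :=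
  \mxcol_(i < ncos) ind_block ((t i)^-1 * g)%g.

(* g (t_j (x) v) = (g t_j) (x) v. *)
Definition ind_mx (g : gT) : 'M[k]_ind_deg :=
  \mxrow_(j < ncos) ind_tensor (g * t j)%g.

Lemma coset_reprP i : t i \in G /\ enum_val i = (t i *: H)%g.
Proof.
have := enum_valP i => /lcosetsP[x Gx def_i].
have Ht: t i \in (x *: H)%g by rewrite /t def_i (mem_repr x) ?lcoset_refl.
split; last by rewrite def_i; apply/lcoset_eqP; rewrite lcoset_sym.
move: Ht; rewrite mem_lcoset => /(subsetP sHG) Gy.
by rewrite -(mulKVg x (t i)) groupM.
Qed.

Lemma mem_coset_repr i (g : gT) : ((t i)^-1 * g \in H)%g = (enum_val i == (g *: H)%g).
Proof.
rewrite -mem_lcoset (proj2 (coset_reprP i)) lcoset_sym.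
by apply/idP/eqP => [/lcoset_eqP->|/lcoset_eqP].
Qed.

Lemma ind_blockM x y : y \in H -> ind_block (x * y)%g = ind_block x *m L y.
Proof.
move=> Hy; rewrite /ind_block groupMr //.
by case: ifP => Hx; rewrite ?mul0mx // repr_mxM.
Qed.

Lemma ind_block_sum a g : g \in G ->
  \sum_j ind_block (a * t j)%g *m ind_block ((t j)^-1 * g)%g
    = ind_block (a * g)%g.
Proof.
move=> Gg; have Cg: (g *: H)%g \in lcosets H G by apply/lcosetsP; exists g.
pose j0 := enum_rank_in Cg (g *: H)%g.
have ej0: enum_val j0 = (g *: H)%g by rewrite enum_rankK_in.
have Hj0: ((t j0)^-1 * g)%g \in H by rewrite mem_coset_repr ej0.
rewrite (bigD1 j0) //= big1 ?addr0 => [|j ne_j].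
  by rewrite {2}/ind_block Hj0 -ind_blockM // -!mulgA mulKVg.
rewrite {2}/ind_block mem_coset_repr -ej0 (inj_eq enum_val_inj) (negPf ne_j).
by rewrite mulmx0.
Qed.


Lemma ind_tensor_basis : \mxrow_j ind_tensor (t j) = 1%:M.
Proof.
rewrite -mxblockEh -mxdiagZ; apply: eq_mxblock => i j.
rewrite /ind_block mem_coset_repr -(proj2 (coset_reprP j)).
rewrite (inj_eq enum_val_inj); case: eqVneq => // ->.
by rewrite mulVg repr_mx1 conform_mx_id.
Qed.

Lemma ind_tensorM g h : h \in H -> ind_tensor (g * h)%g = ind_tensor g *m L h.
Proof.
move=> Hh; rewrite mxcol_mul; apply: eq_mxcol => i.
by rewrite mulgA ind_blockM.
Qed.

Lemma ind_mx_tensor g g' : g' \in G ->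
  ind_mx g *m ind_tensor g' = ind_tensor (g * g')%g.
Proof.
move=> Gg'; rewrite /ind_mx -mxblockEh mul_mxblock_mxrow.
apply: eq_mxcol => i; under eq_bigr => j _ do rewrite !mulgA.
by rewrite ind_block_sum // mulgA.
Qed.

Lemma ind_mx_repr : mx_repr G ind_mx.
Proof.
split=> [|x y Gx Gy].
  by rewrite -ind_tensor_basis; apply: eq_mxrow => j; rewrite mul1g.
rewrite [ind_mx y]/ind_mx mul_mxrow; apply: eq_mxrow => j.
by rewrite ind_mx_tensor ?mulgA // groupM //; case: (coset_reprP j).
Qed.

Definition Ind : representation k G :=
  Representation (MxRepresentation ind_mx_repr).

(* The blocks t_i (x) L are pairwise orthogonal isometric copies of L; see    *)
(* ind_formE for the values on arbitrary tensors.                             *)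
Definition ind_form (B : 'M[k]_(rdegree L)) : 'M[k]_(rdegree Ind) :=
  \mxdiag_(i < ncos) B.

Lemma ind_formE (B : 'M[k]_(rdegree L)) g1 g2 u v :
    G_form (M := L) B -> g1 \in G -> g2 \in G ->
  bform (ind_form B) (ind_tensor g1 *m u) (ind_tensor g2 *m v)
    = if (g1 *: H == g2 *: H)%g then bform B (L (g2^-1 * g1)%g *m u) v else 0.
Proof.
case=> _ _ invB Gg1 Gg2; rewrite /bform /ind_form !trmx_mul -!mulmxA.
rewrite (mulmxA _ (ind_tensor g2)) mul_mxdiag_mxcol tr_mxcol.
rewrite mxcol_mul mul_mxrow_mxcol mulmx_sumr summxE.
have Cg: (g2 *: H)%g \in lcosets H G by apply/lcosetsP; exists g2.
pose j0 := enum_rank_in Cg (g2 *: H)%g.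
have ej0: enum_val j0 = (g2 *: H)%g by rewrite enum_rankK_in.
have [Gt _] := coset_reprP j0.
have H2: ((t j0)^-1 * g2)%g \in H by rewrite mem_coset_repr ej0.
rewrite (bigD1 j0) //= big1 ?addr0 => [|j ne_j]; last first.
  rewrite [ind_block (_ * g2)]/ind_block mem_coset_repr -ej0.
  rewrite (inj_eq enum_val_inj) (negPf ne_j).
  by rewrite !(mulmx0, mul0mx) mxE.
have -> : ((t j0)^-1 * g1 = ((t j0)^-1 * g2) * (g2^-1 * g1))%g.
  by rewrite -!mulgA mulKVg.
have -> : (g1 *: H == g2 *: H)%g = ((g2^-1 * g1)%g \in H).
  by rewrite -mem_lcoset; apply/eqP/lcoset_eqP.
case: ifP => H12; last first.
  by rewrite /ind_block groupMl // H12 trmx0 !(mulmx0, mul0mx) mxE.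
rewrite ind_blockM // /ind_block H2.
have := invB _ (L (g2^-1 * g1)%g *m u) v H2; rewrite /bform.
by rewrite !trmx_mul -!mulmxA => <-.
Qed.

End Induction.

Section Vertices.

Variables (k : fieldType) (gT : finGroupType) (G : {group gT}).
Implicit Types (M : representation k G) (H V T : {group gT}).

Definition minimal_subgroup (P : {group gT} -> Prop) T : Prop :=
  P T /\ forall S : {group gT}, P S -> S \subset T -> S :=: T.

Definition projective_form H M (B : 'M[k]_(rdegree M)) : Prop :=
  exists (sHG : H \subset G) (L : representation k H) (C : 'M[k]_(rdegree L)),
    G_form C /\ component B (ind_form sHG C).

Definition symmetrically_projective H M : Prop :=
  exists B, G_form (M := M) B /\ projective_form H B.

Definition symmetric_vertex M T : Prop :=
  minimal_subgroup (fun S => symmetrically_projective S M) T.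

Definition relatively_projective H M : Prop :=
  exists (sHG : H \subset G) (L : representation k H),
    is_summand_of M (Ind sHG L).

Definition Green_vertex M V : Prop :=
  minimal_subgroup (fun S => relatively_projective S M) V.

(* Z is a V-source of M when V is a Green vertex of M. *)
Definition is_source V (sVG : V \subset G) M (Z : representation k V) : Prop :=
  indecomposable Z /\ is_summand_of M (Ind sVG Z).

Definition source_summand V (sVG : V \subset G) M (Z : representation k V)
    (i : 'M[k]_(rdegree (Res sVG M), rdegree Z)) : Prop :=
  is_source sVG M Z /\ summand_embedding i.

Definition has_form_nondegenerate_on_source V (sVG : V \subset G) M : Prop :=
  exists (B : 'M[k]_(rdegree M)) (Z : representation k V)
         (i : 'M[k]_(rdegree (Res sVG M), rdegree Z)),
    [/\ G_form B, source_summand i & nondegenerate_on B i].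

Definition sources_self_dual V (sVG : V \subset G) M : Prop :=
  forall Z : representation k V, is_source sVG M Z -> self_dual Z.

Definition sources_not_self_dual V (sVG : V \subset G) M : Prop :=
  forall Z : representation k V, is_source sVG M Z -> ~ self_dual Z.

Definition forms_degenerate_on_sources V (sVG : V \subset G) M : Prop :=
  forall B : 'M[k]_(rdegree M), G_form B ->
  forall (Z : representation k V) (i : 'M[k]_(rdegree (Res sVG M), rdegree Z)),
    source_summand i -> ~ nondegenerate_on B i.

End Vertices.

(* The algebra kG is the row space of group_ring k G, and the action of       *)
(* e in kG on M is gring_op M e.                                              *)
Section Blocks.

Variables (k : fieldType) (gT : finGroupType) (G : {group gT}).
Implicit Types e : 'M[k]_#|G|.

Definition central_idempotent e : Prop :=
  (e \in 'Z(group_ring k G))%MS /\ e *m e = e.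

Definition block_idempotent e : Prop :=
  [/\ central_idempotent e, e != 0
    & forall e1 e2, central_idempotent e1 -> central_idempotent e2 ->
        e1 *m e2 = 0 -> e = e1 + e2 -> e1 = 0 \/ e2 = 0].

Definition in_block e (M : representation k G) : Prop :=
  gring_op M e = 1%:M.

Definition in_principal_block (M : representation k G) : Prop :=
  exists e, [/\ block_idempotent e, in_block e (trivial_repr k G) & in_block e M].

End Blocks.

Definition exactly_one (P Q R : Prop) : Prop :=
  [\/ [/\ P, ~ Q & ~ R], [/\ ~ P, Q & ~ R] | [/\ ~ P, ~ Q & R]].

(* Main.v *)
Require Import Defs.
From mathcomp Require Import all_boot all_order all_algebra all_fingroup.
From mathcomp Require Import mxrepresentation character.
From mathcomp Require boolp.

(** Fix a G-form B on M. Through B, the bilinear forms on M that are invariant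
    under a subgroup H become the H-endomorphisms of M, and the symmetric forms
    become the self-adjoint ones. Higman's criterion [relatively_projectiveP]
    says that M is H-projective exactly when a relative trace Tr_H^G x of an
    H-endomorphism x is invertible. An invariant symmetric form, even a
    degenerate one, is pulled back from the quotient by its radical; hence M is
    symmetrically H-projective exactly when x can be chosen self-adjoint
    [symmetrically_projectiveP]. In particular T contains a Green vertex V.

    As k is algebraically closed, the endomorphism ring of an indecomposable
    module is local with residue field k: an endomorphism has one eigenvalue,
    which is additive and multiplicative, and is nonzero exactly on the units.
    The adjoint x^# of an endomorphism x has the same eigenvalue as x, so in characteristic 2 every x + x^# has eigenvalue 0. Let s x be the
    eigenvalue of Tr_V^G x, for x a V-endomorphism of M. By minimality of V, the
    functional s kills the traces from proper subgroups of V, so when a product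
    of relative traces is expanded under s, only the terms indexed by cosets
    fixed by V survive [brauer_mackey], and the terms that adjunction exchanges
    cancel [adjoint_diagonal]. Everything follows from expansions of this kind.

    Index. Let Tr_V^G x = 1, and let y be a self-adjoint T-endomorphism with
    Tr_T^G y invertible. Expanding s (x Tr_T^G y Tr_V^G x^#), some surviving term
    is its own adjoint up to conjugation [swap_fixed_point]. It yields an
    element c of a conjugate of T, with c normalising V and c^2 in V, such that
    M is symmetrically projective relative to the group generated by V and c.
    Minimality of T makes that group a conjugate of T, so |T : V| <= 2.

    Sources. If p a q is a non-unit of End(Z) for all V-endomorphisms a of M,
    where q : Z -> M and p : M -> Z, then s (q p) = 0, because the radical of
    End(Z) is nilpotent [vtrace_nonunit]. This gives the conjugacy of the
    sources under the normaliser of V [source_conj], so that either all of them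
    or none of them are self-dual.

    Case (i). It remains to see that M is symmetrically V-projective if and only
    if some G-form on M is non-degenerate on a source. For maps q, p, v from Z
    to M, with adjoints taken with respect to a form on Z, the eigenvalue of
    v^# Tr(p q^#) Tr(q p^#) v is that of q^# q times that of v^# Tr(p p^#) v
    [source_diagonal]. If the form of M restricts to the form of Z, this
    identity prevents all the Tr(w w^#) from being nilpotent
    [nonalternating_source]. Conversely a symmetrically V-projective module has
    a source Z with a form and a map r : Z -> M with Tr(r r^#) invertible, and
    the form of M twisted by Tr(r r^#) is then non-degenerate on r(Z)
    [trace_form_diagonal].

    Block. Let z be the principal block idempotent and v the embedding of a
    source on which the form is non-degenerate. In v^# z^# z v the terms for
    (g, h) and (h, g) cancel, and what remains is v^# v times the square of the
    augmentation of z, which is 1. So z does not annihilate M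
    [class_sum_nonzero]. *)

Set Implicit Arguments.
Unset Strict Implicit.
Unset Printing Implicit Defensive.
Import GRing.Theory GroupScope.

Section Splittings.
Local Open Scope ring_scope.

Variables (k : fieldType) (gT : finGroupType) (G : {group gT}).
Implicit Types M N L Z : representation k G.

Lemma mulmx1_swap n m (p : 'M[k]_(m, n)) (q : 'M_(n, m)) :
  n = m -> p *m q = 1%:M -> q *m p = 1%:M.
Proof. by move=> e; case: _ / e p q => p q; apply: mulmx1C. Qed.

Lemma kG_hom1 M : kG_hom (M := M) (N := M) 1%:M.
Proof. by move=> g _; rewrite mul1mx mulmx1. Qed.

Lemma kG_homM M N L (f : 'M_(rdegree N, rdegree M)) (h : 'M_(rdegree L, rdegree N)) :
  kG_hom f -> kG_hom h -> kG_hom (M := M) (N := L) (h *m f).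
Proof. by move=> Hf Hh g Gg; rewrite -mulmxA Hf // mulmxA Hh // mulmxA. Qed.

Lemma kG_homD M N (f h : 'M_(rdegree N, rdegree M)) :
  kG_hom f -> kG_hom h -> kG_hom (f + h).
Proof. by move=> Hf Hh g Gg; rewrite mulmxDl mulmxDr Hf ?Hh. Qed.

Lemma kG_homZ M N c (f : 'M_(rdegree N, rdegree M)) :
  kG_hom f -> kG_hom (c *: f).
Proof. by move=> Hf g Gg; rewrite -scalemxAl -scalemxAr Hf. Qed.

Lemma kG_homN M N (f : 'M_(rdegree N, rdegree M)) : kG_hom f -> kG_hom (- f).
Proof. by move=> Hf; rewrite -scaleN1r; apply: kG_homZ. Qed.

Lemma kG_hom_scalar M c : kG_hom (M := M) (N := M) c%:M.
Proof. by move=> g _; rewrite scalar_mxC. Qed.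

Lemma kG_homV M (f : 'M_(rdegree M)) :
  f \in unitmx -> kG_hom f -> kG_hom (invmx f).
Proof.
move=> Uf Hf g Gg; apply: (can_inj (mulKmx Uf)).
by rewrite !mulmxA mulmxV // mul1mx Hf // mulmxK.
Qed.

(** A full rank factorisation f = c r of an idempotent satisfies r c = 1, so it
    transports the action from M to the image of f. *)
Lemma idempotent_image M (f : 'M_(rdegree M)) :
  kG_hom f -> f *m f = f ->
  exists L (c : 'M_(rdegree M, rdegree L)) (r : 'M_(rdegree L, rdegree M)),
    [/\ kG_hom c, kG_hom r, r *m c = 1%:M & c *m r = f].
Proof.
move=> Hf ff; have := row_base_free f; have := col_base_full f.
move: (\rank f) (col_base f) (row_base f) (mulmx_base f) => d c r cr.
move=> /row_fullP[c' c'c] /row_freeP[r' rr'].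
have rc : r *m c = 1%:M.
  have: c *m (r *m c) *m r = c *m r by rewrite mulmxA cr -mulmxA cr ff.
  move/(congr1 (fun x => c' *m x *m r')) => /=; rewrite !mulmxA c'c !mul1mx.
  by rewrite -!mulmxA rr' mulmx1.
have fc : f *m c = c by rewrite -cr -mulmxA rc mulmx1.
have rf : r *m f = r by rewrite -cr mulmxA rc mul1mx.
have reprL : mx_repr G (fun g => r *m M g *m c).
  split=> [|x y Gx Gy]; first by rewrite repr_mx1 mulmx1.
  rewrite repr_mxM // !mulmxA -(mulmxA _ c r) cr -(mulmxA r (M x) f) -Hf //.
  by rewrite mulmxA rf.
exists (Representation (MxRepresentation reprL)), c, r; split=> // g Gg /=.
  by rewrite !mulmxA cr Hf // -mulmxA fc.
by rewrite -[RHS]mulmxA cr -mulmxA -Hf // mulmxA rf.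
Qed.

Lemma split_complement Z N (q : 'M_(rdegree N, rdegree Z)) (p : 'M_(rdegree Z, rdegree N)) :
    kG_hom q -> kG_hom p -> p *m q = 1%:M ->
  exists L (j : 'M_(rdegree N, rdegree L)) (r : 'M_(rdegree L, rdegree N)),
    [/\ kG_hom j, kG_hom r & [/\ r *m j = 1%:M, p *m j = 0, r *m q = 0 &
        q *m p + j *m r = 1%:M]].
Proof.
move=> Hq Hp pq; set e := q *m p.
have ee : e *m e = e by rewrite /e mulmxA -(mulmxA q) pq mulmx1.
have He : kG_hom (1%:M - e : 'M_(rdegree N)).
  by apply/kG_homD/kG_homN/kG_homM=> //; apply: kG_hom1.
have [|L [j [r [Hj Hr rj jr]]]] := idempotent_image He.
  by rewrite mulmxBl mul1mx mulmxBr mulmx1 ee subrr subr0.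
exists L, j, r; split=> //; split=> //.
- rewrite -[j]mulmx1 -rj !mulmxA -(mulmxA p) jr mulmxBr mulmx1 /e mulmxA pq.
  by rewrite mul1mx subrr mul0mx.
- rewrite -[r]mul1mx -rj -(mulmxA r) jr -mulmxA mulmxBl mul1mx /e -mulmxA pq.
  by rewrite mulmx1 subrr mulmx0.
by rewrite jr addrC subrK.
Qed.

Lemma split_summand Z N (q : 'M_(rdegree N, rdegree Z)) (p : 'M_(rdegree Z, rdegree N)) :
  kG_hom q -> kG_hom p -> p *m q = 1%:M -> is_summand_of Z N.
Proof.
move=> Hq Hp pq; have [L [j [r [Hj Hr [rj pj rq qp]]]]] := split_complement Hq Hp pq.
have qjpr : row_mx q j *m col_mx p r = 1%:M by rewrite mul_row_col.
have prqj : col_mx p r *m row_mx q j = 1%:M.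
  by rewrite mul_col_row pq rj pj rq -scalar_mx_block.
exists L; apply: (@MxReprSim _ _ _ _ _ _ _ (row_mx q j)).
- apply/eqP; rewrite eqn_leq; apply/andP; split.
    by rewrite -(mxrank1 k (rdegree N)) -qjpr mulmx_max_rank.
  by rewrite -(mxrank1 k (_ + _)) -prqj mulmx_max_rank.
- by apply/row_freeP; exists (col_mx p r).
by move=> g Gg /=; rewrite mul_row_block !mulmx0 addr0 add0r mul_mx_row Hq ?Hj.
Qed.

Lemma dadd_split M L1 L2 : mx_rsim M (dadd_grepr L1 L2) ->
  rdegree M = (rdegree L1 + rdegree L2)%N /\
  exists (q1 : 'M_(rdegree M, rdegree L1)) (p1 : 'M_(rdegree L1, rdegree M))
         (q2 : 'M_(rdegree M, rdegree L2)) (p2 : 'M_(rdegree L2, rdegree M)),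
    [/\ kG_hom q1 /\ kG_hom p1, kG_hom q2 /\ kG_hom p2, p1 *m q1 = 1%:M
      & q1 *m p1 + q2 *m p2 = 1%:M].
Proof.
case=> B /= eqn freeB homB; split=> //; have /row_freeP[B' BB'] := freeB.
have B'B : B' *m B = 1%:M by apply: mulmx1_swap BB'.
have homB' g : g \in G -> B' *m M g = block_mx (L1 g) 0 0 (L2 g) *m B'.
  move=> Gg.
  by rewrite -[RHS]mul1mx -B'B -!mulmxA (mulmxA B) -homB // -mulmxA BB' mulmx1.
have [q1 [q2 defB]] : exists q1 q2, B = row_mx q1 q2.
  by exists (lsubmx B), (rsubmx B); rewrite hsubmxK.
have [p1 [p2 defB']] : exists p1 p2, B' = col_mx p1 p2.
  by exists (usubmx B'), (dsubmx B'); rewrite vsubmxK.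
move: BB' B'B homB homB'; rewrite {}defB {}defB' => BB' B'B homB homB'.
exists q1, p1, q2, p2.
split.
- split=> g Gg.
    by have := homB g Gg; rewrite mul_mx_row mul_row_block !mulmx0 addr0 add0r => /eq_row_mx[].
  by have := homB' g Gg; rewrite mul_col_mx mul_block_col !mul0mx addr0 add0r => /eq_col_mx[].
- split=> g Gg.
    by have := homB g Gg; rewrite mul_mx_row mul_row_block !mulmx0 addr0 add0r => /eq_row_mx[].
  by have := homB' g Gg; rewrite mul_col_mx mul_block_col !mul0mx addr0 add0r => /eq_col_mx[].
- by move: B'B; rewrite mul_col_row scalar_mx_block => /eq_block_mx[].
by move: BB'; rewrite mul_row_col.
Qed.

Lemma summand_split Z N : is_summand_of Z N ->
  exists (q : 'M_(rdegree N, rdegree Z)) (p : 'M_(rdegree Z, rdegree N)),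
    [/\ kG_hom q, kG_hom p & p *m q = 1%:M].
Proof.
by case=> L /dadd_split[_ [q [p [_ [_ [[Hq Hp] _ pq _]]]]]]; exists q, p.
Qed.

(** This replaces the decomposition of a module into indecomposable ones: a
    module of least degree with the property cannot decompose. *)
Lemma minimal_indecomposable (P : representation k G -> Prop) :
    (exists M, P M) -> (forall M, P M -> (0 < rdegree M)%N) ->
    (forall M L1 L2 (q1 : 'M_(rdegree M, rdegree L1)) (p1 : 'M_(rdegree L1, rdegree M))
         (q2 : 'M_(rdegree M, rdegree L2)) (p2 : 'M_(rdegree L2, rdegree M)), P M ->
       kG_hom q1 -> kG_hom p1 -> kG_hom q2 -> kG_hom p2 ->
       q1 *m p1 + q2 *m p2 = 1%:M -> P L1 \/ P L2) ->
  exists2 M, P M & indecomposable M.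
Proof.
move=> [M0 PM0] Ppos Psplit.
have exd : exists d, boolp.asbool (exists2 M, P M & rdegree M = d).
  by exists (rdegree M0); apply/boolp.asboolP; exists M0.
case: (ex_minnP exd) => d /boolp.asboolP[M PM degM] mind.
exists M => //; split=> [|L1 L2 rs]; first exact: Ppos.
have [deg [q1 [p1 [q2 [p2 [[Hq1 Hp1] [Hq2 Hp2] _ e1]]]]]] := dadd_split rs.
have min L : P L -> (d <= rdegree L)%N by move=> PL; apply/mind/boolp.asboolP; exists L.
have [/min|/min] := Psplit _ _ _ _ _ _ _ PM Hq1 Hp1 Hq2 Hp2 e1; rewrite -degM deg.
  by rewrite -[X in (_ <= X)%N]addn0 leq_add2l leqn0 => /eqP; right.
by rewrite -[X in (_ <= X)%N]add0n leq_add2r leqn0 => /eqP; left.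
Qed.

Lemma split_embedding Z N (q : 'M_(rdegree N, rdegree Z)) (p : 'M_(rdegree Z, rdegree N)) :
  kG_hom q -> kG_hom p -> p *m q = 1%:M -> summand_embedding q.
Proof.
move=> Hq Hp pq; have [L [j [r [Hj Hr [rj pj rq qp]]]]] := split_complement Hq Hp pq.
split=> //; exists L, j; split=> //.
  by apply/row_freeP; exists (col_mx p r); rewrite mul_row_col.
apply/row_fullP; exists (col_mx p r).
by rewrite mul_col_row pq rj pj rq -scalar_mx_block.
Qed.

Lemma idempotent_indecomposable M (f : 'M_(rdegree M)) :
  indecomposable M -> kG_hom f -> f *m f = f -> f = 0 \/ f = 1%:M.
Proof.
move=> [_ indM] Hf ff; have [Z [q [p [Hq Hp pq qp]]]] := idempotent_image Hf ff.
have [L rs] := split_summand Hq Hp pq; have [_ /= eqn _ _] := rs.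
case/indM: (rs) => d0.
  left; rewrite -qp; move: q {Hq pq qp} p {Hp} => q p.
  apply/matrixP=> i j; rewrite !mxE big1 // => -[l lt_l].
  by exfalso; move: lt_l; rewrite d0.
right; rewrite -qp; apply: mulmx1_swap pq; last by rewrite eqn d0 addn0.
Qed.

End Splittings.

(** * Fitting's lemma *)

Section Fitting.
Local Open Scope ring_scope.

(** Write the characteristic polynomial of a as 'X^m q with q(0) nonzero. If
    u 'X^m + v q = 1, then (u 'X^m)(a) is idempotent by Cayley-Hamilton; being
    a polynomial in a, it is a module endomorphism whenever a is one. *)
Lemma fitting_idempotent (k : fieldType) n (a : 'M[k]_n.+1) :
  exists f : 'M[k]_n.+1, [/\ f *m f = f, forall b, a *m b = b *m a -> f *m b = b *m f,
    f = 1%:M -> a \in unitmx & f = 0 -> exists m, a ^+ m = 0].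
Proof.
have [m [q nroot Dp]] := multiplicity_XsubC (char_poly a) 0.
rewrite polyC0 subr0 in Dp.
have p0 := monic_neq0 (char_poly_monic a); rewrite p0 /= in nroot.
have /Bezout_eq1_coprimepP[[u v] /= uv1] : coprimep ('X^m) q.
  have -> : 'X = 'X - 0%:P :> {poly k} by rewrite polyC0 subr0.
  by rewrite coprimep_sym coprimep_expr ?coprimep_XsubC.
have CH : horner_mx a q * a ^+ m = 0.
  have /esym := Cayley_Hamilton a; rewrite Dp rmorphM /= rmorphXn /= horner_mx_X.
  by move<-.
pose f := horner_mx a (u * 'X^m).
have f' : 1 - f = horner_mx a (v * q).
  by rewrite -(rmorph1 (horner_mx a)) -rmorphB /= -uv1 addrC addKr.
have fE : f = horner_mx a u * a ^+ m by rewrite /f rmorphM rmorphXn /= horner_mx_X.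
have f'E : 1 - f = horner_mx a v * horner_mx a q by rewrite f' rmorphM.
exists f; split.
- have: f * (1 - f) = 0.
    rewrite f' -rmorphM /= (_ : u * _ * _ = u * v * (q * 'X^m)); last first.
      by rewrite mulrACA [_ * q]mulrC.
    by rewrite rmorphM /= [horner_mx a (q * _)]rmorphM /= rmorphXn /= horner_mx_X CH mulr0.
  by rewrite mulrBr mulr1 => /eqP; rewrite subr_eq0 => /eqP.
- by move=> b ab; apply: comm_horner_mx.
- move=> f1; case: (posnP m) => m0.
    have: ~~ eigenvalue a 0.
      by rewrite eigenvalue_root_char Dp m0 mulr1 nroot.
    by rewrite negbK /eigenspace raddf0 subr0 kermx_eq0 row_free_unit.
  have: horner_mx a u * a ^+ m.-1 *m a = 1%:M.
    by rewrite -[1%:M]f1 fE -{2}(prednK m0) exprSr mulrA.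
  by case/mulmx1_unit.
move=> f0; exists m; rewrite -[a ^+ m]mul1r.
have -> : 1 = horner_mx a v * horner_mx a q by rewrite -f'E f0 subr0.
by rewrite -mulrA CH mulr0.
Qed.

End Fitting.

(** * The local endomorphism ring of an indecomposable module *)

Section LocalEndomorphisms.
Local Open Scope ring_scope.

(** On endomorphisms of an indecomposable module there is no choice: this is the
    character of the local endomorphism ring onto its residue field. *)
Definition some_eigenvalue (k : closedFieldType) n (a : 'M[k]_n) : k :=
  head 0 (sval (closed_field_poly_normal (char_poly a))).

Local Notation lam := some_eigenvalue.

Lemma some_eigenvalueP (k : closedFieldType) n (a : 'M[k]_n) :
  (0 < n)%N -> a - (lam a)%:M \notin unitmx.
Proof.
move=> n_gt0; rewrite -row_free_unit -kermx_eq0.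
rewrite -[_ != 0]/(eigenvalue a (lam a)) eigenvalue_root_char /lam.
case: closed_field_poly_normal => r /=; rewrite (monicP (char_poly_monic a)) scale1r => Dp.
rewrite Dp root_prod_XsubC; case: r Dp => [|x r] Dp; last exact: mem_head.
by have := size_char_poly a; rewrite Dp big_nil size_poly1 => -[n0]; rewrite -n0 in n_gt0.
Qed.

Variables (k : closedFieldType) (gT : finGroupType) (G : {group gT}).
Variable M : representation k G.
Hypothesis indM : indecomposable M.
Local Notation d := (rdegree M).
Local Notation hom := (kG_hom (M := M) (N := M)).
Implicit Types (a b : 'M[k]_d) (c : k).

Lemma unit_or_nilpotent a :
  hom a -> a \in unitmx \/ exists m, iter m (mulmx a) 1%:M = 0.
Proof.
move=> Ha; have [d_gt0 _] := indM.
suffices [f [ff fC fu f0]]: exists f : 'M_d, [/\ f *m f = f,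
    forall b, a *m b = b *m a -> f *m b = b *m f, f = 1%:M -> a \in unitmx
  & f = 0 -> exists m, iter m (mulmx a) 1%:M = 0].
  have Hf: hom f by move=> g Gg; apply: fC; apply: Ha.
  by case: (idempotent_indecomposable indM Hf ff) => e; [right; apply: f0 | left; apply: fu].
move: (rdegree M) d_gt0 a {Ha} => [//|n] _ a.
have [f [ff fC fu f0]] := fitting_idempotent a; exists f; split=> // /f0[m am].
exists m; rewrite -am; elim: m {am} => //= m ->; by rewrite exprS.
Qed.

Lemma unit_scalar (c : k) : c%:M \in @unitmx k d = (c != 0).
Proof.
have [d_gt0 _] := indM; rewrite unitmxE det_scalar unitfE expf_eq0.
by rewrite negb_and -leqNgt leqNgt d_gt0.
Qed.

Lemma nilpotent_addl a m : iter m (mulmx a) 1%:M = 0 -> 1%:M - a \in unitmx.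
Proof.
move=> am.
pose s := \sum_(i < m) iter i (mulmx a) 1%:M.
suffices e: (1%:M - a) *m s = 1%:M by case: (mulmx1_unit e).
suffices: (1%:M - a) *m s = 1%:M - iter m (mulmx a) 1%:M by rewrite am subr0.
rewrite /s; elim: m {am s} => [|m IH]; first by rewrite big_ord0 mulmx0 subrr.
by rewrite big_ord_recr /= mulmxDr IH mulmxBl mul1mx addrA subrK.
Qed.

(** Dividing by an invertible sum reduces to x + y = 1, where a non-unit x is
    nilpotent and y = 1 - x is therefore a unit. *)
Lemma nonunitD a b : hom a -> hom b ->
  a \notin unitmx -> b \notin unitmx -> a + b \notin unitmx.
Proof.
move=> Ha Hb Na Nb; apply: contra Nb => Uab.
have Hx := kG_homM Ha (kG_homV Uab (kG_homD Ha Hb)).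
case: (unit_or_nilpotent Hx) => [|[m xm]].
  by rewrite unitmx_mul (negPf Na) andbF.
have := nilpotent_addl xm; rewrite -(mulVmx Uab) -mulmxBr addrAC subrr add0r.
by rewrite unitmx_mul => /andP[].
Qed.

Lemma hom_subscalar a c : hom a -> hom (a - c%:M).
Proof. by move=> Ha; apply/kG_homD/kG_homN/kG_hom_scalar. Qed.

Lemma lam_eq a c : hom a -> a - c%:M \notin unitmx -> lam a = c.
Proof.
move=> Ha Nac; apply/eqP; rewrite -subr_eq0; apply: contraNT Nac => nz.
have [d_gt0 _] := indM; apply: contraR (some_eigenvalueP a d_gt0) => Nac.
rewrite -subr_eq0 in nz; move: nz; rewrite subr0 -unit_scalar.
apply: contraLR => Nal.
have -> : (lam a - c)%:M = (a - c%:M) + - (a - (lam a)%:M) :> 'M_d.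
  by rewrite opprB [RHS]addrC addrA subrK -raddfB.
apply: nonunitD => //; first exact: hom_subscalar; first exact/kG_homN/hom_subscalar.
by rewrite -scaleN1r unitmxZ // unitrN unitr1.
Qed.

Lemma lam_scalar c : lam (c%:M : 'M_d) = c.
Proof.
apply: lam_eq; first exact: kG_hom_scalar.
by rewrite -raddfB subrr unit_scalar eqxx.
Qed.

Lemma lamN a : a - (lam a)%:M \notin unitmx.
Proof. by apply: some_eigenvalueP; case: indM. Qed.

Lemma lamD a b : hom a -> hom b -> lam (a + b) = lam a + lam b.
Proof.
move=> Ha Hb; apply: lam_eq; first exact: kG_homD.
rewrite raddfD opprD addrACA.
by apply: nonunitD; try apply: hom_subscalar => //; apply: lamN.
Qed.

Lemma lamM a b : hom a -> hom b -> lam (a *m b) = lam a * lam b.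
Proof.
move=> Ha Hb; apply: lam_eq; first exact: kG_homM.
have -> : a *m b - (lam a * lam b)%:M =
   (a - (lam a)%:M) *m b + lam a *: (b - (lam b)%:M).
  rewrite mulmxBl mul_scalar_mx scalerBr scale_scalar_mx.
  by rewrite addrA subrK.
apply: nonunitD.
- by apply: kG_homM => //; apply: hom_subscalar.
- by apply/kG_homZ/hom_subscalar.
- by rewrite unitmx_mul negb_and lamN.
by rewrite -mul_scalar_mx unitmx_mul negb_and lamN orbT.
Qed.

Lemma lamZ c a : hom a -> lam (c *: a) = c * lam a.
Proof.
by move=> Ha; rewrite -mul_scalar_mx lamM ?lam_scalar //; apply: kG_hom_scalar.
Qed.

Lemma lam0 : lam (0 : 'M[k]_d) = 0.
Proof. by rewrite -(raddf0 (@scalar_mx k d)) lam_scalar. Qed.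

Lemma lam1 : lam (1%:M : 'M[k]_d) = 1.
Proof. exact: lam_scalar. Qed.

Lemma lam_unit a : hom a -> (lam a != 0) = (a \in unitmx).
Proof.
move=> Ha; apply/idP/idP; last first.
  apply: contraTneq => l0; have := lamN a.
  by rewrite l0 raddf0 subr0.
by apply: contraNT => Na; apply/eqP/lam_eq => //; rewrite raddf0 subr0.
Qed.

Lemma lam_tr (s : 'M_d -> 'M_d) a :
    (forall x, (s x \in unitmx) = (x \in unitmx)) ->
    (forall x c, s (x - c%:M) = s x - c%:M) -> hom (s a) -> lam (s a) = lam a.
Proof. by move=> sU sB Hsa; apply: lam_eq => //; rewrite -sB sU lamN. Qed.

(** The factors need not be endomorphisms: typically they intertwine M with one
    of its conjugates. *)
Lemma lamC a b : hom (a *m b) -> hom (b *m a) -> lam (a *m b) = lam (b *m a).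
Proof.
move=> Hab Hba; have [Ua|Na] := boolP (a \in unitmx).
  apply: lam_eq => //; set c := lam _.
  have -> : a *m b - c%:M = a *m (b *m a - c%:M) *m invmx a.
    by rewrite mulmxBr mulmxBl !mulmxA mulmxK // scalar_mxC mulmxK.
  by rewrite !unitmx_mul negb_and negb_and lamN orbT.
have /negbFE/eqP -> : (lam (a *m b) != 0) = false.
  by rewrite lam_unit // unitmx_mul (negPf Na).
by apply/esym/eqP/negbFE; rewrite lam_unit // unitmx_mul (negPf Na) andbF.
Qed.

Definition mxprod (rs : seq 'M[k]_d) := foldr mulmx 1%:M rs.

Lemma mxprod_cat rs ss : mxprod (rs ++ ss) = mxprod rs *m mxprod ss.
Proof. by elim: rs => [|r rs /= ->]; rewrite ?mul1mx ?mulmxA. Qed.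

Lemma hom_mxprod rs : {in rs, forall r, hom r} -> hom (mxprod rs).
Proof.
elim: rs => [|r rs IH] Hrs /=; first exact: kG_hom1.
apply: kG_homM; last by apply: Hrs; rewrite mem_head.
by apply: IH => x rs_x; apply: Hrs; rewrite inE rs_x orbT.
Qed.

(** The radical of the endomorphism ring is nilpotent. If the product does not
    kill v, the partial products applied to v are more than d vectors, and in a
    linear relation among them the vector of shortest product that occurs is
    killed by a nonzero scalar plus non-units, that is, by a unit. *)
Lemma nonunit_products (rs : seq 'M[k]_d) :
    {in rs, forall r, hom r /\ r \notin unitmx} -> (d <= size rs)%N ->
  mxprod rs = 0.
Proof.
move=> Hrs le_d; set m := size rs.
have Hdrop n : hom (mxprod (drop n rs)).
  by apply: hom_mxprod => r /mem_drop /Hrs[].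
suffices kill (v : 'cV[k]_d) : mxprod rs *m v = 0.
  apply/matrixP=> i j; have := kill (delta_mx j 0) => /matrixP/(_ i 0).
  by rewrite -colE !mxE.
pose V := \matrix_(i < m.+1) (mxprod (drop i rs) *m v)^T.
have /rowV0Pn[u /sub_kermxP uV u_nz]: kermx V != 0.
  rewrite kermx_eq0 /row_free neq_ltn; apply/orP; left.
  by apply: leq_ltn_trans (rank_leq_col V) _; rewrite ltnS.
have /rV0Pn[i1 ui1] := u_nz.
pose i0 := [arg max_(i > i1 | u 0 i != 0) val i].
have [ui0 max_i0]: u 0 i0 != 0 /\ forall i, u 0 i != 0 -> (i <= i0)%N.
  by rewrite /i0; case: arg_maxnP.
pose n (i : nat) := mxprod (take (i0 - i) (drop i rs)).
have nE i : (i <= i0)%N -> mxprod (drop i rs) = n i *m mxprod (drop i0 rs).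
  move=> le_i; rewrite -{1}[drop i rs](cat_take_drop (i0 - i)) mxprod_cat.
  by rewrite drop_drop subnK.
pose x := \sum_(i : 'I_m.+1 | (i < i0)%N) u 0 i *: n i.
have Hn i : hom (n i).
  by apply: hom_mxprod => r /mem_take /mem_drop /Hrs[].
have [Hx Nx]: hom x /\ x \notin unitmx.
  rewrite /x; elim/big_ind: _ => [|a b [Ha Na] [Hb Nb]|i lt_i].
  - split; first by move=> g _; rewrite mul0mx mulmx0.
    by rewrite -(raddf0 (@scalar_mx k d)) unit_scalar eqxx.
  - by split; [apply: kG_homD | apply: nonunitD].
  split; first exact: kG_homZ.
  rewrite -mul_scalar_mx unitmx_mul negb_and; apply/orP; right.
  have lt_im : (i < m)%N by apply: leq_trans lt_i _; rewrite -ltnS.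
  rewrite /n (drop_nth 0) // -(prednK (_ : 0 < i0 - i)%N) ?subn_gt0 //=.
  rewrite unitmx_mul negb_and; have [_ -> //] := Hrs (nth 0 rs i) (mem_nth 0 lt_im).
have kill0 : (u 0 i0)%:M *m (mxprod (drop i0 rs) *m v) + x *m (mxprod (drop i0 rs) *m v) = 0.
  have: (u *m V)^T = 0 by rewrite uV trmx0.
  rewrite mulmx_sum_row (raddf_sum (@trmx _ _ _)) /= (bigID (fun i : 'I__ => (i <= i0)%N)) /=.
  rewrite [X in _ + X]big1 ?addr0 => [|i gt_i]; last first.
    rewrite linearZ /=; case: eqVneq (max_i0 i) => [->|_ /(_ isT)].
      by rewrite scale0r.
    by rewrite (negPf gt_i).
  rewrite (bigD1 i0) //= rowK linearZ /= trmxK mul_scalar_mx => <-; congr (_ + _).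
  rewrite /x mulmx_suml; apply: eq_big => [i|i lt_i].
    by rewrite ltn_neqAle andbC.
  by rewrite rowK linearZ /= trmxK -scalemxAl (nE i (ltnW lt_i)) !mulmxA.
have {}kill0 : mxprod (drop i0 rs) *m v = 0.
  rewrite -mulmxDl in kill0.
  have Uy : (u 0 i0)%:M + x \in unitmx.
    move: ui0; rewrite -unit_scalar; apply: contraLR => Ny.
    rewrite -[_%:M](addrK x); apply: nonunitD => //.
    - by apply: kG_homD => //; apply: kG_hom_scalar.
    - exact: kG_homN.
    by rewrite -scaleN1r unitmxZ // unitrN unitr1.
  by rewrite -[_ *m v](mulKmx Uy) kill0 mulmx0.
by have := nE 0 isT; rewrite drop0 => ->; rewrite -mulmxA kill0 mulmx0.
Qed.

End LocalEndomorphisms.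

(** * Relative traces *)

Section RelativeTraces.
Local Open Scope ring_scope.

Variables (k : fieldType) (gT : finGroupType) (G : {group gT}).
Variable M : representation k G.
Local Notation n := (rdegree M).
Implicit Types (x y : 'M[k]_n) (g h : gT) (H K L : {group gT}) (C : {set gT}).

Definition gconj g x := M g *m x *m M g^-1%g.

Definition fixed_by H x := forall h, h \in H -> x *m M h = M h *m x.

Definition reltr H K x := \sum_(C in lcosets H K) gconj (repr C) x.

Lemma gconj1 x : gconj 1%g x = x.
Proof. by rewrite /gconj invg1 repr_mx1 mul1mx mulmx1. Qed.

Lemma gconjM g h x : g \in G -> h \in G -> gconj (g * h)%g x = gconj g (gconj h x).
Proof. by move=> Gg Gh; rewrite /gconj invMg !repr_mxM ?groupV // !mulmxA. Qed.

Lemma gconjD g x y : gconj g (x + y) = gconj g x + gconj g y.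
Proof. by rewrite /gconj mulmxDr mulmxDl. Qed.

Lemma gconjZ c g x : gconj g (c *: x) = c *: gconj g x.
Proof. by rewrite /gconj -scalemxAr -scalemxAl. Qed.

Lemma gconj_sum g (I : finType) (P : pred I) (F : I -> 'M_n) :
  gconj g (\sum_(i | P i) F i) = \sum_(i | P i) gconj g (F i).
Proof. by rewrite /gconj mulmx_sumr mulmx_suml. Qed.

Lemma gconj_mul g x y : g \in G -> gconj g (x *m y) = gconj g x *m gconj g y.
Proof.
by move=> Gg; rewrite /gconj !mulmxA repr_mxKV.
Qed.

Lemma gconj_fixed H h x : h \in G -> h \in H -> fixed_by H x -> gconj h x = x.
Proof.
by move=> Gh Hh fx; rewrite /gconj -fx // repr_mxK.
Qed.

Lemma fixed_by_gconj H x :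
  H \subset G -> (forall h, h \in H -> gconj h x = x) -> fixed_by H x.
Proof.
move=> sHG fx h Hh; have Gh := subsetP sHG h Hh.
by rewrite -{1}(fx h Hh) /gconj repr_mxKV.
Qed.

Lemma fixed_byS H K x : H \subset K -> fixed_by K x -> fixed_by H x.
Proof. by move=> /subsetP sHK fx h /sHK; apply: fx. Qed.

Lemma fixed_byD H x y : fixed_by H x -> fixed_by H y -> fixed_by H (x + y).
Proof. by move=> fx fy h Hh; rewrite mulmxDl mulmxDr fx ?fy. Qed.

Lemma fixed_byM H x y : fixed_by H x -> fixed_by H y -> fixed_by H (x *m y).
Proof. by move=> fx fy h Hh; rewrite -mulmxA fy // mulmxA fx // mulmxA. Qed.

Lemma fixed_by_conj H g x : H \subset G -> g \in G ->
  fixed_by H x -> fixed_by (H :^ g^-1)%G (gconj g x).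
Proof.
move=> sHG Gg fx; have sHgG : (H :^ g^-1)%g \subset G by rewrite conj_subG ?groupV.
apply: fixed_by_gconj => // h; rewrite mem_conjg invgK => Hh.
have Gh : h \in G by rewrite -(groupJr h Gg); apply: (subsetP sHG).
rewrite -gconjM // (_ : h * g = g * h ^ g)%g; last by rewrite conjgE mulKVg.
by rewrite gconjM ?groupJ // (gconj_fixed _ Hh fx) // groupJ.
Qed.

Lemma fixed_by_norm H g x : H \subset G -> g \in G -> g \in 'N(H) ->
  fixed_by H x -> fixed_by H (gconj g x).
Proof.
move=> sHG Gg Ng fx h Hh; apply: (fixed_by_conj sHG Gg fx) => //=.
by rewrite (normP (groupVr Ng)).
Qed.

Lemma mem_repr_lcoset H g : exists2 h, h \in H & repr (g *: H)%g = (g * h)%g.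
Proof. by have /lcosetP[h Hh ->] := mem_repr _ (lcoset_refl H g); exists h. Qed.

Lemma lcosets_sub H K C : H \subset K -> C \in lcosets H K -> repr C \in K /\ C = (repr C *: H)%g.
Proof.
move=> sHK /lcosetsP[g Kg ->]; have [h Hh ->] := mem_repr_lcoset H g; split.
  by rewrite groupM // (subsetP sHK).
by apply/lcoset_eqP; rewrite mem_lcoset invMg mulgKV groupV.
Qed.

Lemma gconj_repr H g x : H \subset G -> g \in G -> fixed_by H x ->
  gconj (repr (g *: H)%g) x = gconj g x.
Proof.
move=> sHG Gg fx; have [h Hh ->] := mem_repr_lcoset H g.
have Gh := subsetP sHG h Hh.
by rewrite gconjM // (gconj_fixed _ Hh fx).
Qed.

Lemma mulg_lcosets H K g C : g \in K -> ((g *: C)%g \in lcosets H K) = (C \in lcosets H K).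
Proof.
move=> Kg; apply/lcosetsP/lcosetsP => [[c Kc def_C]|[c Kc ->]].
  by exists (g^-1 * c)%g; rewrite ?groupM ?groupV // lcosetM -def_C lcosetK.
by exists (g * c)%g; rewrite ?groupM // lcosetM.
Qed.

Lemma reltr_fixed H K x : H \subset K -> K \subset G -> fixed_by H x ->
  fixed_by K (reltr H K x).
Proof.
move=> sHK sKG fx; have sHG := subset_trans sHK sKG.
apply: fixed_by_gconj => // g Kg; have Gg := subsetP sKG g Kg.
rewrite /reltr gconj_sum [RHS](reindex_onto (fun C => (g *: C)%g) (fun C => (g^-1 *: C)%g)) /=.
  apply: eq_big => [C|C CH]; first by rewrite mulg_lcosets // lcosetK eqxx andbT.
  have [Kr ->] := lcosets_sub sHK CH; have Gr := subsetP sKG _ Kr.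
  by rewrite -lcosetM !gconj_repr ?groupM // gconjM.
by move=> C _; rewrite lcosetKV.
Qed.

Lemma reltrD H K x y : reltr H K (x + y) = reltr H K x + reltr H K y.
Proof. by rewrite -big_split; apply: eq_bigr => C _; apply: gconjD. Qed.

Lemma reltrMl H K x y : H \subset K -> K \subset G -> fixed_by K y ->
  y *m reltr H K x = reltr H K (y *m x).
Proof.
move=> sHK sKG fy; rewrite mulmx_sumr; apply: eq_bigr => C CH.
have [Kr _] := lcosets_sub sHK CH; have Gr := subsetP sKG _ Kr.
by rewrite gconj_mul // (gconj_fixed Gr Kr fy).
Qed.

Lemma reltrMr H K x y : H \subset K -> K \subset G -> fixed_by K y ->
  reltr H K x *m y = reltr H K (x *m y).
Proof.
move=> sHK sKG fy; rewrite mulmx_suml; apply: eq_bigr => C CH.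
have [Kr _] := lcosets_sub sHK CH; have Gr := subsetP sKG _ Kr.
by rewrite gconj_mul // (gconj_fixed Gr Kr fy).
Qed.

Lemma reltr_trans H K L x : H \subset K -> K \subset L -> L \subset G -> fixed_by H x ->
  reltr K L (reltr H K x) = reltr H L x.
Proof.
move=> sHK sKL sLG fx; have sKG := subset_trans sKL sLG.
have sHG := subset_trans sHK sKG; have sHL := subset_trans sHK sKL.
rewrite /(reltr H L) (partition_big (fun C => C * K)%g (mem (lcosets K L))) /=; last first.
  move=> C /lcosetsP[c Lc ->]; apply/lcosetsP; exists c => //.
  by rewrite -mulgA mulSGid.
apply: eq_bigr => D DL; have [Lr defD] := lcosets_sub sKL DL.
have Gr := subsetP sLG _ Lr; set r := repr D in Lr defD Gr *.
rewrite gconj_sum [RHS](reindex_onto (fun C => (r *: C)%g)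
  (fun C => (r^-1 *: C)%g)) /=; last first.
  by move=> C _; rewrite lcosetKV.
apply: eq_big => [C|C CH]; last first.
  have [Kc ->] := lcosets_sub sHK CH; have Gc := subsetP sKG _ Kc.
  by rewrite -lcosetM !gconj_repr ?groupM // gconjM.
rewrite lcosetK eqxx andbT mulg_lcosets //.
apply/lcosetsP/andP => [[c Kc ->]|[/lcosetsP[c Lc ->]]].
  split; first by apply/lcosetsP; exists c; rewrite // (subsetP sKL).
  by rewrite -lcosetM -mulgA mulSGid // lcosetM lcoset_id // -defD.
rewrite -lcosetM -mulgA mulSGid // => /eqP defD'; exists c => //.
by rewrite -(mulKg r c) -mem_lcoset -defD -defD' lcoset_refl.
Qed.

End RelativeTraces.

Arguments gconj {k gT G} M g x.
Arguments fixed_by {k gT G} M H x.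
Arguments reltr {k gT G} M H K x.

Section TraceTransfer.
Local Open Scope ring_scope.

Variables (k : fieldType) (gT : finGroupType) (G V U : {group gT}).
Variables (M : representation k G) (Z : representation k V).
Hypotheses (sVG : V \subset G) (sUV : U \subset V).
Variables (q : 'M[k]_(rdegree M, rdegree Z)) (p : 'M[k]_(rdegree Z, rdegree M)).
Hypotheses (Hq : kG_hom (M := Z) (N := Res sVG M) q)
           (Hp : kG_hom (M := Res sVG M) (N := Z) p).

Lemma gconj_sandwich_out g y : g \in V -> q *m gconj Z g y *m p = gconj M g (q *m y *m p).
Proof.
by move=> Vg; rewrite /gconj !mulmxA (Hq Vg) -!mulmxA -(Hp (groupVr Vg)).
Qed.

Lemma gconj_sandwich_in g x : g \in V -> p *m gconj M g x *m q = gconj Z g (p *m x *m q).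
Proof.
by move=> Vg; rewrite /gconj !mulmxA (Hp Vg) -!mulmxA -(Hq (groupVr Vg)).
Qed.

Lemma fixed_by_sandwich y : fixed_by Z U y -> fixed_by M U (q *m y *m p).
Proof.
move=> fy h Uh; have Vh := subsetP sUV h Uh.
have pM : p *m M h = Z h *m p by apply: Hp.
have qM : q *m Z h = M h *m q by apply: Hq.
by rewrite -mulmxA pM mulmxA -(mulmxA q) fy // mulmxA qM !mulmxA.
Qed.

Lemma reltr_sandwich_out y : q *m reltr Z U V y *m p = reltr M U V (q *m y *m p).
Proof.
rewrite mulmx_sumr mulmx_suml; apply: eq_bigr => C CU.
by have [Vr _] := lcosets_sub sUV CU; rewrite gconj_sandwich_out.
Qed.

End TraceTransfer.

(** * Functionals that kill proper traces *)

Section BrauerFunctionals.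
Local Open Scope ring_scope.

Variables (k : fieldType) (gT : finGroupType) (V : {group gT}).
Variables (Y : representation k V) (mu : 'M[k]_(rdegree Y) -> k).

(** Functionals on the endomorphism algebra of Y that factor through its Brauer
    quotient at V. *)
Definition brauer_functional :=
  (forall x y, fixed_by Y V x -> fixed_by Y V y -> mu (x + y) = mu x + mu y) /\
  (forall (U : {group gT}) x, U \subset V -> U :!=: V -> fixed_by Y U x ->
     mu (reltr Y U V x) = 0).

Hypothesis muP : brauer_functional.

Lemma fixed_by0 : fixed_by Y V 0.
Proof. by move=> h _; rewrite mul0mx mulmx0. Qed.

Lemma brauer0 : mu 0 = 0.
Proof. by apply: (addrI (mu 0)); rewrite -muP.1 ?addr0 //; apply: fixed_by0. Qed.

Lemma brauer_sum (I : finType) (P : pred I) (F : I -> 'M_(rdegree Y)) :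
  (forall i, P i -> fixed_by Y V (F i)) ->
  mu (\sum_(i | P i) F i) = \sum_(i | P i) mu (F i).
Proof.
move=> fF; suffices [] : fixed_by Y V (\sum_(i | P i) F i) /\
   mu (\sum_(i | P i) F i) = \sum_(i | P i) mu (F i) by [].
elim/big_rec2: _ => [|i y x Pi [fx <-]]; first by rewrite brauer0; split=> //; apply: fixed_by0.
split; [by apply: fixed_byD => //; apply: fF | by rewrite muP.1 //; apply: fF].
Qed.

(** The sum over an orbit is the trace of one of its terms from the stabiliser,
    which is a proper subgroup unless the orbit is a single point. *)
Lemma brauer_orbit_sum (rT : finType) (to : {action gT &-> rT}) (S : {set rT})
    (F : rT -> 'M_(rdegree Y)) :
    [acts V, on S | to] ->
    (forall x v, x \in S -> v \in V -> F (to x v^-1%g) = gconj Y v (F x)) ->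
  mu (\sum_(x in S) F x) = \sum_(x in S | x \in 'Fix_to(V)) mu (F x).
Proof.
move=> actS eqF; rewrite (partition_big_imset (orbit to V)) /=.
have orbS x y : x \in S -> y \in orbit to V x -> y \in S.
  by move=> Sx /orbitP[v Vv <-]; rewrite (acts_act actS).
have fixO x : x \in S -> fixed_by Y V (\sum_(y in orbit to V x) F y).
  move=> Sx; apply: fixed_by_gconj => // v Vv; rewrite gconj_sum.
  rewrite [RHS](reindex_inj (act_inj to v^-1%g)) /=.
  apply: eq_big => [y|y xy]; last by rewrite eqF //; apply: orbS xy.
  by rewrite (orbit_transl _ (mem_orbit _ _ _)) ?groupV.
have inO x : x \in S -> forall y,
    (y \in S) && (orbit to V y == orbit to V x) = (y \in orbit to V x).
  move=> Sx y; apply/andP/idP => [[_ /eqP <-]|xy]; first exact: orbit_refl.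
  by split; [apply: orbS xy | apply/eqP/orbit_eqP].
rewrite brauer_sum => [|O /imsetP[x Sx ->]]; last first.
  by rewrite (eq_bigl _ _ (inO x Sx)); apply: fixO.
rewrite [RHS]big_mkcondr [RHS](partition_big_imset (orbit to V)) /=.
apply: eq_bigr => O /imsetP[x Sx ->].
rewrite !(eq_bigl _ _ (inO x Sx)) -big_mkcondr /=.
have [fx|nfx] := boolP (x \in 'Fix_to(V)).
  by rewrite (orbit1P fx) big_mkcondr !big_set1 fx.
rewrite [RHS]big1 => [|y /andP[xy fy]]; last first.
  case/negP: nfx; move: xy; rewrite orbit_sym (orbit1P fy) inE => /eqP ->.
  exact: fy.
set U := 'C_V[x | to]%G; have sUV : U \subset V by apply: subsetIl.
have ntU : U :!=: V.
  apply: contraNneq nfx => eUV; apply/afixP => v; rewrite -eUV => /setIP[_ /astab1P].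
  by [].
have fU : fixed_by Y U (F x).
  apply: fixed_by_gconj => // v Uv; rewrite -eqF //; last exact: (subsetP sUV).
  by congr F; apply/astab1P; move: (groupVr Uv) => /setIP[].
rewrite -[RHS](muP.2 U (F x) sUV ntU fU); congr mu.
have -> : orbit to V x = [set to x (repr C)^-1%g | C in lcosets U V].
  apply/setP=> y; apply/orbitP/imsetP => [[v Vv <-]|[C CU ->]].
    exists (v^-1 *: U)%g; first by apply/lcosetsP; exists v^-1%g; rewrite ?groupV.
    have [h Hh ->] := mem_repr_lcoset U v^-1%g; rewrite invMg invgK actM.
    by congr (to _ _); apply/esym/astab1P; move: (groupVr Hh) => /setIP[].
  by have [Vr _] := lcosets_sub sUV CU; exists (repr C)^-1%g; rewrite ?groupV.
rewrite big_imset /=; last first.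
  move=> C D CU DU; have [Vc defC] := lcosets_sub sUV CU.
  have [Vd defD] := lcosets_sub sUV DU => ecd; rewrite defC defD.
  apply/esym/lcoset_eqP; rewrite mem_lcoset inE groupM ?groupV //=.
  by apply/astab1P; rewrite actM -[RHS](actKV to (repr D)) -ecd.
by apply: eq_bigr => C CU; rewrite eqF //; have [] := lcosets_sub sUV CU.
Qed.

End BrauerFunctionals.

Section CosetAction.
Variables (gT : finGroupType).

Lemma lcoset_is_action :
  is_action [set: gT] (fun (C : {set gT}) (g : gT) => g^-1 *: C).
Proof.
apply: is_total_action => [C|C g h]; rewrite /= ?invg1 ?lcoset1 //.
by rewrite invMg lcosetM.
Qed.

Definition lcoset_action := Action lcoset_is_action.

Definition fixed_lcosets (V H G : {set gT}) :=
  [set C in lcosets H G | [forall v in V, v *: C == C]].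

Lemma fixed_lcosetP (V H G C : {set gT}) :
  reflect (C \in lcosets H G /\ forall v, v \in V -> v *: C = C)
          (C \in fixed_lcosets V H G).
Proof.
rewrite inE; apply: (iffP andP) => -[CG fC]; split=> //.
  by move=> v Vv; apply/eqP; apply: (forall_inP fC).
by apply/forall_inP => v Vv; apply/eqP/fC.
Qed.

Lemma fixed_lcoset_self (V G : {group gT}) g :
  g \in G -> g *: V \in fixed_lcosets V V G -> g \in 'N(V).
Proof.
move=> Gg /fixed_lcosetP[_ fC]; apply/normP/eqP.
rewrite eqEcard cardJg leqnn andbT; apply/subsetP => _ /imsetP[v Vv ->].
by rewrite conjgE -mem_lcoset -(fC v Vv) -lcosetM lcoset_refl.
Qed.

End CosetAction.

Section Mackey.
Local Open Scope ring_scope.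

Variables (k : fieldType) (gT : finGroupType) (G V H : {group gT}).
Variables (M : representation k G) (Y : representation k V).
Variables (mu : 'M[k]_(rdegree Y) -> k).
Hypotheses (muP : brauer_functional mu) (sVG : V \subset G) (sHG : H \subset G).

(** Modulo proper traces, only the double cosets that consist of a single coset
    count in the Mackey formula. Here Phi is typically multiplication by
    V-homomorphisms on both sides. *)
Lemma brauer_mackey (Phi : 'M[k]_(rdegree M) -> 'M[k]_(rdegree Y)) w :
    (forall x y, Phi (x + y) = Phi x + Phi y) ->
    (forall v x, v \in V -> Phi (gconj M v x) = gconj Y v (Phi x)) ->
    fixed_by M H w ->
  mu (Phi (reltr M H G w)) =
    \sum_(C in fixed_lcosets V H G) mu (Phi (gconj M (repr C) w)).
Proof.
move=> PhiD PhiV fw.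
have Phi0 : Phi 0 = 0 by apply: (addrI (Phi 0)); rewrite -PhiD !addr0.
have -> : Phi (reltr M H G w) = \sum_(C in lcosets H G) Phi (gconj M (repr C) w).
  by apply: (big_morph Phi PhiD Phi0).
rewrite (brauer_orbit_sum muP (to := lcoset_action gT)) => [||C v CG Vv /=].
- apply: eq_bigl => C; rewrite [RHS]inE /=; congr (_ && _); apply/afixP/forall_inP => fC v Vv /=.
    by have /= := fC v^-1%g (groupVr Vv); rewrite invgK => ->.
  by apply/eqP/fC; rewrite groupV.
- apply/actsP=> v Vv C /=; rewrite mulg_lcosets // groupV.
  exact: (subsetP sVG).
have Gv := subsetP sVG v Vv; rewrite invgK.
have [Gr defC] := lcosets_sub sHG CG.
rewrite -PhiV // -gconjM // -(gconj_repr sHG (groupM Gv Gr) fw).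
by rewrite lcosetM -defC.
Qed.

End Mackey.

(** * Higman's criterion *)

Lemma hom_mul_fixed (k : fieldType) (gT : finGroupType) (G H : {group gT}) (sHG : H \subset G)
    (M : representation k G) (L : representation k H)
    (q : 'M[k]_(rdegree M, rdegree L)) (p : 'M[k]_(rdegree L, rdegree M)) :
    kG_hom (M := L) (N := Res sHG M) q -> kG_hom (M := Res sHG M) (N := L) p ->
  fixed_by M H (q *m p)%R.
Proof.
by move=> Hq Hp h Hh; rewrite -mulmxA [(p *m _)%R](Hp _ Hh) mulmxA [(q *m _)%R](Hq _ Hh) mulmxA.
Qed.

Section HigmanCriterion.
Local Open Scope ring_scope.

Variables (k : fieldType) (gT : finGroupType) (G H : {group gT}).
Hypothesis sHG : H \subset G.
Variable L : representation k H.
Local Notation t := (@coset_repr gT G H).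
Local Notation I := (Ind sHG L).

(** The coordinate of an induced vector along the coset of g, the block of g
    being identified with L by means of g. *)
Definition ind_proj (g : gT) : 'M[k]_(rdegree L, rdegree I) :=
  \mxrow_(j < #|lcosets H G|) ind_block L (g^-1 * t j)%g.

Lemma ind_proj_tensor g g' : g' \in G ->
  ind_proj g *m ind_tensor G L g' = ind_block L (g^-1 * g')%g.
Proof. by move=> Gg'; rewrite mul_mxrow_mxcol ind_block_sum. Qed.

Lemma ind_proj_mul g x : x \in G -> ind_proj g *m I x = ind_proj (x^-1 * g)%g.
Proof.
move=> Gx; rewrite /= /ind_mx mul_mxrow; apply: eq_mxrow => j.
have [Gt _] := coset_reprP sHG j.
by rewrite ind_proj_tensor ?groupM // invMg invgK mulgA.
Qed.

Lemma ind_mul_tensor g x : g \in G -> I x *m ind_tensor G L g = ind_tensor G L (x * g)%g.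
Proof. by move=> Gg; apply: ind_mx_tensor. Qed.

Lemma ind_proj_col : 1%:M = \mxcol_j ind_proj (t j).
Proof.
by rewrite -(ind_tensor_basis sHG L) -mxblockEh -mxblockEv; apply: eq_mxblock.
Qed.

Lemma ind_proj_sum : \sum_j ind_tensor G L (t j) *m ind_proj (t j) = 1%:M.
Proof.
by rewrite -mul_mxrow_mxcol -ind_proj_col ind_tensor_basis // mulmx1.
Qed.

Lemma ind_tensor1_hom : kG_hom (M := L) (N := Res sHG I) (ind_tensor G L 1).
Proof.
by move=> h Hh /=; rewrite -ind_tensorM // mul1g ind_mx_tensor // mulg1.
Qed.

Lemma ind_proj1_hom : kG_hom (M := Res sHG I) (N := L) (ind_proj 1).
Proof.
move=> h Hh; have Gh := subsetP sHG h Hh.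
rewrite [LHS]ind_proj_mul // mul_mxrow; apply: eq_mxrow => j.
rewrite mulg1 invgK invg1 mul1g /ind_block groupMl //.
by case: ifP => [Ht|]; rewrite ?mulmx0 ?repr_mxM.
Qed.

Lemma reltr_ind (M : representation k G) x :
  fixed_by M H x -> reltr M H G x = \sum_j gconj M (t j) x.
Proof.
move=> fx; rewrite /reltr big_enum_val /=; apply: eq_bigr => j _.
by [].
Qed.

Lemma ind_block_coset i g : g \in G -> enum_val i = (g *: H)%g ->
  forall j, j != i -> ind_block L (g^-1 * t j)%g = 0.
Proof.
move=> Gg defi j ne_ji; rewrite /ind_block -mem_lcoset -defi.
have [_ defj] := coset_reprP sHG j; case: ifP => // tj; case/eqP: ne_ji.
by apply: enum_val_inj; rewrite defj defi; apply/lcoset_eqP; rewrite -defi.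
Qed.

Lemma lcoset_index g : g \in G -> exists i : 'I_#|lcosets H G|, enum_val i = (g *: H)%g.
Proof.
move=> Gg; have Cg : (g *: H)%g \in lcosets H G by apply/lcosetsP; exists g.
by exists (enum_rank_in Cg (g *: H)%g); rewrite enum_rankK_in.
Qed.

Variable M : representation k G.

Section Frobenius.

Variables (q : 'M[k]_(rdegree M, rdegree L)) (p : 'M[k]_(rdegree L, rdegree M)).
Hypotheses (Hq : kG_hom (M := L) (N := Res sHG M) q)
           (Hp : kG_hom (M := Res sHG M) (N := L) p).

Definition ind_lift : 'M[k]_(rdegree I, rdegree M) := \mxcol_j (p *m M (t j)^-1%g).
Definition ind_extend : 'M[k]_(rdegree M, rdegree I) := \mxrow_j (M (t j) *m q).

Lemma ind_proj_lift g : g \in G -> ind_proj g *m ind_lift = p *m M g^-1%g.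
Proof.
move=> Gg; have [i defi] := lcoset_index Gg; have [Gt ti] := coset_reprP sHG i.
have Hg : (g^-1 * t i)%g \in H by rewrite -mem_lcoset -defi ti lcoset_refl.
rewrite mul_mxrow_mxcol (bigD1 i) //= big1 ?addr0 => [|j ne_ji].
  rewrite /ind_block Hg mulmxA -(Hp Hg) -mulmxA /= -repr_mxM ?groupM ?groupV //.
  by rewrite mulgK.
by rewrite (ind_block_coset Gg defi) // mul0mx.
Qed.

Lemma ind_extend_tensor g : g \in G -> ind_extend *m ind_tensor G L g = M g *m q.
Proof.
move=> Gg; have [i defi] := lcoset_index Gg; have [Gt ti] := coset_reprP sHG i.
have Hg : ((t i)^-1 * g)%g \in H by rewrite -mem_lcoset -ti defi lcoset_refl.
rewrite mul_mxrow_mxcol (bigD1 i) //= big1 ?addr0 => [|j ne_ji].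
  rewrite /ind_block Hg -mulmxA (Hq Hg) mulmxA /= -repr_mxM ?groupM ?groupV //.
  by rewrite mulKVg.
rewrite (_ : ind_block _ _ = 0) ?mulmx0 //.
rewrite /ind_block (mem_coset_repr sHG) -defi (inj_eq enum_val_inj) (negPf ne_ji).
by [].
Qed.

Lemma ind_lift_hom : kG_hom (M := M) (N := I) ind_lift.
Proof.
move=> x Gx; rewrite -[LHS]mul1mx -[RHS]mul1mx -ind_proj_sum !mulmx_suml.
apply: eq_bigr => j _; have [Gt _] := coset_reprP sHG j.
rewrite -!mulmxA; congr (_ *m _); rewrite [in RHS]mulmxA ind_proj_mul //.
rewrite [in LHS]mulmxA !ind_proj_lift ?groupM ?groupV // -mulmxA -repr_mxM ?groupV //.
by rewrite invMg invgK.
Qed.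

Lemma ind_extend_hom : kG_hom (M := I) (N := M) ind_extend.
Proof.
move=> x Gx; rewrite -[LHS]mulmx1 -[RHS]mulmx1 -ind_proj_sum !mulmx_sumr.
apply: eq_bigr => j _; have [Gt _] := coset_reprP sHG j.
rewrite !mulmxA; congr (_ *m _).
rewrite -mulmxA ind_mul_tensor // -mulmxA !ind_extend_tensor ?groupM //.
by rewrite mulmxA -repr_mxM.
Qed.

Lemma ind_extend_lift : ind_extend *m ind_lift = reltr M H G (q *m p).
Proof.
rewrite reltr_ind ?mul_mxrow_mxcol; last exact: hom_mul_fixed Hq Hp.
by apply: eq_bigr => j _; rewrite /gconj !mulmxA.
Qed.

End Frobenius.

(** Frobenius reciprocity turns maps M -> Ind L -> M into maps p : M -> L and
    q : L -> M over H, and their composite into the trace of q p. *)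
Lemma higman_summandP :
  is_summand_of M I <->
  exists (q : 'M_(rdegree M, rdegree L)) (p : 'M_(rdegree L, rdegree M)),
    [/\ kG_hom (M := L) (N := Res sHG M) q, kG_hom (M := Res sHG M) (N := L) p
      & reltr M H G (q *m p) = 1%:M].
Proof.
split=> [/summand_split[a [b [Ha Hb ba]]] | [q [p [Hq Hp tr1]]]]; last first.
  apply: (split_summand (ind_lift_hom Hp) (ind_extend_hom Hq)).
  by rewrite (ind_extend_lift Hq Hp).
have Ha' : kG_hom (M := Res sHG M) (N := Res sHG I) a.
  by move=> h Hh; apply: Ha; apply: (subsetP sHG).
have Hb' : kG_hom (M := Res sHG I) (N := Res sHG M) b.
  by move=> h Hh; apply: Hb; apply: (subsetP sHG).
have Hq := kG_homM ind_tensor1_hom Hb'; have Hp := kG_homM Ha' ind_proj1_hom.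
exists (b *m ind_tensor G L 1), (ind_proj 1 *m a); split=> //.
rewrite reltr_ind; last exact: hom_mul_fixed Hq Hp.
have -> : 1%:M = b *m (\sum_j ind_tensor G L (t j) *m ind_proj (t j)) *m a.
  by rewrite ind_proj_sum mulmx1.
rewrite mulmx_sumr mulmx_suml.
apply: eq_bigr => j _; have [Gt _] := coset_reprP sHG j.
rewrite /gconj !mulmxA -(Hb _ Gt) -(mulmxA _ a) (Ha _ (groupVr Gt)).
rewrite -(mulmxA b (I _)) ind_mul_tensor // mulg1 !mulmxA -(mulmxA _ (ind_proj _) (I _)).
by rewrite ind_proj_mul ?groupV // invgK mulg1.
Qed.

End HigmanCriterion.

Lemma relatively_projectiveP (k : fieldType) (gT : finGroupType) (G H : {group gT})
    (M : representation k G) :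
  relatively_projective H M <->
  H \subset G /\ exists2 x, fixed_by M H x & reltr M H G x = 1%:M%R.
Proof.
split=> [[sHG [L /higman_summandP[q [p [Hq Hp tr1]]]]] | [sHG [x fx tr1]]].
  split=> //; exists (q *m p)%R => //; apply: hom_mul_fixed Hq Hp.
exists sHG, (Res sHG M); apply/higman_summandP; exists 1%:M%R, x.
by split=> [|//|]; [apply: kG_hom1 | rewrite mul1mx].
Qed.

(** * Forms and the symmetric Higman criterion *)

Section GramMatrices.
Local Open Scope ring_scope.

Variable k : fieldType.

Lemma bformM n m1 m2 (B : 'M[k]_n) (f : 'M_(n, m1)) (h : 'M_(n, m2)) u v :
  bform B (f *m u) (h *m v) = (u^T *m (f^T *m B *m h) *m v) 0 0.
Proof. by rewrite /bform trmx_mul !mulmxA. Qed.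

Lemma bform_tr n (B : 'M[k]_n) u v : bform B^T u v = bform B v u.
Proof.
have -> : bform B v u = (v^T *m B *m u)^T 0 0 by rewrite mxE.
by rewrite !trmx_mul trmxK mulmxA.
Qed.

Lemma bform_eq n (B C : 'M[k]_n) : (forall u v, bform B u v = bform C u v) -> B = C.
Proof.
move=> eBC; apply/matrixP=> i j; have := eBC (delta_mx i 0) (delta_mx j 0).
by rewrite /bform !trmx_delta -!rowE -!colE !mxE.
Qed.

Lemma pullback_mul m n p (D : 'M[k]_m) (P : 'M_(m, n)) (f : 'M_(n, p)) :
  f^T *m (P^T *m D *m P) *m f = (P *m f)^T *m D *m (P *m f).
Proof. by rewrite trmx_mul !mulmxA. Qed.

Lemma pullback_tr m n (D : 'M[k]_m) (P : 'M_(m, n)) :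
  (P^T *m D *m P)^T = P^T *m D^T *m P.
Proof. by rewrite !trmx_mul trmxK mulmxA. Qed.

Lemma nondegenerateE n (B : 'M[k]_n) : Defs.nondegenerate B <-> B \in unitmx.
Proof.
split=> [ndB | UB u Bu]; last first.
  have: u^T *m B = 0.
    apply/matrixP=> i j; have := Bu (delta_mx j 0).
    by rewrite /bform -colE mxE ord1 => ->; rewrite mxE.
  move/(congr1 (mulmx^~ (invmx B))); rewrite mulmxK // mul0mx.
  by move/(canRL (@trmxK _ _ _)) ->; rewrite trmx0.
rewrite -row_free_unit -kermx_eq0; apply/rowV0P=> u /sub_kermxP uB.
apply: (can_inj (@trmxK _ _ _)); rewrite trmx0; apply: ndB => v.
by rewrite /bform trmxK uB mul0mx mxE.
Qed.

Lemma nondegenerate_onE n m (B : 'M[k]_n) (i : 'M_(n, m)) :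
  nondegenerate_on B i <-> i^T *m B *m i \in unitmx.
Proof.
rewrite -nondegenerateE /nondegenerate_on /Defs.nondegenerate.
by split=> nd u Bu; apply: nd => v; rewrite -[RHS](Bu v) bformM.
Qed.

(** The forms C on the source and B on the target of f are given by their Gram
    matrices. *)
Definition adjoint m n (C : 'M[k]_m) (B : 'M[k]_n) (f : 'M[k]_(n, m)) : 'M[k]_(m, n) :=
  invmx C *m f^T *m B.

Lemma adjointD m n (C : 'M_m) (B : 'M_n) (f h : 'M_(n, m)) :
  adjoint C B (f + h) = adjoint C B f + adjoint C B h.
Proof. by rewrite /adjoint linearD mulmxDr mulmxDl. Qed.

Lemma adjointM m n p (C : 'M_m) (B : 'M_n) (D : 'M_p) (f : 'M_(n, m)) (h : 'M_(p, n)) :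
  B \in unitmx -> adjoint C D (h *m f) = adjoint C B f *m adjoint B D h.
Proof. by move=> UB; rewrite /adjoint trmx_mul !mulmxA mulmxK. Qed.

Lemma adjointK m n (C : 'M_m) (B : 'M_n) (f : 'M_(n, m)) :
    C \in unitmx -> C^T = C -> B \in unitmx -> B^T = B ->
  adjoint B C (adjoint C B f) = f.
Proof.
move=> UC symC UB symB; rewrite /adjoint !trmx_mul trmxK trmx_inv symB symC.
by rewrite !mulmxA mulVmx // mul1mx mulmxKV.
Qed.

Lemma adjoint_scalar n (B : 'M_n) c : B \in unitmx -> adjoint B B c%:M = c%:M.
Proof. by move=> UB; rewrite /adjoint tr_scalar_mx scalar_mxC -mulmxA mulVmx // mulmx1. Qed.

Lemma adjoint_unit n (B : 'M_n) f : B \in unitmx -> (adjoint B B f \in unitmx) = (f \in unitmx).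
Proof. by move=> UB; rewrite /adjoint !unitmx_mul unitmx_inv UB unitmx_tr andbT. Qed.

Variables (gT : finGroupType) (G : {group gT}) (M : representation k G).

Lemma G_formE (B : 'M_(rdegree M)) :
  G_form B <->
  [/\ B \in unitmx, B^T = B & forall g, g \in G -> (M g)^T *m B *m M g = B].
Proof.
split=> -[ndB symB invB]; split.
- exact/nondegenerateE.
- by apply: bform_eq => u v; rewrite [RHS]symB bform_tr.
- by move=> g Gg; apply: bform_eq => u v; rewrite -(invB g u v Gg) bformM.
- exact/nondegenerateE.
- by move=> u v; rewrite -{1}symB bform_tr.
by move=> g u v Gg; rewrite bformM invB.
Qed.

End GramMatrices.

Section SymmetricHigman.
Local Open Scope ring_scope.

Variables (k : fieldType) (gT : finGroupType) (G H : {group gT}).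
Variable M : representation k G.
Local Notation n := (rdegree M).

Definition form_trace (C : 'M[k]_n) : 'M[k]_n :=
  \sum_(D in lcosets H G) (M (repr D)^-1%g)^T *m C *m M (repr D)^-1%g.

(** The module L is the quotient of M by the radical of C, and a is the
    projection. *)
Lemma radical_quotient (sHG : H \subset G) (C : 'M[k]_n) :
    C^T = C -> (forall h, h \in H -> (M h)^T *m C *m M h = C) ->
  exists (L : representation k H) (D : 'M_(rdegree L)) (a : 'M_(rdegree L, n)),
    [/\ G_form D, kG_hom (M := Res sHG M) (N := L) a & a^T *m D *m a = C].
Proof.
move=> symC invC; have := row_base_free C; have := col_base_full C.
move: (\rank C) (mxrankE C) (col_base C) (row_base C) (mulmx_base C) => r _ c a ca.
move=> /row_fullP[c' c'c] /row_freeP[a' aa'].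
have CE : C *m (a' *m a) = C by rewrite -ca -mulmxA (mulmxA a) aa' mul1mx.
have CE' : (a' *m a)^T *m C = C by rewrite -{1}symC -trmx_mul CE.
have a_hom h : h \in H -> a *m M h *m a' *m a = a *m M h.
  move=> Hh; have Gh := subsetP sHG h Hh.
  have Ch : C *m M h = (M h^-1%g)^T *m C.
    by rewrite -{1}(invC h^-1%g (groupVr Hh)) repr_mxKV.
  rewrite -[LHS]mul1mx -[RHS]mul1mx -c'c -!(mulmxA c'); congr (_ *m _).
  by rewrite !mulmxA ca Ch -!mulmxA CE.
have reprL : mx_repr H (fun h => a *m M h *m a').
  split=> [|x y Hx Hy]; first by rewrite repr_mx1 mulmx1.
  by rewrite repr_mxM ?(subsetP sHG) // !mulmxA a_hom.
pose D := a'^T *m C *m a'.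
have aDa : a^T *m D *m a = C.
  by rewrite -[RHS]CE -[in RHS]CE' trmx_mul !mulmxA.
have Da : D *m (a *m c'^T) = 1%:M.
  rewrite /D mulmxA -(mulmxA _ a') -mulmxA -mulmxA (mulmxA C) CE.
  by rewrite -symC -ca !trmx_mul !mulmxA -trmx_mul aa' trmx1 mul1mx -trmx_mul c'c trmx1.
have symD : D^T = D by rewrite /D !trmx_mul trmxK symC mulmxA.
have defD : D = a'^T *m C *m a' by [].
clearbody D; exists (Representation (MxRepresentation reprL)), D, a; split=> //=; last first.
  by move=> h Hh /=; rewrite a_hom.
apply/G_formE; split=> /=.
- by case: (mulmx1_unit Da).
- by [].
move=> h Hh; rewrite !trmx_mul -!mulmxA (mulmxA a^T) (mulmxA _ a) aDa.
by rewrite (mulmxA C) (mulmxA (M h)^T) (mulmxA (M h)^T) invC // mulmxA -defD.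
Qed.

Lemma ind_form_sum (sHG : H \subset G) (L : representation k H) (D : 'M_(rdegree L)) :
  ind_form sHG D = \sum_(j < #|lcosets H G|)
    (ind_proj sHG L (coset_repr j))^T *m D *m ind_proj sHG L (coset_repr j).
Proof.
have e1 := ind_proj_col sHG L.
rewrite -[LHS]mulmx1 -[LHS]mul1mx -{1}trmx1 e1 /ind_form mul_mxdiag_mxcol tr_mxcol.
by rewrite mul_mxrow_mxcol; apply: eq_bigr => j _; rewrite mulmxA.
Qed.

Variable B0 : 'M[k]_n.
Hypothesis formB0 : G_form B0.

Lemma form_trace_mul x : H \subset G -> form_trace (B0 *m x) = B0 *m reltr M H G x.
Proof.
have [UB symB invB] := (G_formE B0).1 formB0.
move=> sHG; rewrite /form_trace /reltr mulmx_sumr; apply: eq_bigr => C CG.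
have [Gr _] := lcosets_sub sHG CG; rewrite /gconj !mulmxA; congr (_ *m _ *m _).
by rewrite -{2}(invB _ (groupVr Gr)) repr_mxKV.
Qed.

(** The form B0 identifies invariant forms with endomorphisms. By
    [radical_quotient] a G-form is H-projective as soon as it is the trace of a
    symmetric H-form, whether or not that form is degenerate. *)
Lemma symmetrically_projectiveP :
  symmetrically_projective H M <->
  H \subset G /\ exists x : 'M[k]_n,
    [/\ fixed_by M H x, adjoint B0 B0 x = x & reltr M H G x \in unitmx].
Proof.
have [UB0 symB0 invB0] := (G_formE B0).1 formB0.
have B0V g : g \in G -> B0 *m M g = (M g^-1%g)^T *m B0.
  by move=> Gg; rewrite -{1}(invB0 _ (groupVr Gg)) repr_mxKV.
split=> [[B [/G_formE[UB symB invB] [sHG [L [D [formD [f [Hf Df]]]]]]]]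
        | [sHG [x [fx sx Ux]]]].
  have [UD symD invD] := (G_formE D).1 formD.
  split=> //; have {}Df : f^T *m ind_form sHG D *m f = B.
    by apply: bform_eq => u v; rewrite -Df bformM.
  have [a defa]: exists a, a = ind_proj sHG L 1 *m f by exists (ind_proj sHG L 1 *m f).
  have Ha h : h \in H -> a *m M h = L h *m a.
    move=> Hh; rewrite defa -mulmxA (Hf _ (subsetP sHG h Hh)) mulmxA.
    by rewrite [_ *m (Ind sHG L) h](ind_proj1_hom sHG L Hh) mulmxA.
  pose C := a^T *m D *m a.
  have symC : C^T = C by rewrite !trmx_mul trmxK symD mulmxA.
  have invC h : h \in H -> (M h)^T *m C *m M h = C.
    move=> Hh; rewrite !mulmxA -trmx_mul Ha // -(mulmxA _ a) Ha //.
    by rewrite trmx_mul !mulmxA -(mulmxA a^T _ D) -(mulmxA a^T _ (L h)) invD.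
  have trC : form_trace C = B.
    rewrite -Df ind_form_sum mulmx_sumr mulmx_suml /form_trace big_enum_val /=.
    apply: eq_bigr => j _; rewrite -/(coset_repr j).
    have [Gt _] := coset_reprP sHG j.
    have projf : ind_proj sHG L (coset_repr j) *m f = a *m M (coset_repr j)^-1%g.
      rewrite defa -mulmxA (Hf _ (groupVr Gt)) mulmxA ind_proj_mul ?groupV //.
      by rewrite invgK mulg1.
    by rewrite [RHS]pullback_mul projf trmx_mul !mulmxA.
  clearbody C; have BxC : B0 *m (invmx B0 *m C) = C by rewrite mulKVmx.
  exists (invmx B0 *m C); split.
  - move=> h Hh; have Gh := subsetP sHG h Hh; apply: (can_inj (mulKmx UB0)).
    rewrite [LHS]mulmxA BxC mulmxA B0V // -mulmxA BxC -{1}(invC _ (groupVr Hh)).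
    by rewrite repr_mxKV.
  - by rewrite /adjoint trmx_mul trmx_inv symB0 symC -!mulmxA mulVmx // mulmx1.
  by move: UB; rewrite -trC -{1}BxC form_trace_mul // unitmx_mul UB0.
pose C := B0 *m x.
have symC : C^T = C by rewrite /C trmx_mul symB0 -[in RHS]sx /adjoint !mulmxA mulmxV ?mul1mx.
have invC h : h \in H -> (M h)^T *m C *m M h = C.
  move=> Hh; have Gh := subsetP sHG h Hh.
  by rewrite -!mulmxA fx // !mulmxA invB0.
have [L [D [a [formD Ha aDa]]]] := radical_quotient sHG symC invC.
pose f := ind_lift sHG a.
have Hf : kG_hom (M := M) (N := Ind sHG L) f := ind_lift_hom Ha.
have BE : f^T *m ind_form sHG D *m f = B0 *m reltr M H G x.
  rewrite -form_trace_mul // ind_form_sum mulmx_sumr mulmx_suml /form_trace [RHS]big_enum_val /=.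
  apply: eq_bigr => j _; rewrite -/(coset_repr j) -/C -aDa.
  have [Gt _] := coset_reprP sHG j.
  have fE := ind_proj_lift Ha Gt; rewrite -/f in fE.
  by rewrite [LHS]pullback_mul fE trmx_mul !mulmxA.
exists (B0 *m reltr M H G x); split; last first.
  exists sHG, L, D; split=> //; exists f; split=> // u v.
  by rewrite bformM BE.
apply/G_formE; split.
- by rewrite unitmx_mul UB0.
- rewrite -form_trace_mul // /form_trace (raddf_sum (@trmx _ _ _)); apply: eq_bigr => K _.
  by rewrite /= -/C pullback_tr symC.
move=> g Gg; rewrite -!mulmxA (reltr_fixed sHG (subxx G) fx) //.
by rewrite !mulmxA invB0.
Qed.

End SymmetricHigman.

(** * The vertex trace *)

Lemma reltr_conj (k : fieldType) (gT : finGroupType) (G H : {group gT})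
    (M : representation k G) g x :
    H \subset G -> g \in G -> fixed_by M H x ->
  reltr M (H :^ g^-1)%G G (gconj M g x) = reltr M H G x.
Proof.
move=> sHG Gg fx; rewrite /reltr.
rewrite [RHS](reindex_onto (fun C : {set gT} => C :* g) (fun C => C :* g^-1)) /=; last first.
  by move=> C _; rewrite -rcosetM mulVg rcoset1.
have sHgG : H :^ g^-1 \subset G by rewrite conj_subG ?groupV.
have cosE c : (c *: (H :^ g^-1)) :* g = (c * g)%g *: H.
  by rewrite conjsgE invgK lcosetM !mulgA -[RHS]rcoset1 -(mulVg g) rcosetM.
apply: eq_big => [C|C CH].
  rewrite -rcosetM mulgV rcoset1 eqxx andbT.
  apply/lcosetsP/lcosetsP => [[c Gc ->]|[c Gc eC]].
    by exists (c * g)%g; rewrite ?groupM // cosE.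
  exists (c * g^-1)%g; rewrite ?groupM ?groupV //.
  by rewrite -[C]rcoset1 -(mulgV g) rcosetM eC -{1}(mulgKV g c) -cosE -rcosetM mulgV rcoset1.
have /lcosetsP[c Gc ->] := CH; rewrite cosE (gconj_repr _ _ fx) ?groupM //.
rewrite gconj_repr // ?gconjM //; exact: fixed_by_conj.
Qed.

Section Vertex.
Local Open Scope ring_scope.

Variables (k : closedFieldType) (gT : finGroupType) (G V : {group gT}).
Variable M : representation k G.
Hypotheses (indM : indecomposable M) (sVG : V \subset G).
Hypothesis minV : forall U : {group gT},
  relatively_projective U M -> U \subset V -> U :=: V.
Local Notation n := (rdegree M).
Local Notation lam := some_eigenvalue.
Implicit Types (x y : 'M[k]_n) (g : gT).

Definition vtrace x := lam (reltr M V G x).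
Local Notation s := vtrace.

Lemma reltr_hom (H : {group gT}) x : H \subset G -> fixed_by M H x ->
  kG_hom (M := M) (N := M) (reltr M H G x).
Proof. by move=> sHG fx; apply: reltr_fixed. Qed.

Lemma reltr_unit_projective (H : {group gT}) x :
  H \subset G -> fixed_by M H x -> reltr M H G x \in unitmx -> relatively_projective H M.
Proof.
move=> sHG fx Ux; have fr := reltr_hom sHG fx.
have fi := kG_homV Ux fr.
apply/relatively_projectiveP; split=> //; exists (x *m invmx (reltr M H G x)).
  by apply: fixed_byM => //; apply: fixed_byS sHG _.
by rewrite -reltrMr // mulmxV.
Qed.

Lemma vtrace_unit x : fixed_by M V x -> (s x != 0) = (reltr M V G x \in unitmx).
Proof. by move=> fx; rewrite /s lam_unit //; apply: reltr_hom. Qed.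

Lemma vtraceD x y : fixed_by M V x -> fixed_by M V y -> s (x + y) = s x + s y.
Proof. by move=> fx fy; rewrite /s reltrD lamD //; apply: reltr_hom. Qed.

Lemma vtrace0 : s 0 = 0.
Proof.
rewrite /s (_ : reltr M V G 0 = 0) ?(lam0 indM) // /reltr big1 // => C _.
by rewrite /gconj mulmx0 mul0mx.
Qed.

(** By transitivity of traces, the minimality of [V] says that [vtrace] kills
    traces from proper subgroups. *)
Lemma vtrace_brauer : brauer_functional (Y := Res sVG M) s.
Proof.
split=> [x y fx fy | U x sUV neUV fx]; first exact: vtraceD.
rewrite /s (reltr_trans sUV sVG (subxx G) fx); apply/eqP; apply: contraNT neUV => Ux.
have sUG := subset_trans sUV sVG.
apply/eqP/minV => //; apply: (@reltr_unit_projective U x) => //.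
by rewrite -(lam_unit indM) //; apply: reltr_hom.
Qed.

Lemma vtraceMl x c : kG_hom (M := M) (N := M) c -> fixed_by M V x -> s (c *m x) = lam c * s x.
Proof. by move=> Hc fx; rewrite /s -reltrMl // lamM //; apply: reltr_hom. Qed.

Lemma vtraceMr x c : kG_hom (M := M) (N := M) c -> fixed_by M V x -> s (x *m c) = s x * lam c.
Proof. by move=> Hc fx; rewrite /s -reltrMr // lamM //; apply: reltr_hom. Qed.

Lemma vtrace_conj g x : g \in G -> g \in 'N(V) -> fixed_by M V x -> s (gconj M g x) = s x.
Proof.
move=> Gg Ng fx; rewrite /s -(reltr_conj sVG Gg fx).
suff -> : (V :^ g^-1)%G = V by [].
by apply/val_inj/normP; rewrite groupV.
Qed.

Lemma vtrace_mackey (Phi : 'M[k]_n -> 'M[k]_n) (H : {group gT}) w :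
    H \subset G -> (forall x y, Phi (x + y) = Phi x + Phi y) ->
    (forall v x, v \in V -> Phi (gconj M v x) = gconj M v (Phi x)) ->
    fixed_by M H w ->
  s (Phi (reltr M H G w)) = \sum_(C in fixed_lcosets V H G) s (Phi (gconj M (repr C) w)).
Proof. move=> sHG; exact: (brauer_mackey vtrace_brauer). Qed.

Lemma fixed_lcoset_norm C : C \in fixed_lcosets V V G ->
  [/\ repr C \in G, repr C \in 'N(V) & C = (repr C *: V)%g].
Proof.
move=> CV; have /fixed_lcosetP[CG _] := CV; have [Gr defC] := lcosets_sub sVG CG.
by split=> //; apply: fixed_lcoset_self Gr _; rewrite -defC.
Qed.

(** Expand the vertex trace of y times the trace of x: some term survives. *)
Lemma vtrace_conj_mul x y : fixed_by M V x -> fixed_by M V y -> s x != 0 -> s y != 0 ->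
  exists g, [/\ g \in G, g \in 'N(V) & s (y *m gconj M g x) != 0].
Proof.
move=> fx fy sx sy.
have: s (y *m reltr M V G x) != 0.
  by rewrite (vtraceMr (reltr_hom sVG fx) fy); apply: mulf_neq0.
rewrite (vtrace_mackey (Phi := mulmx y)) // => [|a b|v a Vv]; last 2 first.
- exact: mulmxDr.
- by rewrite gconj_mul ?(subsetP sVG) // (gconj_fixed _ Vv fy) // (subsetP sVG).
case: (boolP [exists C in fixed_lcosets V V G, s (y *m gconj M (repr C) x) != 0]).
  case/exists_inP=> C CV nz _; have [Gr Nr _] := fixed_lcoset_norm CV.
  by exists (repr C).
move/exists_inPn => z; rewrite big1 ?eqxx // => C CV.
by apply/eqP; have := z C CV; rewrite negbK.
Qed.

Section Nonunits.

Variable Z : representation k V.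
Hypothesis indZ : indecomposable Z.
Local Notation d := (rdegree Z).
Variables (q : 'M[k]_(n, d)) (p : 'M[k]_(d, n)).
Hypotheses (Hq : kG_hom (M := Z) (N := Res sVG M) q)
           (Hp : kG_hom (M := Res sVG M) (N := Z) p).
Hypothesis nonunit : forall a, fixed_by M V a -> p *m a *m q \notin unitmx.
Local Notation x := (q *m p).

(** Products with m factors conjugate to q p under the same element g, separated
    by V-endomorphisms. *)
Fixpoint word g m y := if m is m'.+1 then
    exists y' b, [/\ word g m' y', fixed_by M V b & y = y' *m gconj M g x *m b]
  else fixed_by M V y.

Lemma word_mul g m y b : fixed_by M V b -> word g m y -> word g m (y *m b).
Proof.
move=> fb; case: m => [fy|m [y' [c [wy fc ->]]]]; first exact: fixed_byM.
by exists y', (c *m b); split; rewrite ?mulmxA //; apply: fixed_byM.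
Qed.

(** Conjugating back by g, two consecutive factors q p enclose some p a q, which
    is a non-unit. *)
Lemma word_split g m y : g \in G -> g \in 'N(V) -> word g m.+1 y ->
  exists (c : 'M_(n, d)) (rs : seq 'M_d) b,
    [/\ size rs = m, {in rs, forall r, kG_hom (M := Z) (N := Z) r /\ r \notin unitmx},
        fixed_by M V b & y = gconj M g (c *m mxprod rs *m (p *m b))].
Proof.
move=> Gg Ng; have fVK b : fixed_by M V b -> fixed_by M V (gconj M g^-1 b).
  by apply: fixed_by_norm; rewrite ?groupV.
have K b : gconj M g (gconj M g^-1 b) = b.
  by rewrite -gconjM ?groupV // mulgV gconj1.
elim: m y => [|m IH] y [y' [b [wy fb ->]]].
  exists (gconj M g^-1 y' *m q), [::], (gconj M g^-1 b); split=> //; first exact: fVK.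
  by rewrite -[y' in LHS]K -[b in LHS]K -!gconj_mul //= mulmx1 !mulmxA.
have [c [rs [b' [szr Hrs fb' ->]]]] := IH _ wy.
exists c, (rs ++ [:: p *m b' *m q]), (gconj M g^-1 b); split.
- by rewrite size_cat szr addn1.
- move=> r; rewrite mem_cat => /orP[/Hrs //|]; rewrite inE => /eqP ->.
  split; last exact: nonunit.
  apply: kG_homM Hq _; apply: (kG_homM (N := Res sVG M)) => //.
- exact: fVK.
rewrite -[b in LHS]K -!gconj_mul // mxprod_cat /= mulmx1 !mulmxA.
by [].
Qed.

Lemma word_zero g m y : g \in G -> g \in 'N(V) -> (d < m)%N -> word g m y -> y = 0.
Proof.
case: m => // m Gg Ng ltdm /(word_split Gg Ng)[c [rs [b [szr Hrs _ ->]]]].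
rewrite (nonunit_products indZ Hrs) ?szr // mulmx0 mul0mx.
by rewrite /gconj mulmx0 mul0mx.
Qed.

Lemma long_words : s x != 0 -> forall r, exists y (f : {ffun gT -> nat}),
  [/\ fixed_by M V y, s y != 0, forall g, word g (f g) y,
      forall g, (0 < f g)%N -> g \in G /\ g \in 'N(V) & (\sum_g f g = r)%N].
Proof.
move=> sx; have fx := hom_mul_fixed Hq Hp.
elim=> [|r [y [f [fy sy wy Nf Sf]]]].
  by exists x, [ffun=> 0%N]; split=> // [g|g|]; rewrite ?ffunE // big1 // => g _; rewrite ffunE.
have [g [Gg Ng nz]] := vtrace_conj_mul fx fy sx sy.
have fgx : fixed_by M V (gconj M g x) by apply: fixed_by_norm.
exists (y *m gconj M g x), [ffun h => (f h + (h == g))%N]; split=> // [|h|h|].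
- exact: fixed_byM.
- rewrite ffunE; case: eqVneq => [->|_]; last by rewrite addn0; apply: word_mul.
  rewrite addn1; exists y, 1%:M; split; rewrite ?mulmx1 //.
  by move=> v _; rewrite mulmx1 mul1mx.
- by rewrite ffunE; case: eqVneq => [-> //|_]; rewrite addn0; apply: Nf.
under eq_bigr do rewrite ffunE.
rewrite big_split /= Sf -addn1; congr addn.
by rewrite (bigD1 g) //= eqxx big1 ?addn0 // => h /negPf ->.
Qed.

(** If s (q p) is nonzero, expanding the powers of the trace of q p produces
    arbitrarily long products of conjugates of q p with nonzero vertex trace. In
    a long one, many factors are conjugate under the same element, and such a
    product vanishes because the radical of End(Z) is nilpotent. *)
Lemma vtrace_nonunit : s x = 0.
Proof.
apply/eqP/negPn/negP => sx.
have [y [f [fy sy wy Nf Sf]]] := long_words sx (#|gT| * d).+1.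
have [g ltg]: exists g, (d < f g)%N.
  apply/existsP; apply: contraT => /existsPn lef; suff: (\sum_g f g <= #|gT| * d)%N.
    by rewrite Sf ltnn.
  by rewrite -sum_nat_const leq_sum // => g _; rewrite leqNgt lef.
have [Gg Ng] := Nf g (leq_ltn_trans (leq0n d) ltg).
by case/negP: sy; rewrite (word_zero Gg Ng ltg (wy g)) vtrace0.
Qed.

End Nonunits.

End Vertex.

(** * Sources *)

Section Sources.
Local Open Scope ring_scope.

Variables (k : closedFieldType) (gT : finGroupType) (G V : {group gT}).
Variable M : representation k G.
Hypotheses (indM : indecomposable M) (sVG : V \subset G).
Hypothesis projV : relatively_projective V M.
Hypothesis minV : forall U : {group gT},
  relatively_projective U M -> U \subset V -> U :=: V.
Local Notation n := (rdegree M).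
Local Notation lam := some_eigenvalue.
Local Notation s := (@vtrace k gT G V M).

Lemma is_sourceE (Z : representation k V) :
  is_source sVG M Z ->
  indecomposable Z /\ exists (q : 'M_(n, rdegree Z)) (p : 'M_(rdegree Z, n)),
    [/\ kG_hom (M := Z) (N := Res sVG M) q, kG_hom (M := Res sVG M) (N := Z) p
      & reltr M V G (q *m p) = 1%:M].
Proof. by case=> indZ /higman_summandP. Qed.

Lemma is_source_vtrace (Z : representation k V) (q : 'M_(n, rdegree Z)) (p : 'M_(rdegree Z, n)) :
    indecomposable Z ->
    kG_hom (M := Z) (N := Res sVG M) q -> kG_hom (M := Res sVG M) (N := Z) p ->
    s (q *m p) != 0 -> is_source sVG M Z.
Proof.
move=> indZ Hq Hp nz; split=> //; apply/higman_summandP.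
have fx := hom_mul_fixed Hq Hp.
have Ux : reltr M V G (q *m p) \in unitmx by rewrite -vtrace_unit.
have Hr := reltr_hom sVG fx; have Hi := kG_homV Ux Hr.
exists q, (p *m invmx (reltr M V G (q *m p))); split=> //.
  apply: (kG_homM (N := Res sVG M)) Hp => v Vv.
  by apply: Hi; apply: (subsetP sVG).
by rewrite mulmxA -reltrMr // mulmxV.
Qed.

Lemma source_exists : exists Z, is_source sVG M Z.
Proof.
have [_ [x fx tr1]] := (relatively_projectiveP V M).1 projV.
pose P (Z : representation k V) :=
  exists (q : 'M_(n, rdegree Z)) (p : 'M_(rdegree Z, n)),
  [/\ kG_hom (M := Z) (N := Res sVG M) q, kG_hom (M := Res sVG M) (N := Z) p
    & s (q *m p) != 0].
suffices [Z [q [p [Hq Hp nz]]] indZ] : exists2 Z, P Z & indecomposable Z.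
  by exists Z; apply: is_source_vtrace nz.
apply: minimal_indecomposable => [|Z [q [p [Hq Hp nz]]]|].
- exists (Res sVG M), 1%:M, x; split=> //; first exact: kG_hom1.
  by rewrite mul1mx vtrace_unit // tr1 unitmx1.
- rewrite lt0n; apply: contraNneq nz => d0.
  suff -> : q *m p = 0 by rewrite vtrace0.
  by apply/matrixP=> i j; rewrite !mxE big1 // => -[l lt_l]; exfalso; rewrite d0 in lt_l.
move=> Z L1 L2 q1 p1 q2 p2 [q [p [Hq Hp nz]]] Hq1 Hp1 Hq2 Hp2 e1.
have Hqq1 := kG_homM Hq1 Hq; have Hpp1 := kG_homM Hp Hp1.
have Hqq2 := kG_homM Hq2 Hq; have Hpp2 := kG_homM Hp Hp2.
have: s ((q *m q1) *m (p1 *m p) + (q *m q2) *m (p2 *m p)) != 0.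
  by rewrite !mulmxA -(mulmxA q q1) -(mulmxA q q2) -mulmxDl -mulmxDr e1 mulmx1.
rewrite (vtraceD indM sVG (hom_mul_fixed Hqq1 Hpp1) (hom_mul_fixed Hqq2 Hpp2)) => nz'.
have [z1|nz1] := eqVneq (s ((q *m q1) *m (p1 *m p))) 0.
  right; exists (q *m q2), (p2 *m p); split; [exact: Hqq2 | exact: Hpp2 |].
  by rewrite z1 add0r in nz'.
left; exists (q *m q1), (p1 *m p); split; [exact: Hqq1 | exact: Hpp1 | exact: nz1].
Qed.

(** For a source, [V] is minimal for itself: a unit trace of [Z] from a
    smaller subgroup would make [M] projective relative to it. *)
Lemma source_brauer (Z : representation k V) :
  is_source sVG M Z -> brauer_functional (Y := Z) (@some_eigenvalue k (rdegree Z)).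
Proof.
move=> /is_sourceE[indZ [q [p [Hq Hp tr1]]]]; split=> [x y fx fy | U x sUV neUV fx].
  exact: lamD.
have Hr : kG_hom (M := Z) (N := Z) (reltr Z U V x) by apply: reltr_fixed.
apply/eqP; apply: contraNT neUV; rewrite lam_unit // => Ux.
have Hi := kG_homV Ux Hr; have Hqi := kG_homM Hi Hq.
apply/eqP/minV => //; apply/relatively_projectiveP; split.
  exact: subset_trans sVG.
have e1 : q *m invmx (reltr Z U V x) *m reltr Z U V x = q by rewrite mulmxKV.
have fy := fixed_by_sandwich sUV Hqi Hp fx.
exists (q *m invmx (reltr Z U V x) *m x *m p) => //.
rewrite -(reltr_trans sUV sVG (subxx G) fy).
by rewrite -(reltr_sandwich_out sUV Hqi Hp) e1.
Qed.

(** Write the identity of M as the trace of q p and as the trace of q' p', with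
    q p through Z and q' p' through Z'. In the product of the traces some term
    q p (q' p')^g survives, so by [vtrace_nonunit] a composite Z -> Z' -> Z of
    semilinear maps is invertible. *)
Lemma source_conj (Z Z' : representation k V) :
    is_source sVG M Z -> is_source sVG M Z' ->
  exists g (f : 'M_(rdegree Z, rdegree Z')) (h : 'M_(rdegree Z', rdegree Z)),
    [/\ g \in 'N(V), f *m h = 1%:M, h *m f = 1%:M &
      forall v, v \in V -> Z v *m f = f *m Z' (v ^ g)%g].
Proof.
move=> /is_sourceE[indZ [q [p [Hq Hp tr1]]]] /is_sourceE[indZ' [q' [p' [Hq' Hp' tr1']]]].
have fx := hom_mul_fixed Hq Hp; have fx' := hom_mul_fixed Hq' Hp'.
have sx : s (q *m p) != 0 by rewrite vtrace_unit // tr1 unitmx1.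
have sx' : s (q' *m p') != 0 by rewrite vtrace_unit // tr1' unitmx1.
have [g [Gg Ng]] := vtrace_conj_mul indM sVG minV fx' fx sx' sx.
rewrite -mulmxA => nz.
have HP : kG_hom (M := Res sVG M) (N := Z) (p *m gconj M g (q' *m p')).
  apply: (kG_homM (N := Res sVG M)) Hp.
  exact: (fixed_by_norm sVG Gg Ng fx').
have [a fa Ua] : exists2 a, fixed_by M V a & p *m gconj M g (q' *m p') *m a *m q \in unitmx.
  apply: boolp.contrapT => noa.
  case/negP: nz; apply/eqP. apply: (vtrace_nonunit indM minV indZ Hq HP) => a fa.
  by apply/negP=> Ua; case: noa; exists a.
pose f := p *m M g *m q'; pose h0 := p' *m M g^-1%g *m a *m q.
have fh0 : f *m h0 \in unitmx by move: Ua; rewrite /f /h0 /gconj !mulmxA.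
have pM v : v \in V -> p *m M v = Z v *m p by apply: Hp.
have qM v : v \in V -> q *m Z v = M v *m q by apply: Hq.
have p'M v : v \in V -> p' *m M v = Z' v *m p' by apply: Hp'.
have q'M v : v \in V -> q' *m Z' v = M v *m q' by apply: Hq'.
have VJ v : v \in V -> (v ^ g)%g \in V by rewrite memJ_norm.
have MJ v : v \in V -> M v *m M g = M g *m M (v ^ g)%g.
  move=> Vv; have Gv := subsetP sVG v Vv.
  by rewrite -!repr_mxM ?groupJ // conjgE mulKVg.
have MJV v : v \in V -> M (v ^ g)%g *m M g^-1%g = M g^-1%g *m M v.
  move=> Vv; have Gv := subsetP sVG v Vv.
  by rewrite -!repr_mxM ?groupJ ?groupV // conjgE -!mulgA mulgV mulg1.
have twist v : v \in V -> Z v *m f = f *m Z' (v ^ g)%g.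
  move=> Vv; rewrite /f !mulmxA -pM // -(mulmxA p (M v)) MJ // -!mulmxA q'M ?VJ //.
have twist' v : v \in V -> Z' (v ^ g)%g *m h0 = h0 *m Z v.
  move=> Vv; rewrite /h0 !mulmxA -p'M ?VJ // -(mulmxA p' (M (v ^ g)%g)) MJV // -!mulmxA qM //.
  by rewrite (mulmxA a) fa // !mulmxA.
clearbody f h0.
have Hu : kG_hom (M := Z) (N := Z) (f *m h0).
  by move=> v Vv; rewrite -mulmxA -twist' // mulmxA -twist // mulmxA.
have Hi := kG_homV fh0 Hu; set u := invmx (f *m h0) in Hi.
have fhu : f *m (h0 *m u) = 1%:M by rewrite mulmxA mulmxV.
clearbody u.
pose e := h0 *m u *m f.
have ee : e *m e = e.
  have -> : e *m e = h0 *m u *m (f *m (h0 *m u)) *m f by rewrite /e !mulmxA.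
  by rewrite fhu mulmx1.
have He : kG_hom (M := Z') (N := Z') e.
  move=> w Vw; have Vv : (w ^ g^-1)%g \in V by rewrite memJ_norm ?groupV.
  have <- : ((w ^ g^-1) ^ g)%g = w by rewrite -conjgM mulVg conjg1.
  rewrite /e -mulmxA -twist // !mulmxA twist' // -!mulmxA; congr (_ *m _).
  by rewrite !mulmxA Hi.
exists g, f, (h0 *m u); split=> //.
have [e0|//] := idempotent_indecomposable indZ' He ee.
have z1 : (1%:M : 'M[k]_(rdegree Z)) = 0.
  have : f *m e *m (h0 *m u) = 0 by rewrite e0 mulmx0 mul0mx.
  by rewrite /e !mulmxA -(mulmxA f) fhu mul1mx -mulmxA fhu.
have := lam1 indZ; rewrite z1 lam0 // => /eqP; by rewrite eq_sym oner_eq0.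
Qed.

Lemma source_self_dual (Z Z' : representation k V) :
    is_source sVG M Z -> is_source sVG M Z' -> self_dual Z' -> self_dual Z.
Proof.
move=> sZ sZ' [B _ freeB homB].
have [g [f [h [Ng fh hf twist]]]] := source_conj sZ sZ'.
have UB : B \in unitmx by rewrite -row_free_unit.
apply: (@MxReprSim _ _ _ _ _ _ _ (f *m B *m f^T)).
- by [].
- rewrite row_free_unit.
  have: (f *m B *m f^T) *m (h^T *m invmx B *m h) = 1%:M.
    by rewrite !mulmxA -(mulmxA _ f^T) -trmx_mul hf trmx1 mulmx1 mulmxK.
  by case/mulmx1_unit.
move=> v Vv; have Vvg : (v ^ g)%g \in V by rewrite memJ_norm.
have Vvi : (v^-1)%g \in V by rewrite groupV.
rewrite !mulmxA twist // -(mulmxA f) homB // !mulmxA /= -!mulmxA -!trmx_mul.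
by rewrite -conjVg twist // groupV.
Qed.

End Sources.

(** * Adjunction and cancellation in characteristic 2 *)

Section CharacteristicTwoSums.
Local Open Scope ring_scope.

Variables (R : nzRingType) (char2 : 2%N \in [pchar R]).

Lemma sum_involution (I : finType) (S : {set I}) (iota : I -> I) (F : I -> R) :
    {in S, forall x, iota x \in S} -> {in S, forall x, iota (iota x) = x} ->
    {in S, forall x, F (iota x) = F x} ->
  \sum_(x in S) F x = \sum_(x in S | iota x == x) F x.
Proof.
move=> Siota iotaK Fiota; rewrite (bigID (fun x => iota x == x)) /=.
rewrite [X in _ + X](_ : _ = 0) ?addr0 //.
rewrite (bigID (fun x => enum_rank x < enum_rank (iota x))%N) /=.
rewrite [X in _ + X](reindex_onto iota iota) /=; last first.
  by move=> x /andP[/andP[Sx _] _]; apply: iotaK.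
set X := \sum_(x | _) F x; rewrite [X in _ + X](_ : _ = X) ?addrr_pchar2 //.
apply: eq_big => [x|x /andP[/andP[/andP[Six _] _] /eqP ex]]; last first.
  by apply: Fiota; rewrite -ex Siota.
have [Sx|Sx] := boolP (x \in S); last first.
  apply/negP=> /andP[/andP[/andP[Six _] _] /eqP ex].
  by case/negP: Sx; rewrite -ex Siota.
rewrite Siota // iotaK // eqxx andbT /= [x == _]eq_sym.
case: eqVneq => //= ne; rewrite -leqNgt leq_eqVlt.
by rewrite (inj_eq val_inj) (inj_eq enum_rank_inj) eq_sym (negPf ne).
Qed.

Lemma sum_symmetric (I : finType) (S : {set I}) (F : I -> I -> R) :
  {in S &, forall x y, F x y = F y x} ->
  \sum_(x in S) \sum_(y in S) F x y = \sum_(x in S) F x x.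
Proof.
move=> Fsym; rewrite pair_big /=.
have -> : \sum_(p | (p.1 \in S) && (p.2 \in S)) F p.1 p.2 = \sum_(p in setX S S) F p.1 p.2.
  by apply: eq_bigl => p; rewrite inE.
rewrite (sum_involution (iota := fun p => (p.2, p.1))).
- rewrite (reindex_onto (fun x : I => (x, x)) (fun p => p.1)) /=.
    by apply: eq_bigl => x; rewrite inE /= eqxx andbb !andbT eqxx andbT.
  by move=> [x y] /andP[_ /eqP[-> _]].
- by move=> p; rewrite !inE andbC.
- by case.
by move=> p; rewrite inE => /andP[S1 S2]; rewrite /= Fsym.
Qed.

End CharacteristicTwoSums.

Section Adjoints.
Local Open Scope ring_scope.

Variables (k : fieldType) (gT : finGroupType) (G : {group gT}).
Variables (M : representation k G) (B : 'M[k]_(rdegree M)).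
Hypothesis formB : G_form B.
Local Notation adj := (adjoint B B).

Lemma form_unit : B \in unitmx. Proof. by have [] := (G_formE B).1 formB. Qed.
Lemma form_sym : B^T = B. Proof. by have [] := (G_formE B).1 formB. Qed.
Hint Resolve form_unit form_sym : core.

Lemma form_mul g : g \in G -> B *m M g = (M g^-1%g)^T *m B.
Proof.
have [_ _ invB] := (G_formE B).1 formB.
by move=> Gg; rewrite -{1}(invB _ (groupVr Gg)) repr_mxKV.
Qed.

Lemma adjoint_repr g : g \in G -> adj (M g) = M g^-1%g.
Proof.
by move=> Gg; rewrite /adjoint -mulmxA -[g in (M g)^T]invgK -form_mul ?groupV // mulKmx.
Qed.

Lemma adjoint_gconj g x : g \in G -> adj (gconj M g x) = gconj M g (adj x).
Proof.
move=> Gg; rewrite /gconj !(adjointM _ _ _ _ form_unit) !adjoint_repr ?groupV //.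
by rewrite invgK mulmxA.
Qed.

Lemma adjoint_fixed (H : {group gT}) x : H \subset G -> fixed_by M H x -> fixed_by M H (adj x).
Proof.
move=> sHG fx; apply: fixed_by_gconj => // h Hh; have Gh := subsetP sHG h Hh.
by rewrite -adjoint_gconj // (gconj_fixed Gh Hh fx).
Qed.

Lemma adjoint_reltr (H : {group gT}) x : H \subset G ->
  adj (reltr M H G x) = reltr M H G (adj x).
Proof.
move=> sHG; rewrite /reltr (big_morph adj (adjointD _ _) (_ : adj 0 = 0)).
  by apply: eq_bigr => C /(lcosets_sub sHG)[Gr _]; rewrite adjoint_gconj.
by rewrite /adjoint trmx0 mulmx0 mul0mx.
Qed.

End Adjoints.

Section SourceForms.
Local Open Scope ring_scope.

Lemma adjoint_hom (k : fieldType) (gT : finGroupType) (G V : {group gT})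
    (M : representation k G) (B : 'M[k]_(rdegree M)) (sVG : V \subset G)
    (Z : representation k V) (C : 'M[k]_(rdegree Z)) (q : 'M_(rdegree M, rdegree Z)) :
    G_form B -> G_form C -> kG_hom (M := Z) (N := Res sVG M) q ->
  kG_hom (M := Res sVG M) (N := Z) (adjoint C B q).
Proof.
move=> formB formC Hq v Vv; have Gv := subsetP sVG v Vv; have UC := form_unit formC.
have qV : q *m Z v^-1%g = M v^-1%g *m q by apply: Hq; rewrite groupV.
have CV : Z v *m invmx C = invmx C *m (Z v^-1%g)^T.
  by rewrite -[RHS](mulmxK UC) -(mulmxA _ _ C) -(form_mul formC Vv) mulKmx.
rewrite /adjoint !mulmxA CV -!mulmxA; congr (_ *m _).
by rewrite /= (form_mul formB Gv) !mulmxA -!trmx_mul qV.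
Qed.

(** Expand both traces by [brauer_mackey]. Adjunction exchanges the terms indexed
    by (C, D) and (D, C), so the terms off the diagonal cancel. *)
Lemma adjoint_diagonal (k : fieldType) (gT : finGroupType) (G V : {group gT})
    (M : representation k G) (B : 'M[k]_(rdegree M)) (sVG : V \subset G)
    (Y : representation k V) (D : 'M[k]_(rdegree Y)) (mu : 'M[k]_(rdegree Y) -> k)
    (u : 'M_(rdegree M, rdegree Y)) (w z : 'M_(rdegree M)) :
    2%N \in [pchar k] -> G_form B -> G_form D -> brauer_functional mu ->
    (forall y, fixed_by Y V y -> mu (adjoint D D y) = mu y) ->
    kG_hom (M := Y) (N := Res sVG M) u ->
    fixed_by M V w -> fixed_by M V z -> adjoint B B z = z ->
  mu (adjoint D B u *m (reltr M V G w *m z *m reltr M V G (adjoint B B w)) *m u) =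
    \sum_(C in fixed_lcosets V V G)
      mu (adjoint D B u *m (gconj M (repr C) w *m z *m gconj M (repr C) (adjoint B B w)) *m u).
Proof.
move=> char2 formB formD muP muA Hu fw fz sz.
have Hu' := adjoint_hom formB formD Hu; set u' := adjoint D B u in Hu' *.
have [UB symB UD symD] : [/\ B \in unitmx, B^T = B, D \in unitmx & D^T = D].
  by split; [exact: form_unit formB | exact: form_sym formB
            | exact: form_unit formD | exact: form_sym formD].
have u'K : adjoint B D u' = u by apply: adjointK.
have uE : adjoint D B u = u' by [].
clearbody u'.
have fw' : fixed_by M V (adjoint B B w) by exact: adjoint_fixed.
have fT : fixed_by M V (reltr M V G w) by apply: (fixed_byS sVG); apply: reltr_fixed.
have fC C x : fixed_by M V x -> C \in fixed_lcosets V V G -> fixed_by M V (gconj M (repr C) x).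
  move=> fx CV; have /fixed_lcosetP[CG _] := CV; have [Gr defC] := lcosets_sub sVG CG.
  apply: fixed_by_norm => //; apply: fixed_lcoset_self Gr _; by rewrite -defC.
have fix_gconj v x : v \in V -> fixed_by M V x -> gconj M v x = x.
  by move=> Vv; apply: gconj_fixed => //; apply: (subsetP sVG).
pose Phi1 a x := u' *m (a *m z *m x) *m u.
have Phi1D a : forall x y, Phi1 a (x + y) = Phi1 a x + Phi1 a y.
  by move=> x y; rewrite /Phi1 !(mulmxDr, mulmxDl).
have Phi1V a : fixed_by M V a -> forall v x, v \in V -> Phi1 a (gconj M v x) = gconj Y v (Phi1 a x).
  move=> fa v x Vv; have Gv := subsetP sVG v Vv; rewrite -(gconj_sandwich_in Hu Hu') //.
  by rewrite !gconj_mul // (fix_gconj v a) // (fix_gconj v z).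
rewrite -/(Phi1 _ _) (brauer_mackey muP sVG sVG (Phi1D _) (Phi1V _ fT) fw').
pose Phi2 b x := u' *m (x *m z *m b) *m u.
have Phi2D b : forall x y, Phi2 b (x + y) = Phi2 b x + Phi2 b y.
  by move=> x y; rewrite /Phi2 !(mulmxDr, mulmxDl).
have Phi2V b : fixed_by M V b -> forall v x, v \in V -> Phi2 b (gconj M v x) = gconj Y v (Phi2 b x).
  move=> fb v x Vv; have Gv := subsetP sVG v Vv; rewrite -(gconj_sandwich_in Hu Hu') //.
  by rewrite !gconj_mul // (fix_gconj v b) // (fix_gconj v z).
under eq_bigr => C CV.
  rewrite -/(Phi2 (gconj M (repr C) (adjoint B B w)) (reltr M V G w)).
  rewrite (brauer_mackey muP sVG sVG (Phi2D _) (Phi2V _ (fC C _ fw' CV)) fw).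
  over.
apply: (sum_symmetric char2
  (F := fun C D => mu (Phi2 (gconj M (repr C) (adjoint B B w)) (gconj M (repr D) w)))).
move=> C E CV EV; rewrite -[LHS]muA.
  have /fixed_lcosetP[/(lcosets_sub sVG)[Gc _] _] := CV.
  have /fixed_lcosetP[/(lcosets_sub sVG)[Ge _] _] := EV.
  have adj3 a b : adjoint D D (u' *m (a *m z *m b) *m u) =
      u' *m (adjoint B B b *m z *m adjoint B B a) *m u.
    by rewrite !(adjointM _ _ _ _ UB) u'K sz uE !mulmxA.
  congr mu; rewrite /Phi2 adj3.
  by rewrite !(adjoint_gconj formB) // (adjointK _ UB symB UB symB) !mulmxA.
apply: fixed_by_gconj => // v Vv; rewrite -Phi2V //; last exact: fC _ _ fw' CV.
by rewrite (fix_gconj v (gconj M (repr E) w)) //; apply: (fC _ _ fw EV).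
Qed.

End SourceForms.

(** * Forms on sources *)

Section FormValues.
Local Open Scope ring_scope.

Lemma addr_shuffle (A : zmodType) (a b c d : A) : a + b + (c + d) = a + d + (c + b).
Proof. by rewrite [c + d]addrC addrACA [b + c]addrC. Qed.

Variables (k : closedFieldType) (gT : finGroupType) (G : {group gT}).
Variables (M : representation k G) (B : 'M[k]_(rdegree M)).
Hypotheses (char2 : 2%N \in [pchar k]) (indM : indecomposable M) (formB : G_form B).
Local Notation adj := (adjoint B B).
Local Notation lam := some_eigenvalue.

Lemma adjoint_endo x : kG_hom (M := M) (N := M) x -> kG_hom (M := M) (N := M) (adj x).
Proof. by move=> Hx; apply: (adjoint_fixed formB (subxx G)). Qed.

Lemma lam_adjoint x : kG_hom (M := M) (N := M) x -> lam (adj x) = lam x.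
Proof.
have UB := form_unit formB; move=> Hx; apply: (lam_tr indM) => [y|y c|].
- exact: adjoint_unit.
- by rewrite -[in LHS]raddfN adjointD adjoint_scalar // raddfN.
exact: adjoint_endo.
Qed.

Lemma lam_symmetrized x : kG_hom (M := M) (N := M) x -> lam (x + adj x) = 0.
Proof.
move=> Hx; rewrite lamD ?lam_adjoint //; last exact: adjoint_endo.
by rewrite addrr_pchar2.
Qed.

End FormValues.

Section SymmetricSources.
Local Open Scope ring_scope.

Variables (k : closedFieldType) (gT : finGroupType) (G V : {group gT}).
Variable M : representation k G.
Hypotheses (char2 : 2%N \in [pchar k]) (indM : indecomposable M) (sVG : V \subset G).
Hypothesis minV : forall U : {group gT},
  relatively_projective U M -> U \subset V -> U :=: V.
Variable B : 'M[k]_(rdegree M).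
Hypothesis formB : G_form B.
Local Notation n := (rdegree M).
Local Notation lam := some_eigenvalue.
Local Notation s := (@vtrace k gT G V M).
Local Notation adj := (adjoint B B).

Lemma vtrace_adjoint x : fixed_by M V x -> s (adj x) = s x.
Proof.
move=> fx; rewrite /vtrace -(adjoint_reltr formB x sVG).
by rewrite (lam_adjoint indM formB (reltr_hom sVG fx)).
Qed.

Variable Z : representation k V.
Hypothesis srcZ : is_source sVG M Z.
Variable C : 'M[k]_(rdegree Z).
Hypothesis formC : G_form (M := Z) C.
Local Notation ad := (adjoint C B).
Local Notation Zhom q := (kG_hom (M := Z) (N := Res sVG M) q).
Local Notation tr x := (reltr M V G x).
Implicit Types (q p v r w : 'M[k]_(rdegree M, rdegree Z)).

Let indZ : indecomposable Z. Proof. by case: srcZ. Qed.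

Lemma adjoint_outer q p : adj (q *m ad p) = p *m ad q.
Proof.
have [UB UC] := (form_unit formB, form_unit formC).
rewrite (adjointM _ _ _ _ UC) (adjointK _ UC (form_sym formC) UB (form_sym formB)).
by [].
Qed.

Lemma form_Res : G_form (M := Res sVG M) B.
Proof.
have [ndB symB invB] := formB; split=> // g u v Vg.
by apply: invB; apply: (subsetP sVG).
Qed.

Lemma outer_fixed q p : Zhom q -> Zhom p -> fixed_by M V (q *m ad p).
Proof. by move=> Hq Hp; apply: hom_mul_fixed Hq (adjoint_hom formB formC Hp). Qed.

Lemma outer_tr_hom q p : Zhom q -> Zhom p -> kG_hom (M := M) (N := M) (tr (q *m ad p)).
Proof. by move=> Hq Hp; apply: reltr_hom => //; apply: outer_fixed. Qed.

Lemma inner_hom v x : Zhom v -> fixed_by M V x -> kG_hom (M := Z) (N := Z) (ad v *m x *m v).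
Proof.
move=> Hv fx; apply: (kG_homM (N := Res sVG M)) => //.
apply: (kG_homM (N := Res sVG M) _ (adjoint_hom formB formC Hv)).
exact: fx.
Qed.

Lemma inner_adjoint v x : adjoint C C (ad v *m x *m v) = ad v *m adj x *m v.
Proof.
have [UB UC] := (form_unit formB, form_unit formC).
have [u uE e] : exists2 u, ad v = u & adjoint B C u = v.
  by exists (ad v); rewrite // adjointK // ?form_sym.
by rewrite uE !(adjointM _ _ _ _ UB) e uE mulmxA.
Qed.

(** Write q^# for the adjoint of q. After [adjoint_diagonal], each term contains
    q^# q in the middle; it may be replaced by its eigenvalue, since the
    non-unit that remains makes the whole product singular. *)
Lemma source_diagonal q p v : Zhom q -> Zhom p -> Zhom v ->
  lam (ad v *m (tr (p *m ad q) *m tr (q *m ad p)) *m v) =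
    lam (ad q *m q) * lam (ad v *m tr (p *m ad p) *m v).
Proof.
move=> Hq Hp Hv; have [UB UC] := (form_unit formB, form_unit formC).
have muP := source_brauer minV srcZ.
have muA y : fixed_by Z V y -> lam (adjoint C C y) = lam y.
  by move=> fy; apply: lam_adjoint.
have adj1 : adj 1%:M = 1%:M by apply: adjoint_scalar.
have fix1 : fixed_by M V 1%:M by move=> h _; rewrite mulmx1 mul1mx.
have Hv' := adjoint_hom formB formC Hv.
have := adjoint_diagonal char2 formB formC muP muA Hv (outer_fixed Hp Hq) fix1 adj1.
rewrite adjoint_outer mulmx1 => ->.
rewrite (brauer_mackey muP sVG sVG (Phi := fun x => ad v *m x *m v)); last 3 first.
- by move=> x y; rewrite mulmxDr mulmxDl.
- by move=> g x Vg; apply: gconj_sandwich_in.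
- exact: outer_fixed.
rewrite mulr_sumr; apply: eq_bigr => D DV; have [Gr Nr _] := fixed_lcoset_norm sVG DV.
set g := repr D in Gr Nr *.
have Hqq : kG_hom (M := Z) (N := Z) (ad q *m q).
  by rewrite -[ad q]mulmx1; apply: inner_hom.
set c := lam (ad q *m q).
have [rho [qqE Hrho Nrho]] : exists rho, [/\ ad q *m q = rho + c%:M,
    kG_hom (M := Z) (N := Z) rho & rho \notin unitmx].
  exists (ad q *m q - c%:M); rewrite subrK; split=> //; first exact: hom_subscalar.
  exact: lamN.
clearbody c.
have e1 : gconj M g (p *m ad q) *m 1%:M *m gconj M g (q *m ad p) =
   gconj M g (p *m rho *m ad p) + c *: gconj M g (p *m ad p).
  rewrite mulmx1 -gconj_mul // -gconjZ -gconjD; congr (gconj M g _).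
  have -> : p *m ad q *m (q *m ad p) = p *m (ad q *m q) *m ad p by rewrite !mulmxA.
  by rewrite qqE mulmxDr mulmxDl mul_mx_scalar -scalemxAl.
have Hp' := adjoint_hom formB formC Hp.
have fprp : fixed_by M V (p *m rho *m ad p).
  by apply: (hom_mul_fixed _ Hp'); apply: kG_homM Hrho Hp.
have fpp := outer_fixed Hp Hp.
have fg x : fixed_by M V x -> fixed_by M V (gconj M g x) by apply: fixed_by_norm.
rewrite e1 mulmxDr mulmxDl -scalemxAr -scalemxAl lamD //; last first.
- by apply/kG_homZ/inner_hom/fg.
- exact/inner_hom/fg.
rewrite lamZ //; last exact/inner_hom/fg.
rewrite (_ : lam _ = 0) ?add0r //; apply/eqP/negPn.
rewrite lam_unit //; last exact/inner_hom/fg.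
have -> : ad v *m gconj M g (p *m rho *m ad p) *m v =
    (ad v *m M g *m p) *m rho *m (ad p *m M g^-1%g *m v) by rewrite /gconj !mulmxA.
by rewrite !unitmx_mul (negPf Nrho) andbF.
Qed.

(** Let t be the trace of r r^#, where r^# is the adjoint of r. The cube of the
    eigenvalue of t is s (t (r r^#) t), which by [adjoint_diagonal] is the
    eigenvalue of t times that of r^# t r. *)
Lemma trace_form_diagonal r : Zhom r -> s (r *m ad r) != 0 ->
  lam (ad r *m tr (r *m ad r) *m r) != 0.
Proof.
move=> Hr nz; have [UB UC] := (form_unit formB, form_unit formC).
have Hr' := adjoint_hom formB formC Hr.
have fr := outer_fixed Hr Hr; have Ht := outer_tr_hom Hr Hr.
have muP := vtrace_brauer indM sVG minV.
have sr : adj (r *m ad r) = r *m ad r by apply: adjoint_outer.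
have Hid : kG_hom (M := Res sVG M) (N := Res sVG M) 1%:M by apply: kG_hom1.
have := adjoint_diagonal char2 formB form_Res muP vtrace_adjoint Hid fr fr sr.
rewrite sr adjoint_scalar // !mul1mx !mulmx1 => eq_t.
set t := tr (r *m ad r) in Ht eq_t *.
have : s (t *m (r *m ad r) *m t) != 0.
  rewrite (vtraceMr indM sVG Ht) ?(vtraceMl indM sVG Ht) //; last first.
    by apply: fixed_byM => //; apply: fixed_byS sVG _.
  by rewrite !mulf_neq0.
rewrite eq_t; apply: contraNneq => z.
suff -> : \sum_(D in fixed_lcosets V V G)
   s (1%:M *m (gconj M (repr D) (r *m ad r) *m (r *m ad r) *m
      gconj M (repr D) (r *m ad r)) *m 1%:M) =
   s (r *m ad r) * lam (ad r *m t *m r) by rewrite z mulr0.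
rewrite (brauer_mackey (source_brauer minV srcZ) sVG sVG
  (Phi := fun x => ad r *m x *m r)); last 3 first.
- by move=> x y; rewrite mulmxDr mulmxDl.
- by move=> g x Vg; apply: gconj_sandwich_in.
- exact: fr.
rewrite mulr_sumr; apply: eq_bigr => D DV; have [Gr Nr _] := fixed_lcoset_norm sVG DV.
rewrite mul1mx mulmx1; set g := repr D in Gr Nr *.
have Gi : g^-1%g \in G by rewrite groupV.
have fg h x : h \in G -> h \in 'N(V) -> fixed_by M V x -> fixed_by M V (gconj M h x).
  by move=> Gh Nh; apply: fixed_by_norm.
have Hy : kG_hom (M := Z) (N := Z) (ad r *m gconj M g^-1 (r *m ad r) *m r).
  by apply/inner_hom/fg; rewrite ?groupV.
have Hy' : kG_hom (M := Z) (N := Z) (ad r *m gconj M g (r *m ad r) *m r).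
  exact/inner_hom/fg.
pose a := ad r *m M g^-1%g *m r; pose b := ad r *m M g *m r.
have yE : ad r *m gconj M g^-1 (r *m ad r) *m r = a *m b.
  by rewrite /gconj /a /b invgK !mulmxA.
have yE' : ad r *m gconj M g (r *m ad r) *m r = b *m a.
  by rewrite /gconj /a /b !mulmxA.
have -> : gconj M g (r *m ad r) *m (r *m ad r) *m gconj M g (r *m ad r) =
    gconj M g (r *m (a *m b) *m ad r).
  have -> : r *m (a *m b) *m ad r =
      (r *m ad r) *m gconj M g^-1 (r *m ad r) *m (r *m ad r) by rewrite -yE !mulmxA.
  rewrite 2?[gconj M g (_ *m _ *m (r *m _))]gconj_mul // gconj_mul //.
  by rewrite -[in RHS]gconjM // mulgV gconj1.
rewrite yE' in Hy' *; rewrite yE in Hy; rewrite -(lamC indZ Hy Hy').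
set c := lam _.
have [rho [abE Hrho Nrho]] : exists rho, [/\ a *m b = rho + c%:M,
    kG_hom (M := Z) (N := Z) rho & rho \notin unitmx].
  exists (a *m b - c%:M); rewrite subrK; split=> //; first exact: hom_subscalar.
  exact: lamN.
have Hrr := kG_homM Hr' Hrho.
have frr : fixed_by M V (r *m (rho *m ad r)) := hom_mul_fixed Hr Hrr.
have fcr : fixed_by M V (c%:M *m (r *m ad r)).
  by apply: fixed_byM => // h _; rewrite scalar_mxC.
have -> : r *m (a *m b) *m ad r = r *m (rho *m ad r) + c%:M *m (r *m ad r).
  by rewrite abE mulmxDr mulmxDl mul_mx_scalar mul_scalar_mx scalemxAl mulmxA.
rewrite (vtrace_conj sVG) //; last exact: fixed_byD.
rewrite (vtraceD indM sVG) // (vtraceMl indM sVG) //; last exact: kG_hom_scalar.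
rewrite (lam_scalar indM) mulrC (vtrace_nonunit indM minV indZ Hr Hrr) ?add0r // => x fx.
rewrite -mulmxA -mulmxA unitmx_mul (negPf Nrho) //.
Qed.

(* As a function of v, this is the square of a linear functional when x is
   self-adjoint. *)
Local Notation value v x := (lam (ad v *m x *m v)).

Lemma valueD v x y : Zhom v -> fixed_by M V x -> fixed_by M V y ->
  value v (x + y) = value v x + value v y.
Proof. by move=> Hv fx fy; rewrite mulmxDr mulmxDl lamD //; apply: inner_hom. Qed.

Lemma value_symmetrized v x : Zhom v -> fixed_by M V x -> value v (x + adj x) = 0.
Proof.
move=> Hv fx; rewrite mulmxDr mulmxDl -inner_adjoint.
by apply: (lam_symmetrized char2 indZ formC); apply: inner_hom.
Qed.

(** Let v^# be the adjoint of v, phi_x v the eigenvalue of v^# x v, and t w the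
    trace of w w^#. By [source_diagonal], phi_1 is a multiple of phi_(t p) when
    1 is the trace of q p^#, and phi_((t w)^2) is the multiple of phi_(t w) by
    the eigenvalue of w^# w. Were all the t w non-units, there would be a
    nilpotent self-adjoint j with phi_1 v = e phi_1 (j v) for all v; iterating,
    phi_1 would vanish, although phi_1 i = 1. *)
Lemma nonalternating_source i : Zhom i -> ad i *m i = 1%:M ->
  exists2 w, Zhom w & s (w *m ad w) != 0.
Proof.
move=> Hi ii; have [UB UC] := (form_unit formB, form_unit formC).
case: (boolp.EM (exists2 w, Zhom w & s (w *m ad w) != 0)) => // noW.
pose t w := tr (w *m ad w).
have Nt w : Zhom w -> t w \notin unitmx.
  move=> Hw; rewrite -vtrace_unit //; last exact: outer_fixed.
  by apply/negP=> nz; apply: noW; exists w.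
have fV x : kG_hom (M := M) (N := M) x -> fixed_by M V x by apply: fixed_byS.
have Ht w : Zhom w -> kG_hom (M := M) (N := M) (t w) by move=> Hw; apply: outer_tr_hom.
have adjt w : adj (t w) = t w by rewrite (adjoint_reltr formB) // adjoint_outer.
have diag w v : Zhom w -> Zhom v -> value v (t w *m t w) = lam (ad w *m w) * value v (t w).
  by move=> Hw Hv; apply: source_diagonal.
have [_ [q [p' [Hq Hp' tr1]]]] := is_sourceE srcZ.
pose p := adjoint B C p'.
have p'E : p' = ad p by rewrite /p (adjointK _ UB (form_sym formB) UC (form_sym formC)).
have Hp : Zhom p := adjoint_hom (sVG := subxx V) formC form_Res Hp'.
rewrite p'E in tr1.
have tr1' : tr (p *m ad q) = 1%:M.
  by rewrite -adjoint_outer -(adjoint_reltr formB) // tr1 adjoint_scalar.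
have eqp v : Zhom v -> value v 1%:M = lam (ad q *m q) * value v (t p).
  move=> Hv; have := source_diagonal Hq Hp Hv; rewrite tr1 tr1' mulmx1.
  by [].
have addw w1 w2 v : Zhom w1 -> Zhom w2 -> Zhom v ->
    value v (t (w1 + w2)) = value v (t w1) + value v (t w2).
  move=> H1 H2 Hv.
  have -> : t (w1 + w2) = (t w1 + t w2) + (tr (w1 *m ad w2) + adj (tr (w1 *m ad w2))).
    rewrite (adjoint_reltr formB) // adjoint_outer /t adjointD mulmxDr !mulmxDl !reltrD.
    exact: addr_shuffle.
  have ft := outer_tr_hom H1 H2.
  have f12 : fixed_by M V (t w1 + t w2) by apply: fV; apply: kG_homD; apply: Ht.
  have fs : fixed_by M V (tr (w1 *m ad w2) + adj (tr (w1 *m ad w2))).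
    by apply: fV; apply: kG_homD => //; apply: (adjoint_endo formB).
  rewrite (valueD Hv f12 fs) (value_symmetrized Hv (fV _ ft)) addr0.
  exact: valueD Hv (fV _ (Ht _ H1)) (fV _ (Ht _ H2)).
clearbody t; have [j [e [Hj Nj sj ej]]] : exists j e,
    [/\ kG_hom (M := M) (N := M) j, j \notin unitmx,
    adj j = j & forall v, Zhom v -> value v 1%:M = e * value v (j *m j)].
  have [c0|nz] := eqVneq (lam (ad p *m p)) 0; last first.
    exists (t p), (lam (ad q *m q) / lam (ad p *m p)); split; [exact: Ht|exact: Nt|by []|].
    by move=> v Hv; rewrite diag // mulrA divfK // -eqp.
  (* Both i and p + i have value 1, and t p and t (p + i) + t i define the same
     functional. *)
  have Hw : Zhom (p + i) by apply: kG_homD.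
  exists (t (p + i) + t i), (lam (ad q *m q)); split.
  - by apply: kG_homD; apply: Ht.
  - by apply: nonunitD => //; [apply: Ht | apply: Ht | apply: Nt | apply: Nt].
  - by rewrite adjointD !adjt.
  move=> v Hv; rewrite (eqp v Hv); apply: (congr1 (GRing.mul _)).
  have lami : lam (ad i *m i) = 1 by rewrite ii (lam1 indZ).
  have fix1 : fixed_by M V 1%:M by move=> h _; rewrite mulmx1 mul1mx.
  have in1 u : Zhom u -> kG_hom (M := Z) (N := Z) (ad u *m u).
    by move=> Hu; rewrite -[ad u]mulmx1; apply: inner_hom.
  have lamw : lam (ad (p + i) *m (p + i)) = 1.
    have Hpi : kG_hom (M := Z) (N := Z) (ad p *m i).
      exact: (kG_homM (N := Res sVG M) Hi (adjoint_hom formB formC Hp)).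
    have -> : ad (p + i) *m (p + i) =
        (ad p *m p + ad i *m i) + (ad p *m i + adjoint C C (ad p *m i)).
      rewrite (adjointM _ _ _ _ UB) (adjointK _ UC (form_sym formC) UB (form_sym formB)).
      by rewrite adjointD mulmxDr !mulmxDl addr_shuffle.
    have H2 : kG_hom (M := Z) (N := Z) (ad p *m p + ad i *m i).
      by apply: kG_homD; apply: in1.
    rewrite lamD //; last by apply: kG_homD => //; apply: (adjoint_endo formC).
    by rewrite (lam_symmetrized char2) // addr0 (lamD indZ (in1 _ Hp) (in1 _ Hi)) c0 lami add0r.
  have -> : (t (p + i) + t i) *m (t (p + i) + t i) =
      (t (p + i) *m t (p + i) + t i *m t i) + (t (p + i) *m t i + adj (t (p + i) *m t i)).
    rewrite (adjointM _ _ _ _ UB) !adjt mulmxDr !mulmxDl.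
    exact: addr_shuffle.
  have f1 : fixed_by M V (t (p + i) *m t i) by apply: fixed_byM; apply/fV/Ht.
  have f2 : fixed_by M V (t (p + i) *m t (p + i)) by apply: fixed_byM; apply/fV/Ht.
  have f3 : fixed_by M V (t i *m t i) by apply: fixed_byM; apply/fV/Ht.
  rewrite valueD //; last 2 first.
  - exact: fixed_byD.
  - by apply: fixed_byD => //; apply: (adjoint_fixed formB sVG).
  rewrite (value_symmetrized Hv f1) addr0 (valueD Hv f2 f3) (diag _ _ Hw Hv).
  rewrite (diag _ _ Hi Hv) (addw _ _ _ Hp Hi Hv).
  move: (value v (t p)) (value v (t i)) (lam _) (lam _) lamw lami => a b _ _ -> ->.
  by rewrite !mul1r -addrA addrr_pchar2 // addr0.
have [|[m jm]] := unit_or_nilpotent indM Hj; first by rewrite (negPf Nj).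
have val1 v : Zhom v -> value v 1%:M = e * value (j *m v) 1%:M.
  have ajv : ad (j *m v) = ad v *m j by rewrite (adjointM _ _ _ _ UB) sj.
  by move=> Hv; rewrite (ej _ Hv) ajv mulmx1 !mulmxA.
have iterv (r : nat) v : Zhom v -> value v 1%:M = e ^+ r * value (iter r (mulmx j) 1%:M *m v) 1%:M.
  move=> Hv; elim: r => [|r ->]; first by rewrite mul1r mul1mx.
  have Hit : Zhom (iter r (mulmx j) 1%:M *m v).
    elim: r => [|r IH] /=; first by rewrite mul1mx.
    by rewrite -mulmxA; apply: (kG_homM (N := Res sVG M) IH); apply: fV Hj.
  by rewrite (val1 _ Hit) mulrA -exprSr /= -(mulmxA j).
have := iterv m i Hi; rewrite jm mul0mx mulmx0 (lam0 indZ) mulr0 mulmx1 ii (lam1 indZ).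
by move/eqP; rewrite oner_eq0.
Qed.

End SymmetricSources.

Section SymmetricProjectivityAtTheVertex.
Local Open Scope ring_scope.

Variables (k : closedFieldType) (gT : finGroupType) (G V : {group gT}).
Variable M : representation k G.
Hypotheses (char2 : 2%N \in [pchar k]) (indM : indecomposable M) (sVG : V \subset G).
Hypothesis minV : forall U : {group gT},
  relatively_projective U M -> U \subset V -> U :=: V.
Local Notation n := (rdegree M).
Local Notation lam := some_eigenvalue.
Local Notation s := (@vtrace k gT G V M).

Lemma form_on_summand (B : 'M[k]_n) (Z : representation k V) (i : 'M_(n, rdegree Z)) :
    G_form B -> kG_hom (M := Z) (N := Res sVG M) i -> i^T *m B *m i \in unitmx ->
  G_form (M := Z) (i^T *m B *m i).
Proof.
move=> formB Hi UC; have [UB symB invB] := (G_formE B).1 formB.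
apply/G_formE; split=> //; first by rewrite pullback_tr symB.
move=> v Vv; have iV : i *m Z v = M v *m i by apply: Hi.
by rewrite pullback_mul iV -pullback_mul invB // (subsetP sVG).
Qed.

(** The self-adjoint element with invertible trace is the product of the w that
    [nonalternating_source] provides and its adjoint. *)
Lemma nondegenerate_source_projective :
  has_form_nondegenerate_on_source sVG M -> symmetrically_projective V M.
Proof.
move=> [B [Z [i [formB [srcZ [Hi _]] /nondegenerate_onE UC]]]].
have formC := form_on_summand formB Hi UC.
have ii : adjoint (i^T *m B *m i) B i *m i = 1%:M.
  by rewrite /adjoint -!mulmxA mulVmx // !mulmxA.
have [w Hw nz] := nonalternating_source char2 indM minV formB srcZ formC Hi ii.
apply/(symmetrically_projectiveP V formB); split=> //.
exists (w *m adjoint (i^T *m B *m i) B w); split.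
- exact: outer_fixed.
- by apply: (adjoint_outer formB formC).
by rewrite -vtrace_unit //; apply: outer_fixed.
Qed.

Lemma adjoint_mulform (B Y : 'M[k]_n) : B \in unitmx -> B^T = B ->
  adjoint B B (Y *m B) = Y^T *m B.
Proof. by move=> UB symB; rewrite /adjoint trmx_mul symB !mulmxA mulVmx // mul1mx. Qed.

(** Here K is a symmetric form on the dual of Z, viewed as a map from that dual
    to Z, and q K q^T B is the self-adjoint endomorphism of M that factors
    through it. Starting from Z = M, decompose: the two mixed terms are adjoint
    to each other, so one of the two summands keeps a nonzero vertex trace. *)
Lemma form_exists_source (B : 'M[k]_n) : G_form B -> symmetrically_projective V M ->
  exists Z : representation k V, exists (q : 'M_(n, rdegree Z)) (K : 'M_(rdegree Z)),
   [/\ indecomposable Z, kG_hom (M := Z) (N := Res sVG M) q, K^T = K,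
     forall v, v \in V -> Z v *m K *m (Z v)^T = K & s (q *m K *m q^T *m B) != 0].
Proof.
move=> formB /(symmetrically_projectiveP V formB)[_ [x [fx sx Ux]]].
have [UB symB] := (form_unit formB, form_sym formB).
pose P (Z : representation k V) := exists (q : 'M_(n, rdegree Z)) (K : 'M_(rdegree Z)),
   [/\ kG_hom (M := Z) (N := Res sVG M) q, K^T = K,
     forall v, v \in V -> Z v *m K *m (Z v)^T = K & s (q *m K *m q^T *m B) != 0].
suffices [Z [q [K [Hq symK invK nz]]] indZ] : exists2 Z, P Z & indecomposable Z.
  by exists Z, q, K.
have fK (Z : representation k V) (a b : 'M_(n, rdegree Z)) (K : 'M_(rdegree Z)) :
    kG_hom (M := Z) (N := Res sVG M) a -> kG_hom (M := Z) (N := Res sVG M) b ->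
    (forall v, v \in V -> Z v *m K *m (Z v)^T = K) -> fixed_by M V (a *m K *m b^T *m B).
  move=> Ha Hb invK v Vv; have Gv := subsetP sVG v Vv.
  have aV : a *m Z v = M v *m a by apply: Ha.
  have bVi : b *m Z v^-1%g = M v^-1%g *m b by apply: Hb; rewrite groupV.
  rewrite -mulmxA (form_mul formB Gv) mulmxA -(mulmxA _ b^T) -trmx_mul -bVi trmx_mul.
  rewrite !mulmxA -aV -(mulmxA a K) -(mulmxA a (Z v)); congr (a *m _ *m _ *m _).
  by rewrite -{2}(invK _ (groupVr Vv)) !mulmxA -repr_mxM ?groupV // mulgV repr_mx1 mul1mx.
apply: minimal_indecomposable => [|Z [q [K [Hq symK invK nz]]]|].
- have xB : x *m invmx B = invmx B *m x^T.
    by rewrite -{1}sx /adjoint mulmxK.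
  exists (Res sVG M), 1%:M, (x *m invmx B); split.
  + exact: kG_hom1.
  + by rewrite trmx_mul trmx_inv symB -xB.
  + move=> v Vv; have Gv := subsetP sVG v Vv; rewrite /= mulmxA -fx //.
    have e : (M v)^T *m B = B *m M v^-1%g by rewrite (form_mul formB) ?groupV // invgK.
    apply: (can_inj (mulmxK UB)); rewrite mulmxKV // -mulmxA e -!mulmxA mulKmx //.
    by rewrite -repr_mxM ?groupV // mulgV repr_mx1 mulmx1.
  by rewrite mul1mx trmx1 mulmx1 mulmxKV // vtrace_unit.
- rewrite lt0n; apply: contraNneq nz => d0.
  suff -> : q *m K = 0 by rewrite !mul0mx vtrace0.
  by apply/matrixP=> i j; rewrite !mxE big1 // => -[l lt_l]; exfalso; rewrite d0 in lt_l.
move=> Z L1 L2 q1 p1 q2 p2 [q [K [Hq symK invK nz]]] Hq1 Hp1 Hq2 Hp2 e1.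
pose K1 := p1 *m K *m p1^T; pose K2 := p2 *m K *m p2^T.
have sK1 : K1^T = K1 by rewrite /K1 !trmx_mul trmxK symK mulmxA.
have sK2 : K2^T = K2 by rewrite /K2 !trmx_mul trmxK symK mulmxA.
have iK1 v : v \in V -> L1 v *m K1 *m (L1 v)^T = K1.
  move=> Vv; rewrite /K1 !mulmxA -Hp1 // -mulmxA -trmx_mul -Hp1 // trmx_mul.
  by rewrite mulmxA -!(mulmxA p1) invK.
have iK2 v : v \in V -> L2 v *m K2 *m (L2 v)^T = K2.
  move=> Vv; rewrite /K2 !mulmxA -Hp2 // -mulmxA -trmx_mul -Hp2 // trmx_mul.
  by rewrite mulmxA -!(mulmxA p2) invK.
have Hqq1 := kG_homM Hq1 Hq; have Hqq2 := kG_homM Hq2 Hq.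
have Ha := kG_homM Hp1 Hqq1; have Hb := kG_homM Hp2 Hqq2.
pose X := (q *m q1 *m p1) *m K *m (q *m q2 *m p2)^T *m B.
have eX : q *m K *m q^T *m B = (q *m q1) *m K1 *m (q *m q1)^T *m B +
     (q *m q2) *m K2 *m (q *m q2)^T *m B + (X + adjoint B B X).
  have qE : q = q *m q1 *m p1 + q *m q2 *m p2 by rewrite -!mulmxA -mulmxDr e1 mulmx1.
  have -> : (q *m q1) *m K1 *m (q *m q1)^T = (q *m q1 *m p1) *m K *m (q *m q1 *m p1)^T.
    by rewrite /K1 (trmx_mul (q *m q1) p1) !mulmxA.
  have -> : (q *m q2) *m K2 *m (q *m q2)^T = (q *m q2 *m p2) *m K *m (q *m q2 *m p2)^T.
    by rewrite /K2 (trmx_mul (q *m q2) p2) !mulmxA.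
  rewrite /X adjoint_mulform // [in LHS]qE.
  move: (q *m q1 *m p1) (q *m q2 *m p2) => a b.
  rewrite !trmx_mul trmxK symK linearD /= mulmxDr !mulmxDl !mulmxA.
  by rewrite addr_shuffle [X in _ + X]addrC.
have fX : fixed_by M V X by apply: fK.
clearbody X; have f1 := fK _ _ _ _ Hqq1 Hqq1 iK1; have f2 := fK _ _ _ _ Hqq2 Hqq2 iK2.
move: nz; rewrite eX (vtraceD indM sVG) //; last 2 first.
- exact: fixed_byD.
- by apply: fixed_byD => //; apply: (adjoint_fixed formB sVG).
rewrite (vtraceD indM sVG f1 f2) (vtraceD indM sVG fX (adjoint_fixed formB sVG fX)).
rewrite (vtrace_adjoint indM sVG formB fX).
move: (addrr_pchar2 char2 (s X)); move: (s X + s X) => _ ->; rewrite addr0 => nz.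
have [z1|nz1] := eqVneq (s ((q *m q1) *m K1 *m (q *m q1)^T *m B)) 0.
  by right; exists (q *m q2), K2; split=> //; rewrite z1 add0r in nz.
by left; exists (q *m q1), K1.
Qed.

(** The form K is invertible by [vtrace_nonunit], and its inverse is a form on
    the source Z. The form of M that is non-degenerate on Z is B twisted by the
    trace of q times its adjoint, and not B itself, which may be alternating. *)
Lemma projective_nondegenerate_source :
  symmetric_type M -> symmetrically_projective V M -> has_form_nondegenerate_on_source sVG M.
Proof.
move=> [B formB] symV; have [UB symB] := (form_unit formB, form_sym formB).
have [Z [q [K [indZ Hq symK invK nz]]]] := form_exists_source formB symV.
have Hp : kG_hom (M := Res sVG M) (N := Z) (K *m q^T *m B).
  move=> v Vv; have Gv := subsetP sVG v Vv.
  have qVi : q *m Z v^-1%g = M v^-1%g *m q by apply: Hq; rewrite groupV.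
  suff : K *m q^T *m B *m M v = Z v *m (K *m q^T *m B) by [].
  rewrite -mulmxA (form_mul formB Gv) !mulmxA -(mulmxA K) -trmx_mul -qVi trmx_mul.
  rewrite !mulmxA; congr (_ *m _ *m _).
  by rewrite -{1}(invK _ Vv) -mulmxA -trmx_mul -repr_mxM ?groupV // mulVg repr_mx1 trmx1 mulmx1.
have UK : K \in unitmx.
  apply: contraNT nz => NK; apply/eqP.
  have -> : q *m K *m q^T *m B = q *m (K *m q^T *m B) by rewrite !mulmxA.
  apply: (vtrace_nonunit indM minV indZ Hq Hp) => a fa.
  by rewrite -!mulmxA unitmx_mul (negPf NK).
have formC : G_form (M := Z) (invmx K).
  apply/G_formE; rewrite unitmx_inv trmx_inv symK; split=> // v Vv.
  apply: (can_inj (mulmxK UK)); rewrite mulVmx // -{2}(invK _ (groupVr Vv)) !mulmxA.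
  rewrite -(mulmxA _ (Z v)) -repr_mxM ?groupV // mulgV repr_mx1 mulmx1 mulmxKV //.
  by rewrite -trmx_mul -repr_mxM ?groupV // mulVg repr_mx1 trmx1.
have adq : adjoint (invmx K) B q = K *m q^T *m B by rewrite /adjoint invmxK.
have nz' : s (q *m adjoint (invmx K) B q) != 0 by rewrite adq !mulmxA.
have srcZ : is_source sVG M Z.
  by apply: (is_source_vtrace indM indZ Hq Hp); rewrite -adq.
have := trace_form_diagonal char2 indM minV formB srcZ formC Hq nz'.
set t := reltr M V G _ => nzt.
have fqq := outer_fixed formB formC Hq Hq.
have Ht : kG_hom (M := M) (N := M) t by apply: reltr_hom.
have Ut : t \in unitmx by rewrite -vtrace_unit.
have adt : adjoint B B t = t by rewrite (adjoint_reltr formB) // (adjoint_outer formB formC).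
have ftV : fixed_by M V t by apply: fixed_byS sVG Ht.
have Hin : kG_hom (M := Z) (N := Z) (adjoint (invmx K) B q *m t *m q) by apply: inner_hom.
have Uin : adjoint (invmx K) B q *m t *m q \in unitmx by rewrite -(lam_unit indZ).
exists (B *m t), Z, q; split; last 1 first.
- apply/nondegenerate_onE.
  have -> : q^T *m (B *m t) *m q = invmx K *m (adjoint (invmx K) B q *m t *m q).
    by rewrite adq !mulmxA mulVmx // mul1mx.
  by rewrite unitmx_mul unitmx_inv UK.
- apply/G_formE; split; first by rewrite unitmx_mul UB.
    by rewrite trmx_mul symB -[in RHS]adt /adjoint !mulmxA mulmxV // mul1mx.
  have [_ _ invB] := (G_formE B).1 formB.
  by move=> g Gg; rewrite -!mulmxA Ht // !mulmxA invB.
split=> //; have Hin' := kG_homV Uin Hin.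
apply: (@split_embedding _ _ _ Z (Res sVG M) q
  (invmx (adjoint (invmx K) B q *m t *m q) *m (adjoint (invmx K) B q *m t))) => //.
  apply: (kG_homM _ Hin'); apply: (kG_homM (N := Res sVG M)); first exact: ftV.
  exact: adjoint_hom.
by rewrite -(mulmxA (invmx _) (_ *m t) q) mulVmx.
Qed.

End SymmetricProjectivityAtTheVertex.

(** * The index of a Green vertex in a symmetric vertex *)

Lemma quadratic_extension (gT : finGroupType) (V : {group gT}) c :
    c \in 'N(V) -> c * c \in V -> c \notin V ->
  exists U : {group gT},
    [/\ U :=: V :|: c *: V, V \subset U, #|U : V| = 2 & lcosets V U = [set gval V; c *: V]].
Proof.
move=> Nc Vcc nVc.
have VJ v : v \in V -> v ^ c \in V by rewrite memJ_norm.
have gU : group_set (V :|: c *: V).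
  apply/group_setP; split; first by rewrite inE group1.
  move=> x y /setUP[Vx|/lcosetP[v Vv ->]] /setUP[Vy|/lcosetP[w Vw ->]]; rewrite inE.
  - by rewrite groupM.
  - by rewrite orbC mulgA (conjgC x c) -mulgA mem_lcoset mulKg groupM // VJ.
  - by rewrite orbC -mulgA mem_lcoset mulKg groupM.
  have -> : c * v * (c * w) = (c * c) * (v ^ c * w).
    by rewrite !mulgA -(mulgA c v c) (conjgC v c) !mulgA.
  by rewrite groupM // groupM ?VJ.
pose U := Group gU; have sVU : V \subset U by apply: subsetUl.
have cosU : lcosets V U = [set gval V; c *: V].
  apply/setP=> C; rewrite !inE; apply/lcosetsP/orP.
    case=> x /setUP[Vx|Ux] ->; first by left; rewrite lcoset_id.
    by right; apply/eqP/lcoset_eqP.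
  case=> /eqP ->; first by exists 1; rewrite ?group1 ?lcoset1.
  by exists c; rewrite // inE lcoset_refl orbT.
exists U; split=> //; rewrite -card_lcosets cosU cards2.
suff -> : (V : {set gT}) != c *: V by [].
by apply: contraNneq nVc => ->; rewrite lcoset_refl.
Qed.

Section IndexBound.
Local Open Scope ring_scope.

Variables (k : closedFieldType) (gT : finGroupType) (G V T : {group gT}).
Variable M : representation k G.
Hypotheses (char2 : 2%N \in [pchar k]) (indM : indecomposable M) (sVG : V \subset G).
Hypothesis projV : relatively_projective V M.
Hypothesis minV : forall U : {group gT},
  relatively_projective U M -> U \subset V -> U :=: V.
Variable B : 'M[k]_(rdegree M).
Hypothesis formB : G_form B.
Local Notation n := (rdegree M).
Local Notation lam := some_eigenvalue.
Local Notation s := (@vtrace k gT G V M).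
Local Notation adj := (adjoint B B).

Lemma symmetrically_projective_conj (U : {group gT}) b :
  b \in G -> symmetrically_projective U M -> symmetrically_projective (U :^ b^-1)%G M.
Proof.
move=> Gb /(symmetrically_projectiveP U formB)[sUG [x [fx sx Ux]]].
apply/(symmetrically_projectiveP _ formB); split; first by rewrite conj_subG ?groupV.
exists (gconj M b x); split; first exact: fixed_by_conj.
  by rewrite (adjoint_gconj formB) // sx.
by rewrite reltr_conj.
Qed.

(* How adjunction followed by conjugation by C^-1 moves the term indexed by the
   cosets (C, D) in the expansion of th Tr om Tr (adj th) *)
Local Notation swap := (fun p : {set gT} * {set gT} => (p.1^-1%g, ((repr p.1)^-1 *: p.2)%g)).

(** The involution [swap] preserves the values of the terms that survive in the
    expansion; as their sum is nonzero, it fixes a nonzero one. *)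
Lemma swap_fixed_point (th om : 'M[k]_n) : T \subset G ->
    fixed_by M V th -> reltr M V G th = 1%:M ->
    fixed_by M T om -> adj om = om -> reltr M T G om \in unitmx ->
  exists c b, [/\ c \in G /\ b \in G, c \in 'N(V) /\ (c^-1 *: V = c *: V)%g,
    (forall v, v \in V -> (v *: (b *: T) = b *: T)%g), (c^-1 *: (b *: T) = b *: T)%g
    & s (th *m gconj M b om *m gconj M c (adj th)) != 0].
Proof.
move=> sTG fth tr1 fom som Uom.
have muP := vtrace_brauer indM sVG minV.
have [UB symB] := (form_unit formB, form_sym formB).
have fath := adjoint_fixed formB sVG fth.
have tra1 : reltr M V G (adj th) = 1%:M by rewrite -(adjoint_reltr formB) // tr1 adjoint_scalar.
have Hom : kG_hom (M := M) (N := M) (reltr M T G om) by apply: reltr_hom.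
have fOm : fixed_by M V (reltr M T G om) := fixed_byS sVG Hom.
have fixD D : D \in fixed_lcosets V T G -> fixed_by M V (gconj M (repr D) om).
  case/fixed_lcosetP=> DG fD; have [Gd defD] := lcosets_sub sTG DG.
  apply: fixed_by_gconj => // v Vv; have Gv := subsetP sVG v Vv.
  by rewrite -gconjM // -(gconj_repr sTG (groupM Gv Gd) fom) lcosetM -defD fD.
pose F (p : {set gT} * {set gT}) :=
  s (th *m gconj M (repr p.2) om *m gconj M (repr p.1) (adj th)).
pose S := setX (fixed_lcosets V V G) (fixed_lcosets V T G).
have sumF : \sum_(p in S) F p != 0.
  have -> : \sum_(p in S) F p = s (th *m reltr M T G om *m reltr M V G (adj th)).
    rewrite (vtrace_mackey indM sVG minV (Phi := fun x => th *m reltr M T G om *m x)) //.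
    - rewrite (eq_bigl (fun p : {set gT} * {set gT} =>
        (p.1 \in fixed_lcosets V V G) && (p.2 \in fixed_lcosets V T G))); last first.
        by move=> p; rewrite inE.
      rewrite -(pair_big (mem (fixed_lcosets V V G)) (mem (fixed_lcosets V T G))
        (fun C D => F (C, D))) /=.
      apply: eq_bigr => C CV; have [Gc Nc _] := fixed_lcoset_norm sVG CV.
      rewrite (vtrace_mackey indM sVG minV
        (Phi := fun x => th *m x *m gconj M (repr C) (adj th))) //.
        by move=> x y; rewrite mulmxDr mulmxDl.
      move=> v x Vv; have Gv := subsetP sVG v Vv; rewrite [RHS]gconj_mul //.
      rewrite (gconj_fixed Gv Vv (fixed_by_norm sVG Gc Nc fath)).
      rewrite [gconj M v (th *m x)]gconj_mul //.
      by rewrite (gconj_fixed Gv Vv fth).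
    - by move=> x y; rewrite mulmxDr.
    move=> v x Vv; have Gv := subsetP sVG v Vv; rewrite gconj_mul //.
    by rewrite (gconj_fixed Gv Vv (fixed_byM fth fOm)).
  rewrite tra1 mulmx1 (vtraceMr indM sVG) //; apply: mulf_neq0.
    by rewrite vtrace_unit // tr1 unitmx1.
  by rewrite lam_unit.
have SP p : p \in S -> [/\ p.1 \in fixed_lcosets V V G & p.2 \in fixed_lcosets V T G].
  by case: p => C D /setXP[].
have invC C : C \in fixed_lcosets V V G -> C^-1%g = ((repr C)^-1 *: V)%g.
  move=> CV; have [Gc Nc defC] := fixed_lcoset_norm sVG CV.
  by rewrite {1}defC invMg invg_set1 invGid norm_rlcoset ?groupV.
have VN c v : c \in 'N(V) -> v \in V -> (v * c^-1 = c^-1 * (v ^ c^-1))%g.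
  by move=> Nc Vv; rewrite conjgE invgK mulKg.
have swapS p : p \in S -> swap p \in S.
  move=> /SP[CV /fixed_lcosetP[DG fD]]; have [Gc Nc _] := fixed_lcoset_norm sVG CV.
  apply/setXP; split; apply/fixed_lcosetP; rewrite /= ?mulg_lcosets ?groupV //.
    rewrite invC //; split=> [|v Vv].
      by apply/lcosetsP; exists (repr p.1)^-1%g; rewrite ?groupV.
    by rewrite -lcosetM VN // lcosetM lcoset_id // memJ_norm // groupV.
  split=> // v Vv.
  by rewrite -lcosetM VN // lcosetM fD // memJ_norm // groupV.
have swapK p : p \in S -> swap (swap p) = p.
  case: p => C D /SP[/= CV /fixed_lcosetP[DG fD]]; rewrite invgK; congr pair.
  have [Gc Nc _] := fixed_lcoset_norm sVG CV.
  rewrite invC //; have [v Vv ->] := mem_repr_lcoset V (repr C)^-1%g.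
  by rewrite -lcosetM invMg invgK mulgK fD // groupV.
have Fswap p : p \in S -> F (swap p) = F p.
  case: p => C D /SP[/= CV DT]; have [Gc Nc _] := fixed_lcoset_norm sVG CV.
  have /fixed_lcosetP[DG fD] := DT; have [Gd defD] := lcosets_sub sTG DG.
  have Gci : (repr C)^-1%g \in G by rewrite groupV.
  have Nci : (repr C)^-1%g \in 'N(V) by rewrite groupV.
  rewrite /F /=; rewrite (invC C CV).
  rewrite (gconj_repr sVG Gci fath).
  have -> : gconj M (repr ((repr C)^-1 *: D)%g) om =
      gconj M (repr C)^-1%g (gconj M (repr D) om).
    by rewrite -gconjM // -(gconj_repr sTG (groupM Gci Gd) fom) lcosetM -defD.
  have sD : adj (gconj M (repr D) om) = gconj M (repr D) om.
    by rewrite (adjoint_gconj formB) // som.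
  move: (fixD D DT) sD; move: (gconj M (repr D) om) => w fw sw.
  have fgth : fixed_by M V (gconj M (repr C) th) by apply: fixed_by_norm.
  have fgath : fixed_by M V (gconj M (repr C) (adj th)) by apply: fixed_by_norm.
  have -> : s (th *m w *m gconj M (repr C) (adj th)) =
      s (gconj M (repr C) th *m w *m adj th).
    rewrite -(vtrace_adjoint indM sVG formB); last by apply: fixed_byM => //; apply: fixed_byM.
    congr s; rewrite (adjointM _ _ _ _ UB) [adj (th *m w)](adjointM _ _ _ _ UB) sw.
    by rewrite (adjoint_gconj formB) // (adjointK _ UB symB UB symB) mulmxA.
  have E : gconj M (repr C)^-1%g (gconj M (repr C) th) = th.
    by rewrite -gconjM // mulVg gconj1.
  have -> : th *m gconj M (repr C)^-1%g w *m gconj M (repr C)^-1%g (adj th) =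
      gconj M (repr C)^-1%g (gconj M (repr C) th *m w *m adj th).
    rewrite -{1}E; move: (adj th) (gconj M (repr C) th) => x y.
    by rewrite [RHS]gconj_mul // [gconj M _ (y *m w)]gconj_mul.
  rewrite (vtrace_conj sVG Gci Nci) //.
  by apply: fixed_byM => //; apply: fixed_byM.
move: sumF; rewrite (sum_involution char2 swapS swapK Fswap).
case: (boolP [exists p in S, (swap p == p) && (F p != 0)]) => [|/exists_inPn no].
  case/exists_inP=> -[C D] /setXP[CV DT] /andP[/eqP[eC eD] nz] _.
  have /fixed_lcosetP[CG _] := CV; have /fixed_lcosetP[DG fD] := DT.
  have [Gc defC] := lcosets_sub sVG CG; have [Gd defD] := lcosets_sub sTG DG.
  have [_ Nc _] := fixed_lcoset_norm sVG CV.
  exists (repr C), (repr D); split=> //.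
  - by split; rewrite // -invC // -defC.
  - by rewrite -defD.
  by rewrite -defD.
rewrite big1 ?eqxx // => p /andP[Sp fp].
by apply/eqP; have := no p Sp; rewrite fp /= negbK.
Qed.

(** The term eta is self-adjoint up to conjugation by c, so its trace from V to
    the group U generated by V and c is eta, or eta + adj eta, and is
    self-adjoint. *)
Lemma vertex_index_le2 : symmetric_vertex M T -> V \subset T -> (#|T : V| <= 2)%N.
Proof.
move=> [symT minT] sVT; have [UB symB] := (form_unit formB, form_sym formB).
have [sTG [om [fom som Uom]]] := (symmetrically_projectiveP T formB).1 symT.
have [_ [th fth tr1]] := (relatively_projectiveP V M).1 projV.
have [c [b [[Gc Gb] [Nc eC] fD cD nz]]] := swap_fixed_point sTG fth tr1 fom som Uom.
have fath := adjoint_fixed formB sVG fth.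
set w := gconj M b om in nz.
have sw : adj w = w by rewrite (adjoint_gconj formB) // som.
have fw : fixed_by M (T :^ b^-1)%G w by apply: fixed_by_conj.
have memTb x : (x *: (b *: T) = b *: T)%g -> (x \in T :^ b^-1)%g.
  move=> e; rewrite mem_conjg invgK conjgE -mem_lcoset -e -lcosetM.
  by rewrite lcoset_refl.
have sVTb : (V \subset T :^ b^-1)%g by apply/subsetP=> v Vv; apply/memTb/fD.
have Tbc : (c \in T :^ b^-1)%g by rewrite -groupV; apply: memTb.
have sTbG : (T :^ b^-1 \subset G)%g by rewrite conj_subG ?groupV.
have fwV : fixed_by M V w by apply: fixed_byS fw.
have cardTb : #|(T :^ b^-1)%g| = #|T| by rewrite cardJg.
have fcath : fixed_by M V (gconj M c (adj th)) by apply: fixed_by_norm.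
clearbody w.
set eta := th *m w *m gconj M c (adj th) in nz.
have feta : fixed_by M V eta by apply: fixed_byM => //; apply: fixed_byM.
have Ueta : reltr M V G eta \in unitmx by rewrite -vtrace_unit.
suff [U [sVU sUTb dU symU]] : exists U : {group gT},
    [/\ V \subset U, (U \subset T :^ b^-1)%g, (#|(U : {set gT}) : V|%g <= 2)%N
      & symmetrically_projective U M].
  have := minT _ (symmetrically_projective_conj (groupVr Gb) symU).
  rewrite /= invgK => defT.
  have eT : (U :^ b)%g = T.
    apply: defT; rewrite -(conjsgKV b T).
    by rewrite conjSg.
  by rewrite -divgS // -eT cardJg divgS.
have [Vc|nVc] := boolP (c \in V).
  exists V; split=> //; first by rewrite indexgg.
  apply/(symmetrically_projectiveP _ formB); split=> //; exists eta; split=> //.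
  rewrite /eta (gconj_fixed Gc Vc fath) (adjointM _ _ _ _ UB).
  by rewrite [adj (th *m w)](adjointM _ _ _ _ UB) sw (adjointK _ UB symB UB symB) mulmxA.
have Vcc : (c * c \in V)%g.
  have : (c^-1 \in c *: V)%g by rewrite -eC lcoset_refl.
  by rewrite mem_lcoset -invMg groupV.
have [U [defU sVU dU cosU]] := quadratic_extension Nc Vcc nVc.
have sUTb : (U \subset T :^ b^-1)%g.
  rewrite defU subUset sVTb; apply/subsetP=> x /lcosetP[v Vv ->].
  by rewrite groupM // (subsetP sVTb).
have sUG := subset_trans sUTb sTbG.
have aeta : adj eta = gconj M c eta.
  rewrite /eta (adjointM _ _ _ _ UB) [adj (th *m w)](adjointM _ _ _ _ UB) sw.
  rewrite (adjoint_gconj formB) // (adjointK _ UB symB UB symB).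
  rewrite [RHS]gconj_mul // [gconj M c (th *m w)]gconj_mul // (gconj_fixed Gc Tbc fw).
  by rewrite -gconjM // (gconj_fixed _ Vcc fath) ?groupM // mulmxA.
have trU : reltr M V U eta = eta + adj eta.
  rewrite /reltr cosU big_setU1 /= ?inE ?big_set1; last first.
    by apply: contraNneq nVc => ->; rewrite lcoset_refl.
  rewrite (gconj_repr sVG Gc feta) aeta; congr (_ + _).
  by rewrite -(lcoset1 V) (gconj_repr sVG (group1 G) feta) gconj1.
exists U; split; rewrite ?dU //.
apply/(symmetrically_projectiveP _ formB); split=> //; exists (eta + adj eta); split.
- by rewrite -trU; apply: reltr_fixed.
- by rewrite adjointD (adjointK _ UB symB UB symB) addrC.
by rewrite -trU (reltr_trans sVU sUG (subxx G) feta).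
Qed.

End IndexBound.

(** * The principal block *)

Section CentralIdempotents.
Local Open Scope ring_scope.

Variables (k : fieldType) (gT : finGroupType) (G : {group gT}).
Local Notation kG := (group_ring k G).
Local Notation aG := (regular_repr k G).
Local Notation triv := (trivial_repr k G).
Implicit Types e : 'M[k]_#|G|.

Lemma central_class_function e : (e \in 'Z(kG))%MS ->
  exists2 a : gT -> k, e = \sum_(x in G) a x *: aG x &
    {in G &, forall x y, a (x ^ y)%g = a x}.
Proof.
case/center_mxP=> /envelop_mxP[a defe] cGe; exists a => // x y Gx Gy.
have projE b z : z \in G -> gring_proj z (\sum_(x in G) b x *: aG x) = (b z)%:M.
  move=> Gz; rewrite linear_sum (bigD1 z) //= linearZ /= gring_projE // eqxx scalemx1.
  rewrite big1 ?addr0 // => u /andP[Gu ne]; rewrite linearZ /= gring_projE //.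
  by rewrite eq_sym (negPf ne) scaler0.
have eJ : e = \sum_(z in G) a (z ^ y^-1)%g *: aG z.
  have -> : e = aG y^-1%g *m e *m aG y.
    by rewrite cGe ?repr_mxKV // envelop_mx_id ?groupV.
  rewrite {1}defe mulmx_sumr mulmx_suml [RHS](reindex_acts 'J _ Gy) ?astabsJ ?normG //=.
  apply: eq_bigr => z Gz; rewrite -scalemxAr -scalemxAl -!repr_mxM ?groupM ?groupV //.
  by rewrite conjgK conjgE mulgA.
have := projE a (x ^ y)%g (groupJ Gx Gy); rewrite -defe eJ projE ?groupJ // conjgK.
by move/matrixP/(_ 0 0); rewrite !mxE /= !mulr1n.
Qed.

Lemma trivial_idempotent e : (e \in kG)%MS -> e *m e = e ->
  gring_op triv e = 0 \/ gring_op triv e = 1%:M.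
Proof.
move=> kGe ee; have: gring_op triv e *m gring_op triv e = gring_op triv e.
  by rewrite -gring_opM // ee.
rewrite /=; move: (gring_op _ _) => c; rewrite [c]mx11_scalar -scalar_mxM => /matrixP/(_ 0 0).
rewrite !mxE /= !mulr1n => /eqP; rewrite -subr_eq0 -{3}[c 0 0]mulr1 -mulrBr mulf_eq0.
by case/orP=> [/eqP->|]; [left; rewrite raddf0 | rewrite subr_eq0 => /eqP ->; right].
Qed.

(** A central idempotent of least rank among those that act as the identity on
    the trivial module is primitive: if it is f + f', one of f and f' acts as
    the identity too, and then has the same row space. *)
Lemma principal_block_exists : exists2 e : 'M[k]_#|G|,
  block_idempotent e & in_block e triv.
Proof.
pose P d := exists e, [/\ central_idempotent e, in_block e triv & \rank e = d].
have exP : exists d, boolp.asbool (P d).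
  exists (\rank (1%:M : 'M[k]_#|G|)); apply/boolp.asboolP; exists 1%:M; split=> //.
    split; last by rewrite mulmx1.
    by apply/center_mxP; split=> [|B _]; rewrite ?envelop_mx1 ?mulmx1 ?mul1mx.
  exact: gring_op1.
case: (ex_minnP exP) => d /boolp.asboolP[e [[Ze ee] e1 rk]] mind.
have least f : central_idempotent f -> in_block f triv -> (\rank e <= \rank f)%N.
  by move=> cf f1; rewrite rk; apply/mind/boolp.asboolP; exists f.
have dead f f' : central_idempotent f -> central_idempotent f' -> f *m f' = 0 ->
    e = f + f' -> in_block f triv -> f' = 0.
  move=> cf [Zf' ff'] f0 def_e f1.
  have [/center_mxP[kGf cf1] ff] := cf.
  have f'0 : f' *m f = 0.
    by rewrite cf1 //; case/center_mxP: Zf'.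
  have ef : f *m e = f by rewrite def_e mulmxDr ff f0 addr0.
  have sfe : (f <= e)%MS by rewrite -ef submxMl.
  have eqfe : (e <= f)%MS.
    by have := mxrank_leqif_sup sfe; move/geq_leqif <-; rewrite least.
  have sf'e : (f' <= e)%MS.
    have <- : f' *m e = f' by rewrite def_e mulmxDr ff' f'0 add0r.
    exact: submxMl.
  have /submxP[X defX] := submx_trans sf'e eqfe.
  by rewrite -ff' {1}defX -mulmxA f0 mulmx0.
exists e => //; split=> [//||f f' cf cf' ff' def_e].
  apply/eqP=> e0; move: e1; rewrite /in_block e0 linear0 => /matrixP/(_ 0 0)/eqP.
  by rewrite !mxE eq_sym oner_eq0.
have [/center_mxP[kGf cGf] fi] := cf; have [/center_mxP[kGf' _] fi'] := cf'.
have [f0|f1] := trivial_idempotent kGf fi; last by right; apply: dead def_e f1.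
left; apply: (dead f' f) => //; [by rewrite cGf | by rewrite addrC |].
by rewrite /in_block -e1 def_e linearD /= f0 add0r.
Qed.

End CentralIdempotents.

Section PrincipalBlock.
Local Open Scope ring_scope.

Variables (k : closedFieldType) (gT : finGroupType) (G V : {group gT}).
Variable M : representation k G.
Hypotheses (char2 : 2%N \in [pchar k]) (indM : indecomposable M) (sVG : V \subset G).
Hypothesis minV : forall U : {group gT},
  relatively_projective U M -> U \subset V -> U :=: V.
Local Notation n := (rdegree M).
Local Notation lam := some_eigenvalue.
Local Notation aG := (regular_repr k G).

(** Let z be the element of kG with coefficients a, and write ^# for adjoints.
    In i^# z^# z i the terms indexed by (x, y) and (y, x) are adjoint to each
    other, so what survives is i^# i times the square of the augmentation. *)
Lemma class_sum_nonzero (B : 'M[k]_n) (Z : representation k V) (i : 'M_(n, rdegree Z))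
    (C : 'M_(rdegree Z)) (a : gT -> k) :
    G_form B -> is_source sVG M Z -> G_form (M := Z) C ->
    kG_hom (M := Z) (N := Res sVG M) i -> adjoint C B i *m i = 1%:M ->
    {in G &, forall x y, a (x ^ y)%g = a x} -> \sum_(x in G) a x = 1 ->
  \sum_(x in G) a x *: M x != 0.
Proof.
move=> formB srcZ formC Hi ii class_a aug1.
have [indZ _] := srcZ; have muP := source_brauer minV srcZ.
have UB := form_unit formB; have Hi' := adjoint_hom formB formC Hi.
set i' := adjoint C B i in ii Hi'.
set E := \sum_(x in G) a x *: M x.
pose E' := \sum_(x in G) a x *: M x^-1%g.
apply/eqP=> E0.
have actJ : [acts V, on G | 'J] by rewrite astabsJ (subset_trans sVG) ?normG.
have gM v x : v \in V -> x \in G -> gconj M v (M x) = M (x ^ v^-1)%g.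
  move=> Vv Gx; have Gv := subsetP sVG v Vv.
  by rewrite /gconj -!repr_mxM ?groupM ?groupV // conjgE invgK mulgA.
pose fixJ := [set x in G | x \in 'Fix_('J)(V)].
have fixP x : x \in fixJ -> x \in G /\ forall v, v \in V -> (x ^ v)%g = x.
  by rewrite inE => /andP[Gx /afixP fx].
have sumfix (F : gT -> k) : \sum_(x in G | x \in 'Fix_('J)(V)) F x = \sum_(x in fixJ) F x.
  by apply: eq_bigl => x; rewrite [RHS]inE.
pose b x y := a x * a y * lam (i' *m (M x^-1%g *m M y) *m i).
have fE' : fixed_by M V E'.
  apply: fixed_by_gconj => // v Vv; have Gv := subsetP sVG v Vv.
  rewrite /E' gconj_sum [RHS](reindex_acts 'J _ (groupVr Gv)) ?astabsJ ?normG //=.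
  by apply: eq_bigr => x Gx; rewrite gconjZ gM ?groupV // class_a ?groupV // conjVg.
have sumb : \sum_(y in fixJ) \sum_(x in fixJ) b x y = 0.
  pose F y := a y *: (i' *m (E' *m M y) *m i).
  have sumF : \sum_(y in G) F y = 0.
    have -> : \sum_(y in G) F y = i' *m (E' *m E) *m i.
      rewrite /E !mulmx_sumr mulmx_suml; apply: eq_bigr => y _.
      by rewrite -!scalemxAr -scalemxAl.
    by rewrite E0 !(mulmx0, mul0mx).
  have := brauer_orbit_sum muP (to := 'J%act) actJ (F := F).
  rewrite sumF (lam0 indZ) sumfix => h; rewrite [RHS]h => [|y v Gy Vv]; last first.
    have Gv := subsetP sVG v Vv; rewrite /F /= class_a ?groupV // gconjZ.
    rewrite -(gconj_sandwich_in Hi Hi') // gconj_mul // (gconj_fixed Gv Vv fE').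
    by rewrite gM.
  apply: eq_bigr => y /fixP[Gy fy] {h}.
  pose F' x := (a x * a y) *: (i' *m (M x^-1%g *m M y) *m i).
  have -> : F y = \sum_(x in G) F' x.
    rewrite /F /E' mulmx_suml mulmx_sumr mulmx_suml scaler_sumr; apply: eq_bigr => x _.
    by rewrite /F' -scalemxAl -scalemxAr -scalemxAl scalerA mulrC.
  rewrite (brauer_orbit_sum muP (to := 'J%act) actJ (F := F')); last first.
    move=> x v Gx Vv; have Gv := subsetP sVG v Vv; rewrite /F' /= class_a ?groupV // gconjZ.
    rewrite -(gconj_sandwich_in Hi Hi') // gconj_mul // !gM ?groupV // conjVg.
    by rewrite [(y ^ _)%g]fy // groupV.
  rewrite sumfix; apply: eq_bigr => x /fixP[Gx fx].
  rewrite /F' /b (lamZ indZ) //; apply: inner_hom => // v Vv.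
  have Gv := subsetP sVG v Vv; rewrite -!repr_mxM ?groupM ?groupV //; congr (M _).
  have cx : (x^-1 * v = v * x^-1)%g by rewrite conjgC conjVg fx.
  have cy : (y * v = v * y)%g by rewrite conjgC fy.
  by rewrite -mulgA cy mulgA cx mulgA.
have symb : {in fixJ &, forall x y, b x y = b y x}.
  move=> x y /fixP[Gx fx] /fixP[Gy fy]; rewrite /b [a x * _]mulrC; congr (_ * _).
  have fxy : fixed_by M V (M x^-1%g *m M y).
    move=> v Vv; have Gv := subsetP sVG v Vv; rewrite -!repr_mxM ?groupM ?groupV //; congr (M _).
    have cx : (x^-1 * v = v * x^-1)%g by rewrite conjgC conjVg fx.
    have cy : (y * v = v * y)%g by rewrite conjgC fy.
    by rewrite -mulgA cy mulgA cx mulgA.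
  rewrite -(lam_adjoint indZ formC); last exact: inner_hom.
  rewrite (inner_adjoint formB formC) -/i' (adjointM _ _ _ _ UB) !(adjoint_repr formB) ?groupV //.
  by rewrite invgK.
have symb' : {in fixJ &, forall y x, b x y = b y x}.
  by move=> y x Jy Jx; apply: symb.
move: (etrans (esym (sum_symmetric char2 symb')) sumb).
have -> : \sum_(x in fixJ) b x x = \sum_(x in fixJ) a x * a x.
  apply: eq_bigr => x /fixP[Gx _].
  by rewrite /b -repr_mxM ?groupV // mulVg repr_mx1 mulmx1 ii (lam1 indZ) mulr1.
suff -> : \sum_(x in fixJ) a x * a x = 1 by move/eqP; rewrite oner_eq0.
have -> : \sum_(x in fixJ) a x * a x = \sum_(x in fixJ) lam ((a x * a x)%:M : 'M_(rdegree Z)).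
  by apply: eq_bigr => x _; rewrite (lam_scalar indZ).
rewrite -sumfix -(brauer_orbit_sum muP (to := 'J%act) (F := fun x => (a x * a x)%:M)) //; last first.
  move=> x v Gx Vv; have Gv := subsetP sVG v Vv; rewrite /= class_a ?groupV //.
  by rewrite /gconj scalar_mxC -mulmxA -repr_mxM ?groupV // mulgV repr_mx1 mulmx1.
rewrite -raddf_sum (lam_scalar indZ) /=.
rewrite -(sum_symmetric char2 (F := fun x y => a x * a y)); last by move=> x y _ _; rewrite mulrC.
by under eq_bigr do rewrite -mulr_sumr aug1 mulr1.
Qed.

Lemma principal_block_of_form : has_form_nondegenerate_on_source sVG M -> in_principal_block M.
Proof.
move=> [B [Z [i [formB [srcZ [Hi _]] /nondegenerate_onE UC]]]].
have formC := form_on_summand formB Hi UC.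
have ii : adjoint (i^T *m B *m i) B i *m i = 1%:M.
  by rewrite /adjoint -!mulmxA mulVmx // !mulmxA.
have [e be e1] := principal_block_exists k G; exists e; split=> //.
have [[Ze ee] _ _] := be; have [a defe class_a] := central_class_function Ze.
have opE (N : representation k G) : gring_op N e = \sum_(x in G) a x *: N x.
  by rewrite defe linear_sum; apply: eq_bigr => x Gx; rewrite linearZ /= gring_opG.
have aug1 : \sum_(x in G) a x = 1.
  have := e1; rewrite /in_block opE => /matrixP/(_ 0 0).
  rewrite [RHS]mxE eqxx mulr1n summxE => <-.
  by apply: eq_bigr => x _; rewrite !mxE eqxx mulr1n mulr1.
have nz := class_sum_nonzero formB srcZ formC Hi ii class_a aug1; rewrite -opE in nz.
have [kGe cGe] := center_mxP Ze.
have He : kG_hom (M := M) (N := M) (gring_op M e).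
  move=> g Gg; have kGg : (aG g \in group_ring k G)%MS by apply: envelop_mx_id.
  by rewrite -(gring_opG M Gg) -!gring_opM // cGe.
have ide : gring_op M e *m gring_op M e = gring_op M e by rewrite -gring_opM // ee.
have [z|//] := idempotent_indecomposable indM He ide.
by rewrite z eqxx in nz.
Qed.

End PrincipalBlock.

(** * The theorem *)

Lemma vertex_below (k : fieldType) (gT : finGroupType) (G T : {group gT})
    (M : representation k G) :
  relatively_projective T M ->
  exists V : {group gT}, Green_vertex M V /\ V \subset T.
Proof.
move=> projT.
pose P d := exists V : {group gT}, [/\ relatively_projective V M, V \subset T & #|V| = d].
have exP : exists d, boolp.asbool (P d).
  by exists #|T|; apply/boolp.asboolP; exists T.
case: (ex_minnP exP) => d /boolp.asboolP[V [projV sVT cardV]] mind.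
exists V; split=> //; split=> // U projU sUV.
apply/eqP; rewrite eqEcard sUV cardV mind //.
by apply/boolp.asboolP; exists U; split=> //; apply: subset_trans sVT.
Qed.

Lemma self_dual_of_form (k : fieldType) (gT : finGroupType) (V : {group gT})
    (Z : representation k V) (C : 'M[k]_(rdegree Z)) :
  G_form C -> self_dual Z.
Proof.
move=> formC; have UC := form_unit formC.
have UCi : invmx C \in unitmx by rewrite unitmx_inv.
apply: (@MxReprSim _ _ _ _ _ _ _ (invmx C)) => //; first by rewrite row_free_unit.
move=> v Vv /=; apply: (can_inj (mulmxK UC)).
by rewrite mulmxKV // -mulmxA -(form_mul formC Vv) mulKmx.
Qed.

Theorem theorem1p2 (k : closedFieldType) (gT : finGroupType) (G : {group gT})
    (M : representation k G) (T : {group gT}) :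
    (2%N \in [pchar k])%R -> 2 %| #|G| ->
    indecomposable M -> symmetric_type M -> symmetric_vertex M T ->
  exists (V : {group gT}) (sVG : V \subset G),
    [/\ Green_vertex M V, V \subset T, #|T : V|%g <= 2,
        exactly_one
          (has_form_nondegenerate_on_source sVG M)
          (sources_self_dual sVG M /\ forms_degenerate_on_sources sVG M)
          (sources_not_self_dual sVG M)
      & [/\ has_form_nondegenerate_on_source sVG M ->
              T :=: V /\ in_principal_block M,
            sources_self_dual sVG M /\ forms_degenerate_on_sources sVG M ->
              #|T : V|%g = 2
          & sources_not_self_dual sVG M -> #|T : V|%g = 2]].
Proof.
move=> char2 _ indM symM vertT; have [B formB] := symM.
have [symT minT] := vertT.
have [sTG [x [fx _ Ux]]] := (symmetrically_projectiveP T formB).1 symT.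
have [V [[projV minV] sVT]] := vertex_below (reltr_unit_projective sTG fx Ux).
have sVG := subset_trans sVT sTG.
have leTV := vertex_index_le2 char2 indM sVG projV minV formB vertT sVT.
have eqTV : symmetrically_projective V M -> T :=: V.
  by move=> symV; apply/esym/minT.
have formP : #|T : V| = 1%N -> has_form_nondegenerate_on_source sVG M.
  move=> /eqP; rewrite indexg_eq1 => sTV; have eTV : T = V.
    by apply/val_inj/eqP; rewrite eqEsubset sTV.
  by apply: projective_nondegenerate_source => //; rewrite -eTV.
have noform : ~ has_form_nondegenerate_on_source sVG M -> #|T : V| = 2.
  move=> nP; apply/eqP; rewrite eqn_leq leTV ltn_neqAle indexg_gt0 andbT.
  by apply/eqP=> e; case: nP; apply: formP.
have [Z0 srcZ0] := source_exists indM sVG projV.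
have sdP : has_form_nondegenerate_on_source sVG M ->
    exists2 Z : representation k V, is_source sVG M Z & self_dual Z.
  move=> [C [Z [i [formC [srcZ [Hi _]] /nondegenerate_onE UC]]]]; exists Z => //.
  exact: self_dual_of_form (form_on_summand formC Hi UC).
have allsd (Z : representation k V) : is_source sVG M Z -> self_dual Z -> sources_self_dual sVG M.
  by move=> srcZ sdZ Z' srcZ'; apply: (source_self_dual indM minV srcZ' srcZ).
have degP : ~ has_form_nondegenerate_on_source sVG M <-> forms_degenerate_on_sources sVG M.
  split=> [nP C formC Z i srci ndi | deg [C [Z [i [formC srci ndi]]]]].
    by apply: nP; exists C, Z, i.
  exact: deg C formC Z i srci ndi.
have nQR : ~ (sources_self_dual sVG M /\ sources_not_self_dual sVG M).
  by case=> Q R; apply: (R Z0 srcZ0); apply: Q.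
exists V, sVG; split=> //.
  have [P | nP] := boolp.EM (has_form_nondegenerate_on_source sVG M).
    have [Z srcZ sdZ] := sdP P; apply: Or31; split=> // [[_ /degP] // | R].
    exact: R Z srcZ sdZ.
  have deg := degP.1 nP.
  have [[Z srcZ sdZ] | nsd] :=
    boolp.EM (exists2 Z : representation k V, is_source sVG M Z & self_dual Z).
    have Q := allsd Z srcZ sdZ; apply: Or32; split=> // R; exact: nQR.
  have R : sources_not_self_dual sVG M by move=> Z srcZ sdZ; apply: nsd; exists Z.
  by apply: Or33; split=> // -[Q _]; apply: nQR.
split=> [P | [_ /degP] | R]; [split | exact: noform |].
- exact/eqTV/nondegenerate_source_projective.
- exact: principal_block_of_form P.
by apply: noform => /sdP[Z srcZ sdZ]; apply: R Z srcZ sdZ.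
Qed.
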